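(* Let $\Phi$ be an irreducible crystallographic root system of one of the classical types $A_r$, $B_r$, $C_r$ or $D_r$, of rank $r$, with a fixed choice of simple roots $\{\alpha_1,\ldots,\alpha_r\}$, positive roots $\Phi^+$ and Coxeter number $h$. Let $\operatorname{Rvac}\colon\mathcal{A}(\Phi^+)\to\mathcal{A}(\Phi^+)$ be rowvacuation on the root poset $\Phi^+$. Then $\operatorname{Rvac}$ is an involution, and for every antichain $A\in\mathcal{A}(\Phi^+)$: (i) $\#A+\#\operatorname{Rvac}(A)=r$; (ii) the numbers of long roots and of short roots in the multiset union $A\uplus\operatorname{Rvac}(A)$ are the same as the numbers of long roots and of short roots among the simple roots $\{\alpha_1,\ldots,\alpha_r\}$; (iii) if $A=\Phi^+_i$ for some $0\le i\le h-1$, then $\operatorname{Rvac}(A)=\Phi^+_{h-1-i}$; (iv) if $A$ contains a simple root $\alpha$, then $\operatorname{Rvac}(A)=\operatorname{Rvac}_{(\Phi')^+}(A\setminus\{\alpha\})$, where $\Phi'$ is the maximal parabolic sub-root system obtained by removing $\alpha$ from the simple system; (v) if $A\subseteq(\Phi')^+$, where $\Phi'$ is the maximal parabolic sub-root system obtained by removing some simple root $\alpha$ from the simple system, then $\operatorname{Rvac}(A)=\{\alpha\}\cup\operatorname{Rvac}_{(\Phi')^+}(A)$.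
   Context: All posets are finite. A poset $P$ is ranked if there is a function $\mathrm{rk}\colon P\to\mathbb{N}$ with $\mathrm{rk}(p)=0$ for every minimal element $p$ and $\mathrm{rk}(y)=\mathrm{rk}(x)+1$ whenever $y$ covers $x$; $\mathrm{rk}(P)$ is the maximum value of $\mathrm{rk}$ and $P_i=\{p\in P:\mathrm{rk}(p)=i\}$ (empty unless $0\le i\le \mathrm{rk}(P)$). $\mathcal{A}(P)$ is the set of antichains of $P$. For $p\in P$, the toggle $\tau_p\colon\mathcal{A}(P)\to\mathcal{A}(P)$ is $\tau_p(A)=A\setminus\{p\}$ if $p\in A$, $\tau_p(A)=A\cup\{p\}$ if $p\notin A$ and $A\cup\{p\}$ is an antichain, and $\tau_p(A)=A$ otherwise. For $0\le i\le \mathrm{rk}(P)$ the rank toggle $\boldsymbol{\tau}_i$ is the composite of the (pairwise commuting) toggles $\tau_p$, $p\in P_i$. With $R=\mathrm{rk}(P)$ and composition applied right to left, rowvacuation is $\operatorname{Rvac}_P=(\boldsymbol{\tau}_R)(\boldsymbol{\tau}_R\boldsymbol{\tau}_{R-1})\cdots(\boldsymbol{\tau}_R\cdots\boldsymbol{\tau}_1)(\boldsymbol{\tau}_R\cdots\boldsymbol{\tau}_0)$. The root poset $\Phi^+$ is ordered by $\alpha\le\beta$ iff $\beta-\alpha$ is a nonnegative integer combination of simple roots; it is ranked with $\mathrm{rk}(\alpha)=\mathrm{height}(\alpha)-1$, where the height of $\sum_i a_i\alpha_i$ is $\sum_i a_i$; $\Phi^+_i$ denotes its set of elements of rank $i$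 (so $\Phi^+_0$ is the set of simple roots and $\Phi^+_{h-1}=\varnothing$). For a simple root $\alpha$, the positive roots of the maximal parabolic sub-root system $\Phi'$ obtained by removing $\alpha$ form the subposet $(\Phi')^+=\{\beta\in\Phi^+:\beta\not\ge\alpha\}$, with the restricted order and rank function, and $\operatorname{Rvac}_{(\Phi')^+}$ is rowvacuation on it. In the simply laced types $A$ and $D$ all roots are considered to have the same length (so (ii) is automatic there). *)

(* Defs.v *)
From mathcomp Require Import all_boot all_order all_algebra.
From mathcomp Require Import finmap.
From mathcomp Require Import boolp.
From mathcomp Require classical_sets.

Set Implicit Arguments.
Unset Strict Implicit.
Unset Printing Implicit Defensive.

Import Order.TTheory GRing.Theory Num.Theory.
Local Open Scope ring_scope.

(* A finite poset is a subset [P] of a finite type [T], ordered by the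
   restriction of [le : rel T].  Subposets thus share [T], [le] and [rk] with
   the poset they come from. *)
Section Rowvacuation.
Variables (T : finType) (le : rel T) (rk : T -> nat) (P : {set T}).

Definition antichains : {set {set T}} :=
  [set A : {set T} | (A \subset P) &&
     [forall x in A, forall y in A, le x y ==> (x == y)]].

Definition rank_level (i : nat) : {set T} := [set x in P | rk x == i].

Definition poset_rank : nat := (\max_(x in P) rk x)%N.

Definition toggle (p : T) (A : {set T}) : {set T} :=
  if p \in A then A :\ p
  else if p |: A \in antichains then p |: A
  else A.

(* The toggles within one rank commute on antichains, so the order of
   [enum] is irrelevant. *)
Definition rank_toggle (i : nat) (A : {set T}) : {set T} :=
  foldr toggle A (enum (rank_level i)).

(* tau_R ... tau_(k+1) tau_k, with tau_k applied first. *)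
Definition rank_sweep (k : nat) (A : {set T}) : {set T} :=
  foldl (fun B i => rank_toggle i B) A (iota k (poset_rank.+1 - k)).

(* (tau_R)(tau_R tau_(R-1)) ... (tau_R ... tau_0), rightmost factor first. *)
Definition rowvacuation (A : {set T}) : {set T} :=
  foldl (fun B k => rank_sweep k B) A (iota 0 poset_rank.+1).

End Rowvacuation.

Section Euclidean.
Variables (R : realFieldType) (n : nat).
Implicit Types u v a : 'rV[R]_n.

Definition dotv u v : R := \sum_(i < n) u 0 i * v 0 i.

Definition coroot_pairing v a : R := 2 * dotv v a / dotv a a.

Definition reflection a v : 'rV[R]_n := v - coroot_pairing v a *: a.

(* Reduced crystallographic root systems. *)
Record is_root_system (Phi : {fset 'rV[R]_n}) : Prop := IsRootSystem {
  root_span : (<<enum_fset Phi>> = fullv)%VS;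
  root_neq0 : 0 \notin Phi;
  root_reduced : forall (a : Phi) (c : R),
    c *: fsval a \in Phi -> c = 1 \/ c = -1;
  root_reflection : forall a b : Phi, reflection (fsval a) (fsval b) \in Phi;
  root_crystallographic : forall a b : Phi,
    exists m : int, coroot_pairing (fsval b) (fsval a) = m%:~R }.

Variables (Phi : {fset 'rV[R]_n}) (r : nat) (alpha : 'I_r -> Phi).

Definition nat_comb (c : 'I_r -> nat) : 'rV[R]_n :=
  \sum_(i < r) fsval (alpha i) *+ c i.

Record is_simple_system : Prop := IsSimpleSystem {
  simple_free : free [seq fsval (alpha i) | i <- enum 'I_r];
  simple_comb : forall b : Phi, exists c : 'I_r -> nat,
    fsval b = nat_comb c \/ fsval b = - nat_comb c }.

Definition simple_roots : {set Phi} := [set alpha i | i : 'I_r].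

Definition pos_roots : {set Phi} :=
  [set b : Phi | `[< exists c : 'I_r -> nat, fsval b = nat_comb c >]].

Definition root_le : rel Phi := fun a b : Phi =>
  `[< exists c : 'I_r -> nat, fsval b - fsval a = nat_comb c >].

(* Meaningful on positive roots only (0 elsewhere); the value is unique there
   since the simple roots are linearly independent. *)
Definition height (b : Phi) : nat :=
  classical_sets.xget 0%N (fun k : nat => exists2 c : 'I_r -> nat,
    fsval b = nat_comb c & k = (\sum_(i < r) c i)%N).

Definition root_rank (b : Phi) : nat := (height b).-1.

(* The positive roots of the maximal parabolic subsystem obtained by removing
   the simple root [alpha k]: those not above [alpha k]. *)
Definition parabolic_pos_roots (k : 'I_r) : {set Phi} :=
  [set b in pos_roots | ~~ root_le (alpha k) b].

(* In the simply laced case every root is long and none is short. *)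
Definition long_root (b : Phi) : bool :=
  [forall g : Phi, dotv (fsval g) (fsval g) <= dotv (fsval b) (fsval b)].

Definition short_root (b : Phi) : bool := ~~ long_root b.

Definition coxeter_element (v : 'rV[R]_n) : 'rV[R]_n :=
  foldr (fun i w => reflection (fsval (alpha i)) w) v (enum 'I_r).

(* The order of [coxeter_element]; it does not depend on the order in which
   the simple reflections are multiplied. *)
Definition is_coxeter_number (h : nat) : Prop :=
  [/\ (0 < h)%N,
      forall v, iter h coxeter_element v = v
    & forall m : nat, (0 < m)%N ->
        (forall v, iter m coxeter_element v = v) -> (h <= m)%N].

End Euclidean.

Inductive classical_type := TypeA | TypeB | TypeC | TypeD.

Definition min_rank (X : classical_type) : nat :=
  match X with TypeA => 1 | TypeB => 2 | TypeC => 2 | TypeD => 3 end.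

(* Bourbaki's labelling shifted to start at 0; the entry at [i], [j] is
   2 (alpha_i, alpha_j) / (alpha_j, alpha_j).  The last simple root is short
   in type B and long in type C; in type D the last two are both joined to the
   one labelled [r - 3] (so D_3 is A_3). *)
Definition cartan_A (i j : nat) : int :=
  if i == j then 2 else if (i == j.+1) || (j == i.+1) then -1 else 0.

Definition edge_D (r i j : nat) : bool :=
  (j == i.+1) && (j.+1 < r)%N || (i.+3 == r) && (j.+1 == r).

Definition cartan_entry (X : classical_type) (r i j : nat) : int :=
  match X with
  | TypeA => cartan_A i j
  | TypeB => if (i.+2 == r) && (j.+1 == r) then -2 else cartan_A i j
  | TypeC => if (i.+1 == r) && (j.+2 == r) then -2 else cartan_A i j
  | TypeD => if i == j then 2
             else if edge_D r i j || edge_D r j i then -1 else 0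
  end.

Definition has_classical_type (R : realFieldType) (n : nat)
    (Phi : {fset 'rV[R]_n}) (r : nat) (alpha : 'I_r -> Phi)
    (X : classical_type) : Prop :=
  (min_rank X <= r)%N /\
  forall i j : 'I_r,
    coroot_pairing (fsval (alpha i)) (fsval (alpha j))
      = (cartan_entry X r i j)%:~R.

(* Main.v *)
Require Import Defs.
From mathcomp Require Import all_boot all_order all_algebra.
From mathcomp Require Import finmap.
From mathcomp Require Import boolp zify ring lra.
From mathcomp Require classical_sets.

(* Let [J_m] be the order ideal generated by the [m]-th iterate of rowmotion on
   an antichain [A].  A rank toggle moves one rank of a slice of the diagram
   [(J_m)_m] forward in time, so [Rvac A] is the set of minimal elements of the
   complement of the tilted slice [{x | x in J_(rk x)}].  This makes [Rvac] an
   involution with [Row Rvac Row = Rvac], exchanges the levels [i] and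
   [h - 1 - i], and gives (v) since roots above [alpha] never enter the tilted
   slice when [A] avoids them; (iv) is (v) composed with the involution.

   A relation between [A] and [Rvac A] can therefore be proved by induction on
   the support of [A], if it is preserved when a simple root is adjoined to
   [Rvac A] and when [(Row A, B)] is replaced by [(A, Row B)] for [A], [B] of
   full support: some antichain in the rowmotion orbit of [A] has smaller
   support.  The classical root posets are posets of intervals of a path, folded
   at its middle in types B, C and D, and the relation used for (i) and (ii) says
   that an interval of [A] starts at a node iff none of [Rvac A] ends there, with
   variants at the middle of the path.  Counting the starts and the ends in [A]
   and [Rvac A] gives the cardinality, and the lengths are read off the middle
   column (type B) and the self-dual intervals (type C). *)

Set Implicit Arguments.
Unset Strict Implicit.
Unset Printing Implicit Defensive.

Import Order.TTheory GRing.Theory Num.Theory.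

(** The relation between [A] and [Rvac A] has to make sense on every support [K], since the
    induction passes through all parabolic subsystems. Removing nodes cuts the path, and in type D
    it may leave a single copy of the middle node; hence the three clauses of [paired]. What drives
    the induction is a signal: a right end at [k] in an antichain of full support becomes a right
    end at [k + 1] after rowmotion, is reflected at the middle when all its copies are present, and
    comes back as a left end moving down. No signal enters at the first node of a run, yet a left
    end is always present there, so an orbit cannot keep full support. The obstacle is type D:
    adjoining the second copy of the middle node may break the clause at the middle. The failure is
    explicit and puts a simple root in [A]; rowmotion on an antichain of full support yields no
    simple root, so the failure does not survive a step, and the cardinality is right in that case
    too. The constants found are matched with the simple roots by evaluation at the empty antichain,
    which rowvacuation sends to the set of simple roots. *)

Section RankedPoset.
Variables (T : finType) (le : rel T) (rk : T -> nat).
Hypotheses (le_refl : reflexive le) (le_anti : antisymmetric le)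
  (le_trans : transitive le).

(** The element [z] just below [y] may be [x] itself. As [z] lies below [y], the condition passes at
    once to down-closed subposets, such as those of parabolic subsystems. *)
Definition graded (P : {set T}) := forall x y, x \in P -> y \in P ->
  le x y -> x != y -> exists z, [/\ z \in P, le x z, le z y & rk y = (rk z).+1].

(** * Ideals along a rowmotion orbit and their slices *)

Section Fixed.
Variables (P : {set T}) (gP : graded P).

Definition minimals (X : {set T}) : {set T} :=
  [set x in X | [forall y in X, le y x ==> (y == x)]].

Definition down (A : {set T}) : {set T} :=
  [set x in P | [exists y in A, le x y]].

Definition rowmotion (A : {set T}) : {set T} := minimals (P :\: down A).

Definition orbit_ideal (A : {set T}) (m : nat) : {set T} := down (iter m rowmotion A).

Definition tilted_ideal (A : {set T}) (c : nat) : {set T} :=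
  [set x in P | x \in orbit_ideal A (rk x + c)].

Lemma antichainP (A : {set T}) :
  reflect (A \subset P /\ {in A &, forall x y, le x y -> x = y})
    (A \in antichains le P).
Proof.
rewrite inE; apply: (iffP andP) => -[AP h]; split=> //.
  move=> x y xA yA xy; have /forall_inP/(_ x xA)/forall_inP/(_ y yA) := h.
  by rewrite xy => /eqP.
apply/forall_inP=> x xA; apply/forall_inP=> y yA; apply/implyP=> xy.
by apply/eqP; apply: h.
Qed.

Lemma minimalsP (X : {set T}) x :
  reflect (x \in X /\ forall y, y \in X -> le y x -> y = x) (x \in minimals X).
Proof.
rewrite inE; apply: (iffP andP) => -[xX h]; split=> //.
  by move=> y yX yx; have /forall_inP/(_ y yX) := h; rewrite yx => /eqP.
by apply/forall_inP=> y yX; apply/implyP=> yx; apply/eqP; apply: h.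
Qed.

Lemma downP (A : {set T}) x :
  reflect (x \in P /\ exists2 y, y \in A & le x y) (x \in down A).
Proof.
rewrite inE; apply: (iffP andP) => -[xX h]; split=> //.
  by have /exists_inP := h.
by apply/exists_inP.
Qed.

Lemma rk_lt x y : x \in P -> y \in P -> le x y -> x != y -> rk x < rk y.
Proof.
move: {2}(rk y) (leqnn (rk y)) => N; elim: N x y => [|N IH] x y rN xP yP xy nxy.
  by have [z [_ _ _ e]] := gP xP yP xy nxy; rewrite e in rN.
have [z [zP xz zy e]] := gP xP yP xy nxy.
have [-> | nxz] := eqVneq x z; first by rewrite e.
rewrite e; apply: ltnW; rewrite ltnS; apply: IH => //.
by move: rN; rewrite e.
Qed.

Lemma rk_le x y : x \in P -> y \in P -> le x y -> rk x <= rk y.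
Proof.
by move=> xP yP xy; have [-> //| nxy] := eqVneq x y; apply/ltnW/rk_lt.
Qed.

Lemma le_eq_rk x y : x \in P -> y \in P -> le x y -> rk y <= rk x -> x = y.
Proof.
move=> xP yP xy r; have [//| nxy] := eqVneq x y.
by have := rk_lt xP yP xy nxy; rewrite ltnNge r.
Qed.

Lemma upper_cover x y : x \in P -> y \in P -> le x y -> x != y ->
  exists z, [/\ z \in P, le x z, le z y, x != z & rk z = (rk x).+1].
Proof.
move: {2}(rk y) (leqnn (rk y)) => N; elim: N y => [|N IH] y rN xP yP xy nxy.
  by have := leq_trans (rk_lt xP yP xy nxy) rN; rewrite ltn0.
have [z [zP xz zy e]] := gP xP yP xy nxy.
have [exz | nxz] := eqVneq x z; first by exists y; split; rewrite // e exz.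
have [|w [wP xw wz nxw rw]] := IH z _ xP zP xz nxz; first by move: rN; rewrite e.
by exists w; split=> //; apply: le_trans wz zy.
Qed.

Lemma minimal_below (X : {set T}) x : X \subset P -> x \in X ->
  exists2 y, y \in minimals X & le y x.
Proof.
move=> XP xX; pose Q y := (y \in X) && le y x.
have Qx : Q x by rewrite /Q xX le_refl.
case: (arg_minnP rk Qx) => y /andP[yX yx] my; exists y => //.
apply/minimalsP; split=> // z zX zy; apply: le_eq_rk; rewrite ?(subsetP XP) //.
by apply: my; rewrite /Q zX (le_trans zy yx).
Qed.

Definition down_closed (H : {set T}) :=
  H \subset P /\ forall x y, x \in P -> y \in H -> le x y -> x \in H.

Lemma down_downclosed A : down_closed (down A).
Proof.
split=> [|x y xP /downP[_ [z zA yz]] xy]; first by apply/subsetP=> x /downP[].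
by apply/downP; split=> //; exists z => //; apply: le_trans xy yz.
Qed.

Lemma maximal_above (H : {set T}) x : H \subset P -> x \in H ->
  exists y, [/\ y \in H, le x y & forall z, z \in H -> le y z -> z = y].
Proof.
move=> HP xH.
pose Q y := (y \in H) && le x y.
have Qx : Q x by rewrite /Q xH le_refl.
case: (arg_maxnP rk Qx) => y /andP[yH xy] my; exists y; split=> // z zH yz; apply/esym.
apply: le_eq_rk; rewrite ?(subsetP HP) //; apply: my.
by rewrite /Q zH (le_trans xy yz).
Qed.

Lemma minimals_antichain (X : {set T}) : X \subset P -> minimals X \in antichains le P.
Proof.
move=> XP; apply/antichainP; split.
  by apply/subsetP=> x /minimalsP[xX _]; apply: (subsetP XP).
by move=> x y /minimalsP[xX _] /minimalsP[_ my] xy; apply: my.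
Qed.

Lemma row_antichain A : rowmotion A \in antichains le P.
Proof. by apply: minimals_antichain; rewrite subsetDl. Qed.

Lemma iter_row_antichain A m : A \in antichains le P ->
  iter m rowmotion A \in antichains le P.
Proof. by move=> hA; case: m => [|m] //=; apply: row_antichain. Qed.

Lemma antichain_sub_down A : A \in antichains le P -> A \subset down A.
Proof.
move=> /antichainP[AP _]; apply/subsetP=> x xA; apply/downP.
by split; [apply: (subsetP AP) | exists x].
Qed.

Lemma mem_antichain_down A x : A \in antichains le P -> x \in A <->
  x \in down A /\ forall y, y \in down A -> le x y -> y = x.
Proof.
move=> hA; have /antichainP[AP anti] := hA; split.
  move=> xA; split; first by apply: (subsetP (antichain_sub_down hA)).
  move=> y /downP[yP [z zA yz]] xy.
  have xz := anti _ _ xA zA (le_trans xy yz).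
  by apply: le_anti; rewrite xy xz yz.
case=> /downP[xP [y yA xy]] h.
by rewrite -(h y) //; apply: (subsetP (antichain_sub_down hA)).
Qed.

Lemma mem_row A x : x \in rowmotion A <->
  [/\ x \in P, x \notin down A & forall y, y \in P -> le y x -> y != x -> y \in down A].
Proof.
split=> [/minimalsP[]|[xP xA h]].
  rewrite inE => /andP[xA xP] h; split=> // y yP yx nyx.
  apply: contraNT nyx => yA; apply/eqP; apply: h => //.
  by rewrite inE yP yA.
apply/minimalsP; rewrite inE xP xA; split=> // y; rewrite inE => /andP[yA yP] yx.
by apply/eqP; apply: contraNT yA => /(h _ yP yx).
Qed.

(** The minimal elements generate the complement of the ideal and so determine the ideal, and an
    antichain is recovered as the set of maximal elements of its ideal. *)
Lemma row_inj : {in antichains le P &, injective rowmotion}.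
Proof.
have h A B : rowmotion A = rowmotion B -> down A \subset down B.
  move=> e; apply/subsetP=> x xA; have xP : x \in P by case/downP: xA.
  apply: contraT => xB.
  have [|y] := minimal_below (X := P :\: down B) (x := x) (subsetDl _ _).
    by rewrite inE xB xP.
  rewrite -/(rowmotion B) -e => /mem_row[yP yA _] yx.
  by move: yA; rewrite (proj2 (down_downclosed A) _ x).
move=> A B hA hB e; have eD : down A = down B.
  by apply/eqP; rewrite eqEsubset !h.
apply/setP=> x; apply/idP/idP.
  by move=> /(mem_antichain_down _ hA); rewrite eD => /(mem_antichain_down _ hB).
by move=> /(mem_antichain_down _ hB); rewrite -eD => /(mem_antichain_down _ hA).
Qed.

Lemma row_preimage A m : A \in antichains le P ->
  exists2 A0, A0 \in antichains le P & iter m rowmotion A0 = A.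
Proof.
(* Extended by the identity off antichains, rowmotion is an injective self-map of a finite type,
   hence a permutation, whose inverse supplies preimages. *)
pose f B := if B \in antichains le P then rowmotion B else B.
have f_inj : injective f.
  move=> B C; rewrite /f; case: ifP => hB; case: ifP => hC //; first exact: row_inj.
  - by move=> e; rewrite -e row_antichain in hC.
  - by move=> e; rewrite e row_antichain in hB.
move=> hA; have h B : B \in antichains le P -> exists2 C, C \in antichains le P & rowmotion C = B.
  move=> hB; have e := f_finv f_inj B; move: e; rewrite /f; case: ifP => hC e.
    by exists (finv f B).
  by rewrite -e hC in hB.
elim: m => [|m [B hB eB]]; first by exists A.
by have [C hC eC] := h B hB; exists C => //; rewrite iterSr eC.
Qed.

Lemma orbit_ideal_le A m x y : y \in orbit_ideal A m -> x \in P -> le x y ->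
  x \in orbit_ideal A m.
Proof. by move=> yI xP xy; apply: (proj2 (down_downclosed _)) xP yI xy. Qed.

(** The generators at time [m.+1] are minimal outside the ideal at time [m], so everything strictly
    below them was already inside: one strict step down pays for one step back in time. *)
Lemma orbit_idealS A m x y : y \in orbit_ideal A m.+1 -> x \in P -> le x y -> x != y ->
  x \in orbit_ideal A m.
Proof.
move=> /downP[yP [z zr yz]] xP xy nxy.
have /= /mem_row[zP _ h] := zr; apply: h => //; first exact: le_trans xy yz.
apply: contraNneq nxy => exz; apply/eqP; apply: le_anti.
by rewrite xy exz yz.
Qed.

(* The horizontal slice of the diagram at time 0 for [k = 0], the tilted one for large [k]. *)
Definition slice_ideal A k := [set x in P | x \in orbit_ideal A (minn (rk x) k)].

(** Closure is checked one cover at a time. Along a cover the time [f] changes by 0 or by 1, and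
    [orbit_ideal_le] and [orbit_idealS] settle these two cases. *)
Lemma profile_down_closed A (f : nat -> nat) :
  (forall i, f i.+1 = f i \/ f i.+1 = (f i).+1) ->
  down_closed [set x in P | x \in orbit_ideal A (f (rk x))].
Proof.
move=> hf; split=> [|x y xP yH xy]; first by apply/subsetP=> x; rewrite inE => /andP[].
move: {2}(rk y) (leqnn (rk y)) => N; elim: N y yH xy => [|N IH] y yH xy rN.
all: have [-> //| nxy] := eqVneq x y.
all: have yP : y \in P by move: yH; rewrite inE => /andP[].
  by have := leq_trans (rk_lt xP yP xy nxy) rN; rewrite ltn0.
have [z [zP xz zy e]] := gP xP yP xy nxy.
apply: (IH z) => //; last by move: rN; rewrite e.
have nzy : z != y by apply: contraPneq (n_Sn (rk z)) => ezy; rewrite -e ezy.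
move: yH; rewrite inE yP /= e inE zP /=; case: (hf (rk z)) => -> yH.
  exact: orbit_ideal_le yH zP zy.
exact: orbit_idealS yH zP zy nzy.
Qed.

Lemma tilted_down_closed A c : down_closed (tilted_ideal A c).
Proof. by apply: (@profile_down_closed A (fun i => i + c)) => i; right. Qed.

Lemma slice_down_closed A k : down_closed (slice_ideal A k).
Proof.
apply: (@profile_down_closed A (fun i => minn i k)) => i.
by case: (leqP k i) => h; [left; lia | right; lia].
Qed.

(** Rowmotion thus sends the antichain attached to the offset [c.+1] to the one attached to [c]: on
    tilted slices it runs backwards in time. This is the source of the conjugation of rowmotion into
    its inverse. *)
Lemma tilt A c : down (minimals (P :\: tilted_ideal A c.+1)) = tilted_ideal A c.
Proof.
have [_ dW] := tilted_down_closed A c; have [_ dW1] := tilted_down_closed A c.+1.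
apply/setP=> p; apply/idP/idP.
  move=> /downP[pP [x /minimalsP[]]]; rewrite inE => /andP[+ xP] h px.
  rewrite inE xP /= => xN; apply: dW (px) => //; rewrite inE xP /=.
  apply: contraT => xN1; move: xN; rewrite addnS => /negP[].
  apply/downP; split=> //; exists x => //=; apply/mem_row; split=> // y yP yx nyx.
  have [z [zP yz zx e]] := gP yP xP yx nyx.
  suff: z \in orbit_ideal A (rk x + c) by move=> zI; apply: orbit_ideal_le zI yP yz.
  apply: contraT => zN; suff ezx: z = x by move: e; rewrite ezx => /n_Sn.
  by apply: h => //; rewrite inE zP andbT inE zP /= addnS -addSn -e.
rewrite inE => /andP[pP pW].
(* Take [x] of largest rank in the slice above [p]. Were [x] still in the ideal one step later, it
   would lie strictly below a new generator, and an upper cover of [x] would belong to the slice as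
   well. *)
pose Q y := (y \in tilted_ideal A c) && le p y.
have Qp : Q p by rewrite /Q inE pP pW le_refl.
case: (arg_maxnP rk Qp) => x /andP[xW px] mx; have xP : x \in P by move: xW; rewrite inE => /andP[].
apply/downP; split=> //; exists x => //; apply/minimalsP; split.
  rewrite inE xP andbT inE xP /=; apply/negP => /downP[_ [q]].
  rewrite addnS /= => qr xq.
  have [qP qN _] := iffLR (mem_row _ _) qr.
  have nxq : x != q.
    by apply: contraNneq qN => <-; move: xW; rewrite inE xP.
  have [z [zP xz zq nxz e]] := upper_cover xP qP xq nxq.
  have := mx z; rewrite /Q inE zP (le_trans px xz) andbT /= e => h.
  suff: (rk x).+1 <= rk x by rewrite ltnn.
  by apply: h; apply/downP; split=> //; exists q; rewrite ?addSn.
move=> y; rewrite inE => /andP[+ yP] yx; rewrite inE yP /= => yN.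
apply/eqP; apply: contraNT yN => nyx.
have [z [zP yz zx e]] := gP yP xP yx nyx.
suff zW1 : z \in tilted_ideal A c.+1.
  by have := dW1 y z yP zW1 yz; rewrite inE yP.
rewrite inE zP /= addnS -addSn -e.
move: xW; rewrite inE xP /= => xI.
exact: orbit_ideal_le xI zP zx.
Qed.

(** * Toggles, sweeps and the slice formula for rowvacuation *)

Lemma toggle_antichain p A : A \in antichains le P -> toggle le P p A \in antichains le P.
Proof.
rewrite /toggle => hA; case: ifP => // pA; last by case: ifP.
have /antichainP[AP anti] := hA; apply/antichainP; split.
  by apply: subset_trans AP; rewrite subD1set.
by move=> x y /setD1P[_ xA] /setD1P[_ yA]; apply: anti.
Qed.

(** Distinct elements of one rank are incomparable, so their toggles do not see one another, and
    whether an element may enter depends only on the part of [A] off that rank. *)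
Lemma foldr_toggle (s : seq T) i A : uniq s -> {subset s <= rank_level rk P i} ->
  A \in antichains le P ->
  foldr (toggle le P) A s \in antichains le P /\
  forall x, (x \in foldr (toggle le P) A s) =
    if x \in s then (x \notin A) &&
      [forall y in A, (rk y != i) ==> ~~ le x y && ~~ le y x]
    else x \in A.
Proof.
move=> + + hA; elim: s => [//|p s IH] /= /andP[ps us] sub.
have [|hB memB] := IH us; first by move=> x xs; apply: sub; rewrite inE xs orbT.
set B := foldr _ A s in hB memB *; split; first exact: toggle_antichain.
have /setIdP[pP /eqP rp] := sub p (mem_head _ _).
have pB : (p \in B) = (p \in A) by rewrite memB (negbTE ps).
move=> x; rewrite inE /toggle pB; case: ifP => pA.
  rewrite in_setD1 memB; have [->|nxp //=] := eqVneq x p.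
  by rewrite pA.
have key : (p |: B \in antichains le P) =
    [forall y in A, (rk y != i) ==> ~~ le p y && ~~ le y p].
  apply/idP/idP.
    move=> /antichainP[_ anti]; apply/forall_inP=> y yA; apply/implyP=> ry.
    have nyp : y != p by apply: contraNneq ry => ->; rewrite rp.
    have yB : y \in B.
      rewrite memB; case: ifP => // ys.
      by have /setIdP[_] := sub y (mem_behead (s := p :: s) ys); rewrite (negbTE ry).
    apply/andP; split; apply: contra nyp => h; apply/eqP.
      by apply/esym; apply: anti => //; rewrite !inE ?eqxx // yB orbT.
    by apply: anti => //; rewrite !inE ?eqxx // yB orbT.
  move=> /forall_inP h; have /antichainP[BP anti] := hB.
  have inc y : y \in B -> y != p -> ~~ le p y && ~~ le y p.
    move=> yB nyp; have yP := subsetP BP _ yB.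
    have [ry|ry] := eqVneq (rk y) i.
      apply/andP; split; apply: contra nyp => hle; apply/eqP.
        by apply/esym; apply: le_eq_rk; rewrite // ry rp.
      by apply: le_eq_rk; rewrite // ry rp.
    have yA : y \in A.
      move: yB; rewrite memB; case: ifP => // ys.
      have /setIdP[_] := sub y (mem_behead (s := p :: s) ys).
      by rewrite (negbTE ry).
    by have := h _ yA; rewrite ry.
  apply/antichainP; split.
    by rewrite subUset sub1set pP.
  move=> a b /setU1P[->|aB] /setU1P[->|bB] // hab; last exact: anti.
    have [//|nbp] := eqVneq p b.
    by have := inc b bB; rewrite eq_sym nbp hab => /(_ isT).
  have [//|nap] := eqVneq a p.
  by have := inc a aB nap; rewrite hab andbF.
rewrite key; have [->|nxp] := eqVneq x p; rewrite /= ?pA /=.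
  by case: ifP => h; rewrite ?setU11 // pB pA.
by case: ifP => h; rewrite ?in_setU1 ?(negbTE nxp) memB.
Qed.

Lemma rank_toggle_antichain i A : A \in antichains le P ->
  rank_toggle le rk P i A \in antichains le P.
Proof.
move=> hA; have [|//] := @foldr_toggle (enum (rank_level rk P i)) i A (enum_uniq _) _ hA.
by move=> y; rewrite mem_enum.
Qed.

Lemma mem_rank_toggle i A x : A \in antichains le P ->
  (x \in rank_toggle le rk P i A) =
    if x \in rank_level rk P i then (x \notin A) &&
      [forall y in A, (rk y != i) ==> ~~ le x y && ~~ le y x]
    else x \in A.
Proof.
move=> hA; have [|_ ->] := @foldr_toggle (enum (rank_level rk P i)) i A (enum_uniq _) _ hA.
  by move=> y; rewrite mem_enum.
by rewrite mem_enum.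
Qed.

(* The state of a sweep which has toggled the ranks below [j], starting from the
   maximal elements of [H]. *)
Definition split_antichain (H : {set T}) (j : nat) (C : {set T}) :=
  forall x, x \in P -> (x \in C) =
    if rk x < j then x \in minimals (P :\: H)
    else (x \in H) && [forall y in H, le x y ==> (y == x)].

(** At rank [j] a maximal element of [H] is in [C] and is switched off; any other element of [H] is
    blocked by a maximal one above it. Outside [H] an element can enter unless a minimal element of
    the complement, of smaller rank and already in [C], lies below it. *)
Lemma split_antichain_toggle H j C : down_closed H -> C \in antichains le P ->
  split_antichain H j C -> split_antichain H j.+1 (rank_toggle le rk P j C).
Proof.
move=> [HP dH] hC hs x xP; rewrite mem_rank_toggle //.
rewrite inE xP /= ltnS; have [rx|rx] := eqVneq (rk x) j; last first.
  by rewrite hs //; case: ltngtP rx => //= ->; rewrite ?eqxx.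
rewrite rx leqnn; have /antichainP[CP anti] := hC.
have max_C y : y \in H -> j <= rk y -> (forall z, z \in H -> le y z -> z = y) -> y \in C.
  move=> yH ry my; rewrite hs ?(subsetP HP) // ltnNge ry /= yH.
  by apply/forall_inP=> z zH; apply/implyP=> yz; rewrite (my z).
apply/idP/idP.
  move=> /andP[xC /forall_inP inc]; have xH : x \notin H.
    apply/negP=> /(maximal_above HP)[y [yH xy my]].
    have yP := subsetP HP _ yH.
    have yC : y \in C by apply: max_C => //; rewrite -rx; apply: rk_le.
    have nxy : x != y by apply: contraNneq xC => ->.
    have := inc _ yC; rewrite xy /= implybF negbK => /eqP ry.
    by have := rk_lt xP yP xy nxy; rewrite rx ry ltnn.
  have [|z zm zx] := @minimal_below (P :\: H) x (subsetDl _ _); first by rewrite inE xH.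
  have zP : z \in P by case/minimalsP: zm => /setDP[].
  have [<- //|nzx] := eqVneq z x.
  have rz := rk_lt zP xP zx nzx.
  have zC : z \in C by rewrite hs // -rx rz.
  by have := inc _ zC; rewrite zx andbF implybF negbK -rx => /eqP e; rewrite e ltnn in rz.
move=> xm; have /minimalsP[/setDP[_ xH] mx] := xm.
have xC : x \notin C by rewrite hs // rx ltnn (negbTE xH).
rewrite xC /=; apply/forall_inP=> y yC; apply/implyP=> ry.
have yP := subsetP CP _ yC; move: (yC); rewrite hs //; case: ltnP => [ry'|ry'].
  move=> ym; have /antichainP[_ antim] := minimals_antichain (subsetDl P H).
  apply/andP; split; apply: contra ry => h.
    by rewrite -(antim _ _ xm ym h) rx.
  by rewrite (antim _ _ ym xm h) rx.
move=> /andP[yH _]; apply/andP; split; apply: contra xH => h.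
  exact: dH h.
suff -> : x = y by [].
by apply/esym; apply: le_eq_rk; rewrite // rx.
Qed.

Lemma poset_rank_max x : x \in P -> rk x <= poset_rank rk P.
Proof. by move=> xP; apply: (leq_bigmax_cond (F := rk)). Qed.

Lemma rank_sweepE H k C : down_closed H -> C \in antichains le P ->
  k <= (poset_rank rk P).+1 ->
  split_antichain H k C -> rank_sweep le rk P k C = minimals (P :\: H).
Proof.
move=> dH hC hk hs; have {hC hs}[] : 
    rank_sweep le rk P k C \in antichains le P /\
    split_antichain H (poset_rank rk P).+1 (rank_sweep le rk P k C).
  rewrite -[X in split_antichain H X](subnKC hk) /rank_sweep.
  clear hk; move: (_.+1 - k) => d; elim: d k C hC hs => [|d IH] k C hC hs /=; first by rewrite addn0.
  rewrite -addSnnS; apply: IH; last exact: split_antichain_toggle.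
  exact: rank_toggle_antichain.
move=> /antichainP[sP _] hs; apply/setP=> x.
have [xP|xP] := boolP (x \in P); first by rewrite hs // ltnS poset_rank_max.
rewrite (negbTE (contra (subsetP sP x) xP)); apply/esym/negbTE.
by apply: contra xP => /minimalsP[/setDP[]].
Qed.

(** The end of one sweep is the start of the next. Up to rank [k] the two slices agree. Above rank
    [k] both are horizontal, and there the minimal elements outside the ideal at time [k] form the
    next antichain of the orbit, that is the maximal elements of the ideal at time [k.+1]. *)
Lemma split_antichain_slice (A : {set T}) (k : nat) : A \in antichains le P ->
  split_antichain (slice_ideal A k.+1) k.+1 (minimals (P :\: slice_ideal A k)).
Proof.
move=> hA x xP; have [HP dH] := slice_down_closed A k.
have [HP1 dH1] := slice_down_closed A k.+1.
have memS j y : y \in P -> (y \in slice_ideal A j) = (y \in orbit_ideal A (minn (rk y) j)).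
  by move=> yP; rewrite inE yP.
case: ltnP => rx.
  have e y : y \in P -> rk y <= k -> (y \in slice_ideal A k) = (y \in slice_ideal A k.+1).
    by move=> yP ry; rewrite !memS // (minn_idPl ry) (minn_idPl (leqW ry)).
  apply/minimalsP/minimalsP => -[/setDP[_ xH] mx].
    split=> [|y /setDP[yP yH] yx]; first by rewrite in_setD xP -e // xH.
    have ry : rk y <= k by exact: leq_trans (rk_le yP xP yx) rx.
    by apply: mx => //; rewrite in_setD yP e // yH.
  split=> [|y /setDP[yP yH] yx]; first by rewrite in_setD xP e // xH.
  have ry : rk y <= k by exact: leq_trans (rk_le yP xP yx) rx.
  by apply: mx => //; rewrite in_setD yP -e // yH.
have kx : k <= rk x by apply: ltnW.
transitivity (x \in iter k.+1 rowmotion A).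
  apply/minimalsP/idP => [[/setDP[_ +] mx]|/= /mem_row[_ xN mx]].
    rewrite memS // (minn_idPr kx) => xN; apply/mem_row; split=> // y yP yx nyx.
    have [z [zP yz zx e]] := gP yP xP yx nyx.
    suff: z \in orbit_ideal A k by move=> zI; apply: orbit_ideal_le zI yP yz.
    have rz : k <= rk z by rewrite -ltnS -e.
    apply: contraT => zN; suff ezx : z = x by move: e; rewrite ezx => /n_Sn.
    by apply: mx => //; rewrite in_setD zP memS // (minn_idPr rz) zN.
  split=> [|y /setDP[yP yN] yx]; first by rewrite in_setD xP memS // (minn_idPr kx) xN.
  apply/eqP; apply: contraNT yN => nyx.
  have [z [zP yz zx e]] := gP yP xP yx nyx.
  have rz : k <= rk z by rewrite -ltnS -e.
  apply: (dH _ z) => //; rewrite memS // (minn_idPr rz); apply: mx => //.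
  by apply: contraPneq (n_Sn (rk z)) => ezx; rewrite -e ezx.
have hI := iter_row_antichain k.+1 hA.
apply/idP/andP.
  move=> /(mem_antichain_down _ hI)[xI mx]; rewrite memS // (minn_idPr rx); split=> //.
  apply/forall_inP=> y yH; apply/implyP=> xy; have yP := subsetP HP1 _ yH.
  apply/eqP; apply: mx => //; move: yH.
  by rewrite memS // (minn_idPr (leq_trans rx (rk_le xP yP xy))).
rewrite memS // (minn_idPr rx) => -[xI /forall_inP mx].
apply/(mem_antichain_down _ hI); split=> // y yI xy.
have yP : y \in P by case/downP: yI.
apply/eqP; have := mx y; rewrite xy memS //.
by rewrite (minn_idPr (leq_trans rx (rk_le xP yP xy))) => /(_ yI).
Qed.

(** Each sweep tilts the slice over one more rank. After the last one the cut-off [minn (rk x) R] is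
    [rk x] everywhere. *)
Lemma rowvacuationE A : A \in antichains le P ->
  rowvacuation le rk P A = minimals (P :\: tilted_ideal A 0).
Proof.
move=> hA; pose R := poset_rank rk P.
have h k : k <= R -> foldl (fun B k => rank_sweep le rk P k B) A (iota 0 k.+1)
    = minimals (P :\: slice_ideal A k).
  elim: k => [|k IH] hk.
    apply: rank_sweepE => //; first exact: slice_down_closed.
    move=> x xP /=; have memS y : (y \in slice_ideal A 0) = (y \in down A).
      rewrite inE minn0; case: (boolP (y \in P)) => // yP.
      by apply/esym/negbTE; apply: contra yP => /downP[].
    rewrite memS; apply/idP/andP => [/(mem_antichain_down _ hA)[xd mx]|[xd /forall_inP mx]].
      by split=> //; apply/forall_inP=> y; rewrite memS => yd; apply/implyP=> /mx->.
    apply/(mem_antichain_down _ hA); split=> // y yd xy.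
    by apply/eqP; have := mx y; rewrite memS yd xy => /(_ isT).
  rewrite -[k.+2]addn1 iotaD foldl_cat add0n IH ?(ltnW hk) //=.
  apply: rank_sweepE; first exact: slice_down_closed.
  - by apply: minimals_antichain; apply: subsetDl.
  - by apply: leqW.
  - exact: split_antichain_slice.
rewrite /rowvacuation h //; congr (minimals (P :\: _)); apply/setP=> x.
rewrite inE [RHS]inE; case: (boolP (x \in P)) => //= xP.
by rewrite addn0 (minn_idPl (poset_rank_max xP)).
Qed.

(** * Rowvacuation as an involution that inverts rowmotion *)

Lemma rowvacuation_antichain A : A \in antichains le P ->
  rowvacuation le rk P A \in antichains le P.
Proof. by move=> hA; rewrite rowvacuationE // minimals_antichain // subsetDl. Qed.

Lemma tilted_idealD A m c :
  tilted_ideal (iter m rowmotion A) c = tilted_ideal A (c + m).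
Proof.
by apply/setP=> x; rewrite inE [RHS]inE /orbit_ideal -iterD addnA.
Qed.

Lemma iter_row_tilted A c m :
  iter m rowmotion (minimals (P :\: tilted_ideal A (c + m))) = minimals (P :\: tilted_ideal A c).
Proof.
elim: m => [|m IH]; first by rewrite addn0.
by rewrite iterSr addnS {2}/rowmotion tilt IH.
Qed.

(** Write [A] as the image of [A0] under [R.+1] rowmotions. At [x] the second slice moves the first
    one back by [rk x], so it asks for [x] in the ideal of [A0] at time [rk x + (R - rk x) = R]. The
    two tilts cancel and leave a horizontal slice, the minimal elements of whose complement form
    [A]. *)
Lemma rowvacuationK A : A \in antichains le P ->
  rowvacuation le rk P (rowvacuation le rk P A) = A.
Proof.
move=> hA; pose R := poset_rank rk P.
have [A0 hA0 eA] := row_preimage R.+1 hA.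
rewrite rowvacuationE ?rowvacuation_antichain // rowvacuationE // -eA tilted_idealD add0n.
rewrite iterS {2}/rowmotion -/(orbit_ideal A0 R); congr (minimals (P :\: _)).
apply/setP=> x; rewrite inE; case: (boolP (x \in P)) => [xP|xP] /=; last first.
  by apply/esym/negbTE; apply: contra xP => /downP[].
have rx := poset_rank_max xP; have e : R.+1 = ((R - rk x).+1 + rk x)%N.
  by rewrite addSn subnK.
rewrite addn0 /orbit_ideal {1}e iter_row_tilted tilt inE xP /=.
by rewrite (subnKC rx).
Qed.

Lemma row_rowvacuation_row A : A \in antichains le P ->
  rowmotion (rowvacuation le rk P (rowmotion A)) = rowvacuation le rk P A.
Proof.
move=> hA; rewrite !rowvacuationE ?row_antichain // (tilted_idealD A 1) add0n.
by rewrite {1}/rowmotion tilt.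
Qed.

End Fixed.

(** * Removing the elements above a minimal one *)

Section RemoveMinimal.
Variables (P : {set T}) (a : T).
Hypotheses (gP : graded P) (aP : a \in P) (ra : rk a = 0).
Let P' : {set T} := [set x in P | ~~ le a x].

Lemma graded_remove : graded P'.
Proof.
move=> x y /setIdP[xP ax] /setIdP[yP ay] xy nxy.
have [z [zP xz zy e]] := gP xP yP xy nxy; exists z; split=> //.
by rewrite inE zP (contra _ ay) // => az; apply: le_trans az zy.
Qed.

Lemma antichains_remove A : A \in antichains le P' -> A \in antichains le P.
Proof.
move=> /antichainP[AP anti]; apply/antichainP; split=> //.
by apply: (subset_trans AP); apply/subsetP=> x /setIdP[].
Qed.

(** Elements above [a] are outside the ideal at the start, and each step of rowmotion can let in
    only one more rank of them. *)
Lemma orbit_ideal_above A m x : A \in antichains le P' -> x \in P -> le a x ->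
  m <= rk x -> x \notin orbit_ideal P A m.
Proof.
move=> /antichainP[/subsetP AP _]; elim: m x => [|m IH] x xP ax rx.
  apply/negP => /downP[_ [y /AP/setIdP[_ ay] xy]].
  by rewrite (le_trans ax xy) in ay.
have nax : a != x by apply: contraTneq rx => <-; rewrite ra.
have [z [zP az zx e]] := gP aP xP ax nax.
have rz : m <= rk z by rewrite -ltnS -e.
apply: contra (IH z zP az rz) => xI; apply: (orbit_idealS (P := P)) xI zP zx _.
by apply: contraPneq (n_Sn (rk z)) => ezx; rewrite -e ezx.
Qed.

(** By [orbit_ideal_above], an element above [a] in the ideal at time [m] has rank less than [m],
    hence at most [rk x], and cannot lie above [x]. The ideal near [x] is therefore computed without
    such elements. *)
Lemma orbit_ideal_remove A m x : A \in antichains le P' -> x \in P' ->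
  m <= (rk x).+1 -> (x \in orbit_ideal P A m) = (x \in orbit_ideal P' A m).
Proof.
move=> hA; elim: m x => [|m IH] x xP' rx.
  have xP : x \in P by case/setIdP: xP'.
  by apply/downP/downP => -[_ h]; split.
have /setIdP[xP ax] := xP'.
(* The induction hypothesis covers only elements of large rank; every other element strictly below
   [y] lies below one of them. *)
have lowers y : y \in P' -> le x y -> 
    (forall z, z \in P' -> le z y -> z != y -> m <= (rk z).+1 ->
      z \in orbit_ideal P' A m) ->
    (forall z, z \in P' -> le z y -> z != y -> z \in orbit_ideal P' A m).
  move=> yP' xy h z zP' zy nzy; have /setIdP[yP _] := yP'.
  have [w [wP' zw wy e]] := graded_remove zP' yP' zy nzy.
  apply: (orbit_ideal_le (P := P')) zP' zw; apply: h => //.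
    by apply: contraPneq (n_Sn (rk w)) => ewy; rewrite -e ewy.
  by rewrite -e; apply: leq_trans (rx : m <= rk x) (rk_le gP xP yP xy).
apply/downP/downP => -[_ [y /= /mem_row[yP yN my] xy]]; split=> //; exists y => //=.
  have rxy := rk_le gP xP yP xy.
  have ay : ~~ le a y.
    apply/negP=> ay; have nay : a != y.
      apply: contraNneq ax => ay'; rewrite -ay' in xy rxy.
      by rewrite (le_eq_rk gP xP aP xy) ?ra // le_refl.
    have [z [zP az zy e]] := gP aP yP ay nay.
    have nzy : z != y by apply: contraPneq (n_Sn (rk z)) => ezy; rewrite -e ezy.
    have zI := my z zP zy nzy.
    have rz : rk z < m.
      by rewrite ltnNge; apply/negP => rz; have /negP[] := orbit_ideal_above hA zP az rz.
    suff exy : x = y by rewrite exy ay in ax.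
    by apply: (le_eq_rk gP xP yP xy); rewrite e (leq_trans rz).
  have yP' : y \in P' by rewrite inE yP.
  have rmy : m <= rk y by exact: leq_trans (rx : m <= rk x) rxy.
  apply/mem_row; split=> //; first by rewrite -IH // leqW.
  apply: lowers => // z zP' zy nzy rz; rewrite -IH //.
  by apply: my => //; case/setIdP: zP'.
have yP' := yP; have /setIdP[yP1 ay] := yP'; have rxy := rk_le gP xP yP1 xy.
have rmy : m <= rk y by exact: leq_trans (rx : m <= rk x) rxy.
apply/mem_row; split=> //; first by rewrite IH // leqW.
move=> z zP zy nzy; have [w [wP zw wy e]] := gP zP yP1 zy nzy.
have wP' : w \in P' by rewrite inE wP (contra _ ay) // => aw; apply: le_trans aw wy.
apply: (orbit_ideal_le (P := P)) zP zw; rewrite IH //; last by rewrite -e.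
by apply: my => //; apply: contraPneq (n_Sn (rk w)) => ewy; rewrite -e ewy.
Qed.

Lemma rowvacuation_remove A : A \in antichains le P' ->
  rowvacuation le rk P A = a |: rowvacuation le rk P' A.
Proof.
move=> hA; rewrite (rowvacuationE gP (antichains_remove hA)) (rowvacuationE graded_remove hA).
have memW x : x \in P' -> (x \in tilted_ideal P A 0) = (x \in tilted_ideal P' A 0).
  move=> xP'; have /setIdP[xP _] := xP'.
  by rewrite inE [RHS]inE xP xP' /= addn0 orbit_ideal_remove.
have above x : x \in P -> le a x -> x \notin tilted_ideal P A 0.
  by move=> xP ax; rewrite inE xP addn0 /= orbit_ideal_above.
apply/setP=> x; apply/minimalsP/setU1P => [[/setDP[xP xW] mx]|].
  have [ax|ax] := boolP (le a x); [left|right].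
    by apply/esym; apply: mx => //; rewrite in_setD aP above.
  have xP' : x \in P' by rewrite inE xP.
  apply/minimalsP; split=> [|y /setDP[yP' yW] yx]; first by rewrite in_setD xP' -memW ?xW.
  by have /setIdP[yP _] := yP'; apply: mx => //; rewrite in_setD yP memW ?yW.
case=> [->|/minimalsP[/setDP[xP' xW] mx]].
  split=> [|y /setDP[yP _] ya]; first by rewrite in_setD aP above.
  by apply: (le_eq_rk gP yP aP ya); rewrite ra.
have /setIdP[xP ax] := xP'.
split=> [|y /setDP[yP yW] yx]; first by rewrite in_setD xP memW ?xW.
have yP' : y \in P' by rewrite inE yP (contra _ ax) // => ay; apply: le_trans ay yx.
by apply: mx => //; rewrite in_setD yP' -memW ?yW.
Qed.

Lemma mem_rowvacuation_rank0 A : A \in antichains le P ->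
  (a \in rowvacuation le rk P A) = (a \notin down P A).
Proof.
move=> hA; rewrite (rowvacuationE gP hA).
have -> : (a \notin down P A) = (a \notin tilted_ideal P A 0).
  by rewrite [in RHS]inE aP ra.
apply/minimalsP/idP => [[/setDP[]//]|aW].
split=> [|y /setDP[yP _] ya]; first by rewrite in_setD aP aW.
by apply: (le_eq_rk gP yP aP ya); rewrite ra.
Qed.

Lemma antichain_removeP A : A \in antichains le P ->
  (A \in antichains le P') = (a \notin down P A).
Proof.
move=> hA; have /antichainP[AP anti] := hA; apply/idP/idP.
  move=> /antichainP[AP' _]; apply/negP=> /downP[_ [x /(subsetP AP')/setIdP[_]]].
  by move=> /negbTE->.
move=> aA; apply/antichainP; split=> //; apply/subsetP=> x xA.
rewrite inE (subsetP AP) //=; apply: contra aA => ax.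
by apply/downP; split=> //; exists x.
Qed.

(** As [A] is the image of [Rvac A] and contains [a], nothing of [Rvac A] lies above [a]; so
    [rowvacuation_remove] applies to [Rvac A]. *)
Lemma rowvacuation_mem A : A \in antichains le P -> a \in A ->
  rowvacuation le rk P A = rowvacuation le rk P' (A :\ a).
Proof.
move=> hA aA; have hB := rowvacuation_antichain gP hA.
have eA := rowvacuationK gP hA.
have hB' : rowvacuation le rk P A \in antichains le P'.
  by rewrite antichain_removeP // -mem_rowvacuation_rank0 // eA.
have := rowvacuation_remove hB'; rewrite eA => {2}->.
rewrite setU1K ?(rowvacuationK graded_remove hB') //.
have /antichainP[sub _] := rowvacuation_antichain graded_remove hB'.
by apply/negP=> /(subsetP sub)/setIdP[_]; rewrite le_refl.
Qed.

End RemoveMinimal.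

(** * Rank levels *)

Section RankLevels.
Variable P : {set T}.
Hypothesis gP : graded P.
Let R := poset_rank rk P.
Hypotheses
  (below : forall x, x \in P -> 0 < rk x -> exists y, [/\ y \in P, le y x & y != x])
  (above : forall x, x \in P -> rk x < R -> exists y, [/\ y \in P, le x y & y != x]).

Lemma down_rank_level i : i <= R -> down P (rank_level rk P i) = [set x in P | rk x <= i].
Proof.
move=> iR; apply/setP=> x; rewrite [RHS]inE.
apply/downP/andP => -[xP]; first by case=> y /setIdP[yP /eqP <-]; split=> //; apply: (rk_le gP).
move=> rx; split=> //; have [d e] : exists d, rk x + d = i by exists (i - rk x); apply: subnKC.
elim: d x {rx} xP e => [|d IH] y yP e.
  by exists y; [rewrite inE yP -e addn0 eqxx | apply: le_refl].
have [|z [zP yz nzy]] := above yP; first by apply: leq_trans iR; rewrite -e addnS ltnS leq_addr.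
rewrite eq_sym in nzy; have [w [wP yw _ _ rw]] := upper_cover gP yP zP yz nzy.
have [|u ul wu] := IH w wP; first by rewrite rw addSn -addnS.
by exists u => //; apply: le_trans yw wu.
Qed.

Lemma lower_cover x : x \in P -> 0 < rk x -> exists z, [/\ z \in P, le z x & rk x = (rk z).+1].
Proof.
move=> xP rx; have [y [yP yx nyx]] := below xP rx.
by have [z [zP _ zx e]] := gP yP xP yx nyx; exists z.
Qed.

Lemma minimals_rank_ge i : minimals [set x in P | i <= rk x] = rank_level rk P i.
Proof.
apply/setP=> x; apply/minimalsP/setIdP => [[/setIdP[xP rx] mx]|[xP /eqP rx]]; split=> //.
- rewrite eqn_leq rx andbT leqNgt; apply/negP => rix.
  have [|z [zP zx e]] := lower_cover xP; first by apply: leq_trans rix.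
  have ezx : z = x by apply: mx => //; rewrite inE zP -ltnS -e.
  by move: e; rewrite ezx => /n_Sn.
- by rewrite inE xP rx leqnn.
- by move=> y /setIdP[yP ry] yx; apply: (le_eq_rk gP yP xP yx); rewrite rx.
Qed.

Lemma row_rank_level i : i <= R -> rowmotion P (rank_level rk P i) = rank_level rk P i.+1.
Proof.
move=> iR; rewrite /rowmotion down_rank_level // -[RHS]minimals_rank_ge; congr (minimals _).
by apply/setP=> x; rewrite in_setD !inE; case: (x \in P); rewrite //= andbT -ltnNge.
Qed.

Lemma down_set0 : down P set0 = set0.
Proof. by apply/setP=> x; rewrite [RHS]inE; apply/negbTE/negP=> /downP[_ [y yY _]]; rewrite inE in yY. Qed.

Lemma rank_level_overflow i : R < i -> rank_level rk P i = set0.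
Proof.
move=> iR; apply/setP=> x; rewrite inE [RHS]inE; apply/negbTE/negP=> /andP[xP /eqP rx].
by move: (poset_rank_max xP); rewrite rx leqNgt iR.
Qed.

(** Rowmotion permutes the levels cyclically, the empty level [R.+1] coming between [R] and [0];
    hence the modulus [R.+2]. *)
Lemma iter_row_rank_level i m : i <= R.+1 -> m <= R ->
  iter m (rowmotion P) (rank_level rk P i) = rank_level rk P ((i + m) %% R.+2).
Proof.
move=> iR; elim: m => [|m IH] mR; first by rewrite addn0 modn_small.
rewrite iterS IH ?(ltnW mR) //; set j := _ %% _; have jR : j < R.+2 by rewrite ltn_mod.
have -> : (i + m.+1) %% R.+2 = j.+1 %% R.+2 by rewrite addnS -addn1 -modnDml addn1.
have [jR1|jR1] := leqP j R; first by rewrite row_rank_level // modn_small.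
have -> : j = R.+1 by apply/eqP; rewrite eqn_leq jR1 andbT.
rewrite modnn rank_level_overflow // /rowmotion down_set0 setD0 -[RHS]minimals_rank_ge.
by congr (minimals _); apply/setP=> x; rewrite !inE andbT.
Qed.

(** The tilted slice consists of the ranks at most [R - i]: for a larger [rk x], the level reached
    at time [rk x] is empty or has wrapped round to one below [rk x]. *)
Lemma rowvacuation_rank_level i : i <= R.+1 ->
  rowvacuation le rk P (rank_level rk P i) = rank_level rk P (R.+1 - i).
Proof.
move=> iR; have hi : rank_level rk P i \in antichains le P.
  apply/antichainP; split=> [|x y /setIdP[xP /eqP rx] /setIdP[yP /eqP ry] xy].
    by apply/subsetP=> x /setIdP[].
  by apply: (le_eq_rk gP xP yP xy); rewrite rx ry.
rewrite (rowvacuationE gP hi) -[RHS]minimals_rank_ge; congr (minimals _).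
apply/setP=> x; rewrite in_setD [RHS]inE [X in ~~ X]inE; case: (boolP (x \in P)) => //= xP.
have rx : rk x <= R := poset_rank_max xP.
rewrite addn0 /orbit_ideal andbT iter_row_rank_level //.
have [h|h] := leqP (i + rk x) R.
  rewrite modn_small; last by lia.
  by rewrite down_rank_level // inE xP /=; lia.
have [->|h1] := eqVneq (i + rk x) R.+1.
  by rewrite modn_small // rank_level_overflow // down_set0 inE; lia.
have -> : i + rk x = (i + rk x - R.+2) + R.+2 by lia.
rewrite modnDr modn_small; last by lia.
by rewrite down_rank_level ?inE ?xP /=; lia.
Qed.

End RankLevels.

(** * Induction on the support *)

Section PairRelation.
Variables (P : {set T}).
Hypotheses (gP : graded P)
  (below : forall x, x \in P -> 0 < rk x -> exists y, [/\ y \in P, le y x & y != x]).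
Let S := rank_level rk P 0.

(** With [S] the set of simple roots, this is the set of positive roots of the parabolic subsystem
    on [K]. *)
Definition supported (K : {set T}) : {set T} :=
  [set x in P | [forall a in S, le a x ==> (a \in K)]].

Lemma supportedP (K : {set T}) x :
  reflect (x \in P /\ forall a, a \in S -> le a x -> a \in K) (x \in supported K).
Proof.
rewrite inE; apply: (iffP andP) => -[xP h]; split=> //.
  by move=> a aS ax; have /forall_inP/(_ a aS)/implyP/(_ ax) := h.
by apply/forall_inP=> a aS; apply/implyP; apply: h.
Qed.

Lemma rank0_below x : x \in P -> exists2 a, a \in S & le a x.
Proof.
move=> xP; have [a am ax] := minimal_below gP (subxx P) xP.
have /minimalsP[aP ma] := am; exists a => //; rewrite inE aP /=.
case: posnP => // ra; have [y [yP ya /eqP[]]] := below aP ra.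
exact: ma.
Qed.

Lemma graded_supported (K : {set T}) : graded (supported K).
Proof.
move=> x y /supportedP[xP xK] /supportedP[yP yK] xy nxy.
have [z [zP xz zy e]] := gP xP yP xy nxy; exists z; split=> //.
by apply/supportedP; split=> // a aS az; apply: yK => //; apply: le_trans az zy.
Qed.

Lemma supported_full : supported S = P.
Proof. by apply/setP=> x; apply/supportedP/idP => [[]|]. Qed.

Lemma rank0_le a b : a \in S -> b \in S -> le a b -> a = b.
Proof.
by move=> /setIdP[aP /eqP ra] /setIdP[bP /eqP rb] ab; apply: (le_eq_rk gP aP bP ab); rewrite ra rb.
Qed.

Lemma rank0_supported (K : {set T}) a : a \in S -> a \in K -> a \in supported K.
Proof.
move=> aS aK; apply/supportedP; split=> [|b bS ba]; first by case/setIdP: aS.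
by rewrite (rank0_le bS aS ba).
Qed.

Lemma supported_remove (K : {set T}) a : a \in S ->
  [set x in supported K | ~~ le a x] = supported (K :\ a).
Proof.
move=> aS; apply/setP=> x; apply/setIdP/supportedP.
  move=> [/supportedP[xP xK] ax]; split=> // b bS bx.
  by rewrite in_setD1 xK // andbT; apply: contraNneq ax => <-.
move=> [xP xK]; split.
  by apply/supportedP; split=> // b bS bx; have /setD1P[] := xK b bS bx.
by apply/negP=> ax; have /setD1P[/eqP] := xK a aS ax.
Qed.

Lemma supported0 : supported set0 = set0.
Proof.
apply/setP=> x; rewrite [RHS]inE; apply/negbTE/negP=> /supportedP[xP h].
by have [a aS ax] := rank0_below xP; have := h a aS ax; rewrite inE.
Qed.

Definition full_support (K A : {set T}) := forall a, a \in K -> exists2 x, x \in A & le a x.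

Variable Rel : {set T} -> {set T} -> {set T} -> Prop.
Hypotheses
  (Rel0 : Rel set0 set0 set0)
  (Rel_add : forall (K : {set T}) a A B, a \in K -> K \subset S ->
     A \in antichains le (supported (K :\ a)) ->
     B \in antichains le (supported (K :\ a)) -> Rel (K :\ a) A B -> Rel K A (a |: B))
  (Rel_step : forall (K A B : {set T}), K \subset S ->
     A \in antichains le (supported K) -> B \in antichains le (supported K) ->
     full_support K A -> full_support K B ->
     Rel K (rowmotion (supported K) A) B -> Rel K A (rowmotion (supported K) B))
  (orbit_not_full : forall (K A : {set T}), K != set0 -> K \subset S -> A \in antichains le (supported K) ->
     exists m, ~ full_support K (iter m (rowmotion (supported K)) A)).

(** The outer induction is on the size of [K]; the inner one is on a number of rowmotion steps after
    which the support is no longer full. *)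
Lemma Rel_rowvacuation (K A : {set T}) : K \subset S -> A \in antichains le (supported K) ->
  Rel K A (rowvacuation le rk (supported K) A).
Proof.
move: {2}#|K| (erefl #|K|) => N; elim: N K A => [|N IH] K A cK KS hA.
  have K0 : K = set0 by apply/eqP; rewrite -cards_eq0 cK.
  move: hA; rewrite K0 supported0 => hA.
  have sub0 B : B \in antichains le set0 -> B = set0.
    by move=> /antichainP[B0 _]; apply/eqP; rewrite -subset0.
  have g0 : graded set0 by rewrite -supported0; apply: graded_supported.
  by rewrite (sub0 _ (rowvacuation_antichain g0 hA)) (sub0 _ hA).
have gK := @graded_supported K.
have Kn0 : K != set0 by rewrite -card_gt0 cK.
have not_full_case B : B \in antichains le (supported K) -> ~ full_support K B ->
    Rel K B (rowvacuation le rk (supported K) B).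
  move=> hB nfull; have [a aK na] : exists2 a, a \in K & forall x, x \in B -> ~~ le a x.
    apply: contrapT => h; apply: nfull => a aK; apply: contrapT => hx; apply: h.
    by exists a => // x xA; apply/negP=> ax; apply: hx; exists x.
  have aS := subsetP KS _ aK; have /setIdP[aP /eqP ra] := aS.
  have aPK := rank0_supported aS aK.
  have hA' : B \in antichains le [set x in supported K | ~~ le a x].
    rewrite (antichain_removeP aPK hB); apply/negP=> /downP[_ [x xA ax]].
    by have /negP[] := na x xA.
  rewrite (rowvacuation_remove gK aPK ra hA'); move: hA'; rewrite supported_remove // => hA'.
  have cK' : #|K :\ a| = N by move: cK; rewrite (cardsD1 a) aK => -[].
  have K'S : K :\ a \subset S by apply: subset_trans KS; apply: subD1set.
  apply: Rel_add => //; last exact: IH.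
  by apply: rowvacuation_antichain => //; apply: graded_supported.
have [m] := orbit_not_full Kn0 KS hA.
elim: m A hA => [|m IHm] A hA nfull; first exact: not_full_case.
have [fA|] := pselect (full_support K A); last exact: not_full_case.
have hrow := row_antichain (supported K) A; rewrite iterSr in nfull.
rewrite -(row_rowvacuation_row gK hA).
have hB := rowvacuation_antichain gK hrow.
apply: Rel_step => //; last exact: IHm.
(* The antichain [Rvac (Row A)] has full support because its image [Row A] contains no element of
   [K], [A] itself having full support. *)
move=> a aK; have aS := subsetP KS _ aK; have /setIdP[_ /eqP ra] := aS.
have aPK := rank0_supported aS aK.
have := mem_rowvacuation_rank0 gK aPK ra hB; rewrite (rowvacuationK gK hrow).
have -> : (a \in rowmotion (supported K) A) = false.
  apply/negbTE/negP=> /mem_row[_ + _]; have [x xA ax] := fA a aK.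
  by case/negP; apply/downP; split=> //; exists x.
by move=> /esym/negbFE/downP[_ [x xB ax]]; exists x.
Qed.

End PairRelation.
End RankedPoset.

Ltac linear_fact P :=
  lazymatch P with
  | is_true (leq _ _) => idtac
  | is_true (@eq_op ?T _ _) => unify (Equality.sort T) nat
  | is_true (negb (leq _ _)) => idtac
  | is_true (negb (@eq_op ?T _ _)) => unify (Equality.sort T) nat
  | is_true (andb _ _) => idtac
  | is_true (orb _ _) => idtac
  | is_true (negb (andb _ _)) => idtac
  | @eq ?T _ _ => unify T nat
  | is_true ?b => is_var b
  end.

Ltac nlia :=
  repeat match goal with
  | H : ?P |- _ =>
    lazymatch type of P with Prop => idtac end;
    tryif linear_fact P then fail else clear H
  end; lia.

(** A discrete intermediate value argument. It locates the border of an ideal along a row or a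
    column, where the next antichain has an element. *)
Lemma nat_switch (f : nat -> bool) (a b : nat) : (a <= b)%N -> ~~ f a -> f b ->
  exists x, [/\ (a <= x)%N, (x < b)%N, ~~ f x & f x.+1].
Proof.
move=> /subnKC <-; elim: (b - a) => [|d IH]; first by rewrite addn0 => /negbTE->.
move=> na; rewrite addnS => fb; have [fd|fd] := boolP (f (a + d)).
  by have [x [ax xb nx fx]] := IH na fd; exists x; split=> //; nlia.
by exists (a + d)%N; split=> //; nlia.
Qed.

(** * Posets of intervals of a folded path *)

Section FoldedTriangle.
Variables (T : finType) (le : rel T) (rk : T -> nat).
Hypotheses (le_refl : reflexive le) (le_anti : antisymmetric le)
  (le_trans : transitive le).
Variables (P : {set T}) (n : nat) (dbl mid : bool) (el : nat -> nat -> bool -> T).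

(* [el i j s] stands for the interval [[i, j]] of the path [0, ..., n + n] folded
   at its middle, where [k] and [n + n - k] are the same simple root.  Types B and
   C have a middle node ([mid]), type A has none; in type D ([dbl]) the middle
   node is doubled, the sign [s] telling the two copies apart (it is irrelevant
   off the column [j = n]). *)
Definition valid (i j : nat) : bool :=
  [&& i <= j, i + j <= n + n & mid || (j < n)].

Definition compat (j : nat) (s : bool) (j' : nat) (s' : bool) : bool :=
  ~~ [&& dbl, j == n, j' == n & s != s'].

(** The combinatorial argument uses the root poset only through this description. Types B and C give
    the same triangle; only the lengths tell them apart. *)
Record folded_triangle : Prop := FoldedTriangle {
  el_in : forall i j s, valid i j -> el i j s \in P;
  el_onto : forall x, x \in P -> exists i j s, valid i j /\ x = el i j s;
  el_le : forall i j s i' j' s', valid i j -> valid i' j' ->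
    le (el i j s) (el i' j' s') = [&& i' <= i, j <= j' & compat j s j' s'];
  el_rk : forall i j s, valid i j -> rk (el i j s) = j - i }.

Hypothesis hP : folded_triangle.

Lemma compatP j s j' s' :
  reflect (dbl -> j = n -> j' = n -> s = s') (compat j s j' s').
Proof.
apply: (iffP idP).
  by move=> h d ej ej'; move: h; rewrite /compat d ej ej' !eqxx /= negbK => /eqP.
by move=> h; apply/negP=> /and4P[d /eqP ej /eqP ej' /eqP]; apply; apply: h.
Qed.

Lemma compat_refl j s : compat j s j s.
Proof. exact/compatP. Qed.

Lemma compatl j s j' s' : j != n -> compat j s j' s'.
Proof. by move=> /eqP h; apply/compatP. Qed.

Lemma compatr j s j' s' : j' != n -> compat j s j' s'.
Proof. by move=> /eqP h; apply/compatP. Qed.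

Lemma graded_triangle : graded le rk P.
Proof.
move=> x y xP yP; have [i [j [s [v ->]]]] := el_onto hP xP.
have [i' [j' [s' [v' ->]]]] := el_onto hP yP; rewrite (el_le hP) // => /and3P[ii jj c] ne.
have [ij|ij] := ltnP i' i.
  have [e|vi] := boolP (valid i'.+1 j').
    exists (el i'.+1 j' s'); rewrite (el_in hP) // !(el_le hP) // !(el_rk hP) //.
    by rewrite ij jj c leqnSn leqnn compat_refl; split=> //; rewrite /valid in v' e *; nlia.
  have vj : valid i' j'.-1 by rewrite /valid in v v' vi *; nlia.
  exists (el i' j'.-1 s); rewrite (el_in hP) // !(el_le hP) // !(el_rk hP) // ii.
  have jn : j' != n by rewrite /valid in v v' vi *; nlia.
  rewrite (compatr _ _ _ jn) leqnn leq_pred; split=> //; last by rewrite /valid in v v' vi *; nlia.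
  by rewrite (_ : j <= j'.-1) ?compat_refl /=; [apply/compatP | rewrite /valid in v v' vi *; nlia].
have ei : i' = i by nlia.
have jj' : j < j'.
  rewrite ltn_neqAle jj andbT; apply: contraNneq ne => ej; apply/eqP.
  subst i' j'; apply: le_anti; rewrite !(el_le hP) // !leqnn c /=.
  by apply/compatP => d ejn _; have /compatP -> := c.
have vj : valid i' j'.-1 by rewrite /valid in v v' *; nlia.
(* When [j = n] the shortened interval may itself end at the middle, and its sign must then be that
   of the smaller interval. *)
exists (el i' j'.-1 (if j == n then s else s')).
rewrite (el_in hP) // !(el_le hP) // !(el_rk hP) // ii leqnn leq_pred /=.
split=> //.
- apply/andP; split; first by rewrite /valid in v v' *; nlia.
  by apply/compatP => d -> _; rewrite eqxx.
- case: eqP => [ejn|_]; last by apply/compatP => d _.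
  by apply: compatr; rewrite -ejn; nlia.
- by rewrite /valid in v v' *; nlia.
Qed.

Lemma triangle_below x : x \in P -> 0 < rk x -> exists y, [/\ y \in P, le y x & y != x].
Proof.
move=> xP; have [i [j [s [v ->]]]] := el_onto hP xP; rewrite (el_rk hP) // => ij.
have vj : valid i j.-1 by rewrite /valid in v *; nlia.
exists (el i j.-1 s); rewrite (el_in hP) // (el_le hP) // leqnn leq_pred /=.
split=> //; first exact/compatP.
apply/negP => /eqP /(congr1 rk); rewrite !(el_rk hP) //; nlia.
Qed.

Let S := rank_level rk P 0.

Lemma triangle_simpleP x : reflect (exists k s, valid k k /\ x = el k k s) (x \in S).
Proof.
apply: (iffP setIdP) => [[xP]|[k [s [v ->]]]].
  have [i [j [s [v ->]]]] := el_onto hP xP; rewrite (el_rk hP) // => /eqP e.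
  have eij : j = i by rewrite /valid in v; nlia.
  by exists i, s; rewrite -{2}eij eij in v *; split.
by rewrite (el_in hP) // (el_rk hP) // subnn.
Qed.

Definition occ (D : {set T}) (i j : nat) (s : bool) : bool := valid i j && (el i j s \in D).

Lemma el_sign i j s s' : valid i j -> (j != n) || ~~ dbl -> el i j s = el i j s'.
Proof.
move=> v h; apply: le_anti; rewrite !(el_le hP) // !leqnn /=.
by apply/andP; split; apply/compatP=> d ej; move: h; rewrite ej eqxx d.
Qed.

Lemma occ_sign D i j s s' : (j != n) || ~~ dbl -> occ D i j s -> occ D i j s'.
Proof. by move=> h /andP[v D1]; rewrite /occ v -(el_sign s s' v h). Qed.

Lemma occ_valid D i j s : occ D i j s -> valid i j.
Proof. by case/andP. Qed.

Definition ends_at k (D : {set T}) := exists i s, occ D i k s.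
(* The node [n + n - k] is [k] again, so the mirror image of an interval ending
   there starts at [k]. *)
Definition starts_at k (D : {set T}) :=
  (exists j s, occ D k j s) \/ (exists i s, occ D i (n + n - k) s).
Definition all_middles (D : {set T}) := forall s, exists i, occ D i n s.
Definition some_middle (D : {set T}) := exists i s, occ D i n s.
Definition has_central (D : {set T}) := exists i j s, occ D i j s /\ i + j = n + n.
Definition sign_symmetric (D : {set T}) := forall i s, occ D i n s -> occ D i n (~~ s).

(** * Rowmotion on intervals of a given support *)

Section Support.
Variables (K A : {set T}).
Hypotheses (KS : K \subset S).
Let PK := supported le rk P K.
Hypothesis hA : A \in antichains le PK.
Let J := down le PK A.
Let R := rowmotion le PK A.

Lemma occ_supported i j s : occ PK i j s <->
  valid i j /\ forall k s', i <= k -> k <= j -> k <= n -> compat k s' j s -> occ K k k s'.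
Proof.
rewrite /occ; split.
  move=> /andP[v /supportedP[_ h]]; split=> // k s' ik kj kn c.
  have vk : valid k k by rewrite /valid in v *; nlia.
  rewrite vk /=; apply: h; first by apply/triangle_simpleP; exists k, s'.
  by rewrite (el_le hP) // ik kj.
move=> [v h]; rewrite v /=; apply/supportedP; split; first exact: (el_in hP).
move=> x /triangle_simpleP[k [s' [vk ->]]]; rewrite (el_le hP) // => /and3P[ik kj c].
have kn : k <= n by rewrite /valid in vk; nlia.
by have /andP[] := h k s' ik kj kn c.
Qed.

Lemma occ_supported_le i j s i' j' s' : occ PK i' j' s' -> valid i j -> i' <= i ->
  j <= j' -> compat j s j' s' -> occ PK i j s.
Proof.
move=> /andP[v' /supportedP[_ h]] v ii jj c; rewrite /occ v /=.
apply/supportedP; split=> [|a aS ax]; first exact: (el_in hP).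
by apply: h => //; apply: le_trans ax _; rewrite (el_le hP) // ii jj.
Qed.

Lemma occ_antichain i j s : occ A i j s -> occ PK i j s.
Proof.
have /antichainP[AP _] := hA.
by move=> /andP[v xA]; rewrite /occ v (subsetP AP).
Qed.

Lemma occ_down i j s : occ J i j s <-> occ PK i j s /\
  exists i' j' s', [/\ occ A i' j' s', i' <= i, j <= j' & compat j s j' s'].
Proof.
rewrite /occ; split.
  move=> /andP[v /downP[xP [y yA xy]]]; rewrite v xP; split=> //.
  have /antichainP[/subsetP AP _] := hA.
  have /supportedP[yP _] := AP _ yA.
  have [i' [j' [s' [v' ey]]]] := el_onto hP yP; exists i', j', s'.
  by move: xy; rewrite ey (el_le hP) // => /and3P[-> -> ->]; rewrite v' -ey yA.
move=> [/andP[v xP] [i' [j' [s' [/andP[v' yA] ii jj c]]]]]; rewrite v /=.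
by apply/downP; split=> //; exists (el i' j' s') => //; rewrite (el_le hP) // ii jj.
Qed.

Lemma occ_down_le i j s i' j' s' : occ J i' j' s' -> valid i j -> i' <= i ->
  j <= j' -> compat j s j' s' -> occ J i j s.
Proof.
move=> h v ii jj c; have [hK _] := iffLR (occ_down _ _ _) h.
have xK := occ_supported_le hK v ii jj c; move: h => /andP[v' yJ].
rewrite /occ v /=; apply: (proj2 (down_downclosed le_trans _ _)) yJ _.
  by case/andP: xK.
by rewrite (el_le hP) // ii jj.
Qed.

Lemma occ_antichain_down i j s : occ A i j s -> occ J i j s.
Proof.
move=> h; apply/occ_down; split; first exact: occ_antichain.
by exists i, j, s; rewrite compat_refl.
Qed.

Lemma occ_anti i j s i' j' s' : occ A i j s -> occ A i' j' s' -> i' <= i -> j <= j' ->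
  compat j s j' s' -> i = i' /\ j = j'.
Proof.
move=> /andP[v xA] /andP[v' yA] ii jj c; have /antichainP[_ anti] := hA.
have e := anti _ _ xA yA; rewrite (el_le hP) // ii jj c in e.
have := el_le hP s' s v' v; rewrite -(e isT) le_refl => /esym/and3P[? ? _].
by split; nlia.
Qed.

Lemma occ_downN i j s i' j' s' : occ PK i j s -> ~~ occ J i j s -> occ A i' j' s' ->
  i' <= i -> j <= j' -> compat j s j' s' -> False.
Proof.
move=> xK /negP xJ yA ii jj c; apply: xJ; apply/occ_down; split=> //.
by exists i', j', s'.
Qed.

(** Minimality outside the ideal is tested on the two neighbours obtained by dropping an end. From
    column [n.+1] dropping the right end leads to both copies of the middle, hence the quantifier
    over signs. *)
Lemma occ_row i j s : occ R i j s <-> [/\ occ PK i j s, ~~ occ J i j s,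
  valid i.+1 j -> occ J i.+1 j s & i < j -> forall s', occ J i j.-1 s'].
Proof.
rewrite /occ; split.
  move=> /andP[v /mem_row[xP xN mx]]; rewrite v xP (negbTE xN); split=> //.
    move=> v1; rewrite v1 /=; have h1 : le (el i.+1 j s) (el i j s).
      by rewrite (el_le hP) // leqnSn leqnn compat_refl.
    apply: mx => //; last first.
      by apply/eqP=> /(congr1 rk); rewrite !(el_rk hP) //; rewrite /valid in v1; nlia.
    have := @occ_supported_le i.+1 j s i j s; rewrite /occ v v1 xP compat_refl leqnSn leqnn.
    exact.
  move=> ij s'; have v1 : valid i j.-1 by rewrite /valid in v *; nlia.
  have c : compat j.-1 s' j s by apply/compatP; clear -ij; nlia.
  rewrite v1 /=; apply: mx => //; last first.
  - by apply/eqP=> /(congr1 rk); rewrite !(el_rk hP) //; nlia.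
  - by rewrite (el_le hP) // leqnn leq_pred.
  have := @occ_supported_le i j.-1 s' i j s; rewrite /occ v v1 xP leqnn leq_pred c.
  exact.
move=> [/andP[v xP]]; rewrite v /= => xN h1 h2; apply/mem_row; split=> // y yP yx ne.
have /supportedP[yP0 _] := yP.
have [i' [j' [s' [v' ey]]]] := el_onto hP yP0; rewrite ey in yP yx ne *.
move: yx; rewrite (el_le hP) // => /and3P[ii jj c].
suff : occ J i' j' s' by case/andP.
have down2 : i < j -> j' <= j.-1 -> occ J i' j' s'.
  move=> ij hj; have := h2 ij s'; rewrite -/(occ J i j.-1 s') => h.
  by apply: occ_down_le h v' ii hj _; apply/compatP.
have [i1|i1] := ltnP i i'.
  have [v1|v1] := boolP (valid i.+1 j).
    have := h1 v1; rewrite -/(occ J i.+1 j s) => h.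
    exact: occ_down_le h v' i1 jj c.
  by apply: down2; clear h1 h2; rewrite /valid in v v' v1; nlia.
have ei : i' = i by clear -ii i1; nlia.
have [j1|j1] := ltnP j' j; first by apply: down2; clear h1 h2; rewrite /valid in v v'; nlia.
have ej : j' = j by clear -jj j1; nlia.
subst i' j'; case/eqP: ne; apply: le_anti; rewrite !(el_le hP) // !leqnn c /=.
by apply/compatP=> d e1 e2; have /compatP -> := c.
Qed.

Lemma occ_supported_node i j s k s' : occ PK i j s -> i <= k -> k <= j -> k <= n ->
  compat k s' j s -> occ K k k s'.
Proof. by move=> /occ_supported[_ h]; apply: h. Qed.

Lemma occ_simple k s : occ K k k s -> occ PK k k s.
Proof.
move=> /andP[v kK]; rewrite /occ v /=; apply: (rank0_supported (rk := rk)) => //.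
- exact: graded_triangle.
- exact: (subsetP KS).
Qed.

Lemma occ_supported_left i j s : i < n -> occ K i i true -> occ PK i.+1 j s -> valid i j ->
  occ PK i j s.
Proof.
move=> iN hi h v; apply/occ_supported; split=> // k s' ik kj kn c.
have [ek|nk] := eqVneq k i; last by apply: (occ_supported_node h _ kj kn c); nlia.
by rewrite ek; apply: occ_sign hi; rewrite neq_ltn iN.
Qed.

(** An interval that goes past the middle involves every node from [i] to [n] with all copies, so
    its right end puts no further condition on the support. *)
Lemma occ_supported_high i j s i' j' s' : occ PK i j s -> n < j -> i <= i' -> valid i' j' ->
  occ PK i' j' s'.
Proof.
move=> h nj ii v; apply/occ_supported; split=> // k s1 ik kj kn c.
by apply: (occ_supported_node h _ _ kn _); [nlia | nlia | apply: compatr; nlia].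
Qed.

Hypothesis fA : full_support le K A.

Lemma occ_full k s : occ K k k s ->
  exists i j s', [/\ occ A i j s', i <= k, k <= j & compat k s j s'].
Proof.
move=> /andP[v kK]; have [x xA kx] := fA kK.
have /antichainP[/subsetP AP _] := hA; have /supportedP[xP _] := AP _ xA.
have [i [j [s' [v' ex]]]] := el_onto hP xP; exists i, j, s'.
by move: kx; rewrite ex (el_le hP) // => /and3P[-> -> ->]; rewrite /occ v' -ex xA.
Qed.

Lemma occ_full_down k s : occ K k k s -> occ J k k s.
Proof. by move=> h; apply/occ_down; split; [apply: occ_simple | apply: occ_full]. Qed.

Lemma row_not_simple k s : ~ occ R k k s.
Proof.
move=> /occ_row[h /negP n1 _ _]; apply: n1; apply: occ_full_down.
have kn : k <= n by case/andP: h => v _; rewrite /valid in v; nlia.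
by apply: (occ_supported_node h _ _ kn _); rewrite ?compat_refl.
Qed.

Lemma occ_row_supported i j s : occ R i j s -> occ PK i j s.
Proof. by move=> /occ_row[]. Qed.

Lemma occ_above_notin i j s i' j' s' : occ A i j s -> i' <= i -> j <= j' ->
  compat j s j' s' -> (i != i') || (j != j') -> ~~ occ J i' j' s'.
Proof.
move=> hx ii jj c ne; apply/negP=> /occ_down[_ [i2 [j2 [s2 [hy ii2 jj2 c2]]]]].
have c3 : compat j s j2 s2.
  apply/compatP=> d e1 e2; have e3 : j' = n by nlia.
  by rewrite (compatP _ _ _ _ c d e1 e3) (compatP _ _ _ _ c2 d e3 e2).
by have := occ_anti hx hy (leq_trans ii2 ii) (leq_trans jj jj2) c3 => -[e1 e2]; nlia.
Qed.

(** If [[i, k.+1]] is new, the element of [A] over [[i, k]] cannot reach [k.+1], so it ends at [k].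
    Conversely, if [[i, k]] is in [A], then in column [k.+1] the ideal misses [[i, k.+1]] but
    contains the node by full support, and the border between them is new. *)
Lemma ends_at_row k : k.+1 < n -> occ K k.+1 k.+1 true ->
  ends_at k.+1 R <-> ends_at k A.
Proof.
move=> kn hk; split=> -[i [s h]].
  have /occ_row[hPK hJ _ hlow] := h; have v := occ_valid h.
  have ik : i < k.+1.
    have [//|ki] := ltnP i k.+1; have ei : i = k.+1 by rewrite /valid in v; nlia.
    by rewrite ei in h; case: (row_not_simple h).
  have /occ_down[_ [i' [j' [s' [ha ii jj c]]]]] := hlow ik s.
  exists i', s'; suff <- : j' = k by [].
  have [kj|] := ltnP k j'; last by nlia.
  by case: (occ_downN hPK hJ ha ii kj _); apply: compatl; nlia.
have v := occ_valid h.
have ik : i <= k.+1 by rewrite /valid in v; nlia.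
have nJ : ~~ occ J i k.+1 true by apply: (occ_above_notin h) => //; [apply: compatl|]; nlia.
have [x [ix xk nx jx]] := nat_switch (f := fun x => occ J x k.+1 true) ik nJ (occ_full_down hk).
exists x, true; apply/occ_row; split=> //.
- apply/occ_supported; split; first by rewrite /valid in v *; nlia.
  move=> k' s' xk' kk kn' c; have [->|ne] := eqVneq k' k.+1.
    by apply: occ_sign hk; rewrite neq_ltn kn.
  apply: (occ_supported_node (occ_antichain h)) => //; first by nlia.
    by nlia.
  by apply: compatr; nlia.
- move=> _ s'; apply: occ_down_le (occ_antichain_down h) _ ix _ _ => //=.
    by rewrite /valid in v *; nlia.
  by apply: compatr; nlia.
Qed.

(** No supported interval crosses into [k] from the left. One ending at [k] would be the node
    itself, which rowmotion does not produce here, and the element of [A] over the node starts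
    there. *)
Lemma ends_at_row_first k : k < n -> (forall i s, k = i.+1 -> ~~ occ K i i s) -> occ K k k true ->
  ~ ends_at k R /\ starts_at k A.
Proof.
move=> kn hk1 hk; split.
  move=> [i [s h]]; have v := occ_valid h.
  have [ik|ki] := ltnP i k; last first.
    have ei : i = k by rewrite /valid in v; nlia.
    by rewrite ei in h; case: (row_not_simple h).
  have := hk1 k.-1 true (esym (ltn_predK ik)); apply/negP; rewrite negbK.
  by apply: (occ_supported_node (occ_row_supported h)); [nlia | nlia | nlia | apply: compatl; nlia].
have [i [j [s' [h ik kj c]]]] := occ_full hk; left; exists j, s'.
have [ik1|ki] := ltnP i k; last by have <- : i = k by nlia.
have := hk1 k.-1 true (esym (ltn_predK ik1)); apply: contraNP => _.
by apply: (occ_supported_node (occ_antichain h)); [nlia | nlia | nlia | apply: compatl; nlia].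
Qed.

Lemma starts_at_row_last k : k < n -> (forall s, ~~ occ K k.+1 k.+1 s) -> occ K k k true ->
  ~ starts_at k R /\ ends_at k A.
Proof.
move=> kn hk1 hk.
have no i j s : occ PK i j s -> i <= k -> k < j -> False.
  move=> h ik kj; have /negP[] := hk1 s.
  apply: (occ_supported_node h) => //; first by nlia.
  by apply/compatP.
split.
  move=> [[j [s h]]|[i [s h]]]; have v := occ_valid h.
    have [kj|jk] := ltnP k j; first exact: (no _ _ _ (occ_row_supported h) (leqnn k) kj).
    have ej : j = k by rewrite /valid in v; nlia.
    by rewrite ej in h; case: (row_not_simple h).
  apply: (no _ _ _ (occ_row_supported h)); last by nlia.
  by rewrite /valid in v; nlia.
have [i [j [s' [h ik kj c]]]] := occ_full hk; exists i, s'.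
have [kj1|jk] := ltnP k j; last by have <- : j = k by nlia.
by case: (no _ _ _ (occ_antichain h) ik kj1).
Qed.

(** The counterpart of [ends_at_row], along the bent line made of the row of [k] and then of the
    column [n + n - k]. The border of the ideal may fall on either part. *)
Lemma starts_at_row k : k.+1 < n -> occ K k k true -> occ K k.+1 k.+1 true ->
  starts_at k R <-> starts_at k.+1 A.
Proof.
move=> kn hk hk1.
have vk : valid k k by case/andP: hk.
split.
  have colcase i s : occ R i (n + n - k) s -> starts_at k.+1 A.
    move=> h; have v := occ_valid h; have /occ_row[hPK hJ _ hlow] := h.
    have ij : i < n + n - k by rewrite /valid in v; nlia.
    have /occ_down[_ [i' [j' [s' [ha ii jj c]]]]] := hlow ij s; right; exists i', s'.
    suff <- : j' = n + n - k.+1 by [].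
    have [jlt|jge] := ltnP j' (n + n - k); first by nlia.
    by case: (occ_downN hPK hJ ha ii jge _); apply: compatl; nlia.
  move=> [[j [s h]]|[i [s h]]]; last exact: colcase h.
  have v := occ_valid h; have /occ_row[hPK hJ hleft _] := h.
  have kj : k < j.
    have [//|jk] := ltnP k j; have ej : j = k by rewrite /valid in v; nlia.
    by rewrite ej in h; case: (row_not_simple h).
  have [v1|v1] := boolP (valid k.+1 j); last first.
    by apply: (colcase k s); have <- : j = n + n - k by rewrite /valid in v v1; nlia.
  have /occ_down[_ [i' [j' [s' [ha ii jj c]]]]] := hleft v1; left; exists j', s'.
  suff <- : i' = k.+1 by [].
  have [ik|] := ltnP i' k.+1; last by nlia.
  by case: (occ_downN hPK hJ ha ik jj c).
have rowcase j s : occ A k.+1 j s -> starts_at k R.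
  move=> h; have v := occ_valid h; have v1 : valid k j by rewrite /valid in v *; nlia.
  have hPK := occ_supported_left (ltnW kn) hk (occ_antichain h) v1.
  (* Both signs are asked for, so that the last interval before the border has all its copies in the
     ideal, as [occ_row] requires. *)
  pose f j' := ~~ (occ J k j' true && occ J k j' false).
  have fk : ~~ f k.
    rewrite /f negbK; have h1 := occ_full_down hk; rewrite h1 /=.
    by apply: occ_sign h1; apply/orP; left; nlia.
  have nJ : ~~ occ J k j s by apply: (occ_above_notin h) => //; [apply/compatP | nlia].
  have fj : f j by rewrite /f; case: {+}s nJ => /negbTE->; rewrite ?andbF.
  have kj : k <= j by rewrite /valid in v1; nlia.
  have [x [kx xj nx fx]] := nat_switch kj fk fj.
  have [s' [ns' cs']] : exists s', ~~ occ J k x.+1 s' /\ compat x.+1 s' j s.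
    have [ex|ne] := eqVneq x.+1 j; first by exists s; rewrite ex compat_refl.
    move: fx; rewrite /f negb_and => /orP[nn|nn]; [exists true | exists false]; split=> //.
      by apply/compatP; nlia.
    by apply/compatP; nlia.
  left; exists x.+1, s'; apply/occ_row; split=> //.
  - apply: (occ_supported_le hPK) => //; rewrite /valid in v1 *; nlia.
  - by move=> vx; apply: (occ_down_le (occ_antichain_down h)).
  - move=> _ s2 /=; move: nx; rewrite /f negbK => /andP[nx1 nx2].
    by case: s2.
move=> [[j [s h]]|[i [s h]]]; first exact: rowcase h.
have v := occ_valid h.
have [ik|ki] := ltnP i k.+1; last first.
  by apply: (rowcase (n + n - k.+1) s); move: h; have -> : i = k.+1 by rewrite /valid in v; nlia.
(* Since [[k.+1, n + n - k]] is not valid, the search may stop at the corner [x = k], where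
   [occ_row] puts no condition on the left. *)
pose f x := occ J x (n + n - k) true || (x == k.+1).
have nJ : ~~ occ J i (n + n - k) true.
  by apply: (occ_above_notin h) => //; [nlia | apply: compatl; nlia | nlia].
have fi : ~~ f i by rewrite /f negb_or nJ neq_ltn ik.
have fk : f k.+1 by rewrite /f eqxx orbT.
have [x [ix xk nx jx]] := nat_switch (ltnW ik) fi fk.
right; exists x, true; apply/occ_row; split.
- by apply: (occ_supported_high _ (occ_antichain h)) => //; rewrite /valid in v *; nlia.
- by move: nx; rewrite /f negb_or => /andP[].
- move=> v1; move: jx; rewrite /f => /orP[//|/eqP ex].
  by rewrite /valid in v v1; nlia.
- move=> _ s2; apply: (occ_down_le (occ_antichain_down h)) => //.
  + by rewrite /valid in v *; nlia.
  + by nlia.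
  + by apply: compatr; nlia.
Qed.

Section FullMiddle.
Hypothesis hmid : forall s, occ K n n s.

Lemma middle_valid : mid.
Proof. by have /andP[v _] := hmid true; rewrite /valid ltnn orbF in v; case/and3P: v. Qed.

Lemma all_middles_row k : k.+1 = n -> occ K k k true -> all_middles R <-> ends_at k A.
Proof.
move=> kn hk; split.
  move=> hM; have [x1 h1] := hM true; have [x2 h2] := hM false.
  (* Use the middle element with the smaller left end [x]. If the element of [A] over [[x, k]]
     reached the middle, it would be compatible with one of the two signs and lie above the
     corresponding new element. *)
  have aux s x y : occ R x n s -> occ R y n (~~ s) -> x <= y -> ends_at k A.
    move=> hx hy xy; have /occ_row[hPK hJ _ hlow] := hx.
    have /occ_row[hPKy hJy _ _] := hy.
    have v := occ_valid hx.
    have xn : x < n.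
      have [//|nx] := ltnP x n; have ex : x = n by rewrite /valid in v; nlia.
      by rewrite ex in hx; case: (row_not_simple hx).
    have /occ_down[_ [i' [j' [s' [ha ii jj c]]]]] := hlow xn s; exists i', s'.
    suff <- : j' = k by [].
    have [nj|] := ltnP n.-1 j'; last by nlia.
    have jn' : n <= j' by nlia.
    have [cs|ncs] := boolP (compat n s j' s').
      by case: (occ_downN hPK hJ ha ii jn' cs).
    have cs' : compat n (~~ s) j' s'.
      move: ncs; rewrite negbK => /and4P[_ _ _ nss].
      by apply/compatP => _ _ _; case: {+}s nss; case: {+}s'.
    by case: (occ_downN hPKy hJy ha (leq_trans ii xy) jn' cs').
  have [xy|yx] := leqP x1 x2; first exact: (aux true _ _ h1 h2).
  exact: (aux false _ _ h2 h1 (ltnW yx)).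
move=> [i [s h]] s1; have v := occ_valid h.
have ik : i <= n by rewrite /valid in v; nlia.
have nJ : ~~ occ J i n s1 by apply: (occ_above_notin h) => //; [nlia|apply: compatl; nlia|nlia].
have [x [ix xk nx jx]] := nat_switch (f := fun x => occ J x n s1) ik nJ (occ_full_down (hmid s1)).
exists x; apply/occ_row; split=> //.
- apply/occ_supported; split; first by have m := middle_valid; rewrite /valid m in v *; nlia.
  move=> k' s' xk' kk kn' c; have [->|ne] := eqVneq k' n; first exact: hmid.
  apply: (occ_supported_node (occ_antichain h)) => //; try nlia.
  by apply: compatl; nlia.
- move=> _ s'; apply: (occ_down_le (occ_antichain_down h)) => //.
  + by rewrite /valid in v *; nlia.
  + by nlia.
  + by apply: compatl; nlia.
Qed.

Lemma starts_at_row_mid k : k.+1 = n -> occ K k k true -> starts_at k R <-> all_middles A.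
Proof.
move=> kn hk; have hm := middle_valid; have e1 : n + n - k = n.+1 by nlia.
split.
  move=> [[j [s h]]|[i [s h]]]; last first.
    rewrite e1 in h; have v := occ_valid h; have /occ_row[hPK hJ _ hlow] := h.
    have ij : i < n.+1 by rewrite /valid in v; nlia.
    move=> s1; have /occ_down[_ [i' [j' [s' [ha ii /= jj c]]]]] := hlow ij s1.
    have ej : j' = n.
      have [nj|] := ltnP n j'; last by nlia.
      by case: (occ_downN hPK hJ ha ii nj _); apply: compatl; nlia.
    rewrite ej in ha c; exists i'.
    have [d|nd] := boolP dbl; last by apply: occ_sign ha; rewrite nd orbT.
    by rewrite (compatP _ _ _ _ c d erefl erefl).
  have v := occ_valid h; have /occ_row[hPK hJ hleft hlow] := h.
  have kj : k < j.
    have [//|jk] := ltnP k j; have ej : j = k by rewrite /valid in v; nlia.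
    by rewrite ej in h; case: (row_not_simple h).
  have [ejn|nejn] := eqVneq j n; last first.
    have ej1 : j = n.+1 by rewrite /valid in v; nlia.
    move=> s1; rewrite ej1 in hlow hPK hJ kj.
    have /occ_down[_ [i' [j' [s' [ha ii /= jj c]]]]] := hlow kj s1.
    have ej : j' = n.
      have [nj|] := ltnP n j'; last by nlia.
      by case: (occ_downN hPK hJ ha ii nj _); apply: compatl; nlia.
    rewrite ej in ha c; exists i'.
    have [d|nd] := boolP dbl; last by apply: occ_sign ha; rewrite nd orbT.
    by rewrite (compatP _ _ _ _ c d erefl erefl).
  move=> s1; have [i' [j' [s' [ha ii jj c]]]] := occ_full (hmid s1).
  have v' := occ_valid ha; rewrite ejn in hPK hJ.
  have ej : j' = n.
    have [nj|] := ltnP n j'; last by nlia.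
    case: (occ_downN hPK hJ ha _ jj _); last by apply: compatr; nlia.
    by rewrite /valid in v'; nlia.
  rewrite ej in ha c; exists i'.
  have [d|nd] := boolP dbl; last by apply: occ_sign ha; rewrite nd orbT.
  by rewrite (compatP _ _ _ _ c d erefl erefl).
move=> hM; have [x1 h1] := hM true; have [x2 h2] := hM false.
(* Here [i0] is the larger of the two left ends, so that every [[x, n]] with [x] at least [i0] is in
   the ideal for both signs. *)
have [i0 [s0 [h0 max0]]] : exists i0 s0, occ A i0 n s0 /\
    forall s, exists i, occ A i n s /\ i <= i0.
  have [xy|yx] := leqP x1 x2.
    by exists x2, false; split=> // -[]; [exists x1 | exists x2].
  by exists x1, true; split=> // -[]; [exists x1 | exists x2]; split=> //; exact: ltnW.
have v0 := occ_valid h0.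
have [ei0|nei0] := eqVneq i0 n.
  rewrite ei0 -{1}kn in h0; left; exists n, s0; apply/occ_row.
  have vkn : valid k n by rewrite /valid hm; nlia.
  split.
  - apply: occ_supported_left (occ_antichain h0) vkn => //; nlia.
  - by apply: (occ_above_notin h0); rewrite ?compat_refl //; nlia.
  - by move=> _; apply: occ_antichain_down.
  - move=> _ s; rewrite -{1}kn /=; have := occ_full_down hk.
    by apply: occ_sign; apply/orP; left; nlia.
have i0k : i0 <= k by rewrite /valid in v0; nlia.
pose f x := occ J x n.+1 true || (x == n).
have nJ : ~~ occ J i0 n.+1 true by apply: (occ_above_notin h0) => //; [apply: compatr; nlia|nlia].
have fi : ~~ f i0 by rewrite /f negb_or nJ nei0.
have fn : f n by rewrite /f eqxx orbT.
have [|x [ix xn nx jx]] := nat_switch (f := f) _ fi fn; first by nlia.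
right; exists x, true; rewrite e1.
have vx : valid x n.+1 by rewrite /valid hm; nlia.
apply/occ_row; split.
- apply/occ_supported; split=> // k' s' xk' kk kn' c.
  have [->|ne] := eqVneq k' n; first exact: hmid.
  apply: (occ_supported_node (occ_antichain h0)) => //; try nlia.
  by apply: compatl; nlia.
- by move: nx; rewrite /f negb_or => /andP[].
- move=> v1; move: jx; rewrite /f => /orP[//|/eqP ex].
  by rewrite /valid in v1; nlia.
- move=> _ s1 /=; have [i [hi ii0]] := max0 s1.
  apply: (occ_down_le (occ_antichain_down hi)) => //; [|nlia|exact: compat_refl].
  by rewrite /valid hm; nlia.
Qed.

(** A new central interval would strictly contain a central one of [A], and dropping its right end
    would give an interval of the ideal forcing a second element of [A] above the first. If neither
    antichain has a central interval, climbing the diagonal from the middle leads to a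
    contradiction. *)
Lemma has_central_row : has_central R <-> ~ has_central A.
Proof.
have hm := middle_valid; split.
  move=> [i [j [s [h eij]]]] [i' [j' [s' [ha eij']]]].
  have v := occ_valid h; have v' := occ_valid ha; have /occ_row[hPK hJ hleft hlow] := h.
  have ij : i < j.
    have [//|ji] := ltnP i j; have ej : j = i by rewrite /valid in v; nlia.
    by rewrite ej in h; case: (row_not_simple h).
  have ii' : i < i'.
    have [//|ii] := ltnP i i'.
    have [ein|nein] := eqVneq i n; first by rewrite /valid in v; nlia.
    case: (occ_downN hPK hJ ha ii _ _); first by nlia.
    by apply: compatl; nlia.
  have /occ_down[_ [i2 [j2 [s2 [ha2 ii2 jj2 c2]]]]] := hlow ij s'.
  have [] := occ_anti ha ha2 _ _ _; try nlia.
  apply/compatP => d e1 e2; apply: (compatP _ _ _ _ c2) => //; nlia.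
move=> nC; apply: contrapT => nR.
(* An element of [A] over [[n - d, n + d]] is not central, hence starts further left. So
   [[n - d.+1, n + d]] is in the ideal, and the next central interval would be new if it were
   outside. *)
have key d : d <= n -> forall s, occ J (n - d) (n + d) s.
  elim: d => [|d IH] dn s; first by rewrite subn0 addn0; apply: occ_full_down.
  have up s1 : exists i' j' s', [/\ occ A i' j' s', i' <= n - d.+1, n + d <= j' & compat (n + d) s1 j' s'].
    have /occ_down[_ [i' [j' [s' [ha ii jj c]]]]] := IH (ltnW dn) s1.
    exists i', j', s'; split=> //; have v' := occ_valid ha.
    have [//|ni] := leqP i' (n - d.+1).
    by case: nC; exists i', j', s'; split=> //; rewrite /valid in v'; nlia.
  apply: contraT => nJ; case: nR; exists (n - d.+1), (n + d.+1), s; split; last by nlia.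
  have lower s1 : occ J (n - d.+1) (n + d) s1.
    have [i' [j' [s' [ha ii jj c]]]] := up s1.
    by apply: (occ_down_le (occ_antichain_down ha)) => //; rewrite /valid hm; nlia.
  have v : valid (n - d.+1) (n + d.+1) by rewrite /valid hm; nlia.
  apply/occ_row; split=> //.
  - apply/occ_supported; split=> // k s' ik kj kn _.
    have [hK _] := iffLR (occ_down _ _ _) (lower s').
    by apply: (occ_supported_node hK) => //; [nlia | apply/compatP].
  - by move=> v1; rewrite /valid in v1; nlia.
  - by move=> _ s'; rewrite addnS; apply: lower.
have /occ_down[_ [i [j [s [ha ii jj c]]]]] := key n (leqnn n) true.
have v := occ_valid ha; apply: nC; exists i, j, s; split=> //.
by rewrite /valid in v; nlia.
Qed.

(** Exchanging the two copies of the middle is a symmetry of the supported poset, and [A], its ideal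
    and its rowmotion image determine one another. *)
Lemma sign_symmetric_row : sign_symmetric R <-> sign_symmetric A.
Proof.
have hm := middle_valid.
have suppN i s : occ PK i n s -> occ PK i n (~~ s).
  move=> h; apply/occ_supported; split; first exact: occ_valid h.
  move=> k s' ik kn _ c; have [->|ne] := eqVneq k n; first exact: hmid.
  by apply: (occ_supported_node h) => //; apply: compatl.
have Jsym_row : sign_symmetric J -> sign_symmetric R.
  move=> hJ i s h; have /occ_row[hPK hn hleft hlow] := h.
  apply/occ_row; split=> //; first exact: suppN.
  - by apply: contra hn => /hJ; rewrite negbK.
  - by move=> v1; apply: hJ; apply: hleft.
have row_Jsym : sign_symmetric R -> sign_symmetric J.
  move=> hR i s h; have v := occ_valid h; have [hK _] := iffLR (occ_down _ _ _) h.
  apply: contraT => nJ; have xK := suppN _ _ hK.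
  have xX : el i n (~~ s) \in PK :\: J.
    rewrite in_setD; move: nJ xK; rewrite /occ v /= => nJ xK.
    by apply/andP; split; rewrite ?nJ.
  have [y yR yx] := minimal_below le_refl le_trans (@graded_supported _ _ _ le_trans _ graded_triangle K) (subsetDl PK J) xX.
  have /minimalsP[/setDP[/supportedP[yP _] _] _] := yR.
  have [i' [j' [s' [v' ey]]]] := el_onto hP yP.
  have hy : occ R i' j' s' by rewrite /occ v' -ey.
  move: yx; rewrite ey (el_le hP) // => /and3P[ii jj c].
  have bad i2 s2 : occ R i2 j' s2 -> i <= i2 -> compat j' s2 n s -> False.
    move=> h2 ii2 c2; have /occ_row[_ /negP n2 _ _] := h2; apply: n2.
    by apply: (occ_down_le h (occ_valid h2)).
  have [ej|ne] := eqVneq j' n; last by case: (bad _ _ hy ii); apply: compatl.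
  rewrite ej in hy bad c; have [d|nd] := boolP dbl.
    case: (bad _ _ (hR _ _ hy) ii); apply/compatP => _ _ _.
    by rewrite (compatP _ _ _ _ c d erefl erefl) negbK.
  by case: (bad _ _ hy ii); apply/compatP; rewrite (negbTE nd).
have AJ : sign_symmetric A -> sign_symmetric J.
  move=> hS i s /[dup] h /occ_down[hK [i' [j' [s' [ha ii jj c]]]]].
  apply/occ_down; split; first exact: suppN.
  have [ej|ne] := eqVneq j' n; last by exists i', j', s'; split=> //; apply: compatr.
  rewrite ej in ha c; exists i', n, (~~ s'); split=> //; first exact: hS.
  by apply/compatP => d _ _; rewrite (compatP _ _ _ _ c d erefl erefl).
have JA : sign_symmetric J -> sign_symmetric A.
  move=> hJ i s h; have [hK [i' [j' [s' [ha ii jj c]]]]] := iffLR (occ_down _ _ _) (hJ _ _ (occ_antichain_down h)).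
  have [ej|ne] := eqVneq j' n; last first.
    have [|_ e] := occ_anti h ha ii jj; first exact: compatr.
    by rewrite -e eqxx in ne.
  rewrite ej in ha c.
  have h1 := hJ _ _ (occ_antichain_down ha).
  have [_ [i2 [j2 [s2 [hb ii2 jj2 c2]]]]] := iffLR (occ_down _ _ _) h1.
  have c3 : compat n s j2 s2.
    apply/compatP=> d e1 e2; rewrite -(compatP _ _ _ _ c2 d e1 e2).
    by rewrite -(compatP _ _ _ _ c d erefl erefl) negbK.
  have [e3 _] := occ_anti h hb (leq_trans ii2 ii) jj2 c3.
  have ei : i' = i by nlia.
  rewrite ei in ha; have [d|nd] := boolP dbl.
    by rewrite (compatP _ _ _ _ c d erefl erefl).
  by apply: occ_sign h; rewrite nd orbT.
split=> [/row_Jsym /JA //|/AJ /Jsym_row //].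
Qed.

End FullMiddle.

Lemma middles_row_first : (forall k s, n = k.+1 -> ~~ occ K k k s) ->
  (forall i s, ~~ occ R i n s) /\
  forall s, occ K n n s -> exists2 s', occ A n n s' & compat n s n s'.
Proof.
move=> hk.
have no i j s : occ PK i j s -> i < n -> n <= j -> False.
  move=> h iN nj; have /negP[] := hk n.-1 true (esym (ltn_predK iN)).
  by apply: (occ_supported_node h); [nlia | nlia | nlia | apply: compatl; nlia].
split.
  move=> i s; apply/negP=> h; have v := occ_valid h.
  have [iN|Ni] := ltnP i n; first exact: (no _ _ _ (occ_row_supported h) iN (leqnn n)).
  have ei : i = n by rewrite /valid in v; nlia.
  by rewrite ei in h; case: (row_not_simple h).
move=> s hs; have [i [j [s' [ha ii jj c]]]] := occ_full hs; have v := occ_valid ha.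
have [iN|Ni] := ltnP i n; first by case: (no _ _ _ (occ_antichain ha) iN jj).
have ei : i = n by nlia.
have ej : j = n by rewrite /valid in v; nlia.
by exists s'; rewrite ei ej in ha c.
Qed.

Section HalfMiddle.
Variable s0 : bool.
Hypotheses (hs0 : occ K n n s0) (hs1 : ~~ occ K n n (~~ s0)).

Lemma half_dbl : dbl.
Proof.
apply: contraT => nd; case/negP: hs1.
by apply: occ_sign hs0; rewrite nd orbT.
Qed.

(** With one copy missing nothing goes past the middle, which becomes the end of an ordinary path as
    in type A. *)
Lemma half_middle i j s : occ PK i j s -> i <= n -> n <= j -> j = n /\ s = s0.
Proof.
move=> h iN nj; have d := half_dbl.
have [ej|ne] := eqVneq j n; last first.
  by case/negP: hs1; apply: (occ_supported_node h) => //; apply: compatr.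
split=> //; apply/eqP; apply: contraT => ns; case/negP: hs1.
apply: (occ_supported_node h) => //; apply/compatP => _ _ _.
by case: {+}s ns; case: {+}s0.
Qed.

Lemma some_middle_half : some_middle A.
Proof.
have [i [j [s [ha ii jj c]]]] := occ_full hs0.
have [ej _] := half_middle (occ_antichain ha) ii jj.
by exists i, s; rewrite -ej.
Qed.

Lemma some_middle_row_half k : k.+1 = n -> occ K k k true -> some_middle R <-> ends_at k A.
Proof.
move=> kn hk; have d := half_dbl; split=> -[i [s h]]; have v := occ_valid h.
  have iN : i < n.
    have [//|Ni] := ltnP i n; have ei : i = n by rewrite /valid in v; nlia.
    by rewrite ei in h; case: (row_not_simple h).
  have /occ_row[hPK hJ _ hlow] := h.
  have /occ_down[_ [i' [j' [s' [ha ii jj c]]]]] := hlow iN s.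
  exists i', s'; suff <- : j' = k by [].
  have [nj|] := ltnP n.-1 j'; last by nlia.
  have nj' : n <= j' by nlia.
  have [_ es] := half_middle hPK (ltnW iN) (leqnn n).
  have [ej es'] := half_middle (occ_antichain ha) (leq_trans ii (ltnW iN)) nj'.
  by case: (occ_downN hPK hJ ha ii nj'); apply/compatP; rewrite es es'.
have ik : i <= n by rewrite /valid in v; nlia.
have nJ : ~~ occ J i n s0 by apply: (occ_above_notin h) => //; [nlia|apply: compatl; nlia|nlia].
have [x [ix xk nx jx]] := nat_switch (f := fun x => occ J x n s0) ik nJ (occ_full_down hs0).
exists x, s0; apply/occ_row; split=> //.
- apply/occ_supported; split; first by have /andP[vn _] := hs0; rewrite /valid in v vn *; nlia.
  move=> k' s' xk' kk kn' c; have [ek|ne] := eqVneq k' n.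
    by rewrite ek in c *; rewrite (compatP _ _ _ _ c d erefl erefl).
  apply: (occ_supported_node (occ_antichain h)) => //; try nlia.
  by apply: compatl; nlia.
- move=> _ s'; apply: (occ_down_le (occ_antichain_down h)) => //.
  + by rewrite /valid in v *; nlia.
  + by nlia.
  + by apply: compatl; nlia.
Qed.

(** A central element can here only be the node [n] itself, so [has_central] stands for starting at
    [n], just as [some_middle] stands for ending there. *)
Lemma starts_at_row_half k : k.+1 = n -> occ K k k true -> starts_at k R <-> has_central A.
Proof.
move=> kn hk; split.
  move=> [[j [s h]]|[i [s h]]]; have v := occ_valid h; last first.
    have [] := half_middle (occ_row_supported h); try (rewrite /valid in v; nlia).
  have kj : k < j.
    have [//|jk] := ltnP k j; have ej : j = k by rewrite /valid in v; nlia.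
    by rewrite ej in h; case: (row_not_simple h).
  have [||ej es] := half_middle (occ_row_supported h); try nlia.
  rewrite ej es in h; have /occ_row[hPK hJ hleft _] := h.
  have v1 : valid k.+1 n by rewrite kn; have /andP[] := hs0.
  have /occ_down[_ [i' [j' [s' [ha ii jj c]]]]] := hleft v1.
  have [ik|ki] := ltnP i' k.+1; first by case: (occ_downN hPK hJ ha ik jj c).
  have v' := occ_valid ha.
  by exists i', j', s'; split=> //; rewrite /valid in v'; nlia.
move=> [i [j [s [h e]]]]; have v := occ_valid h.
have [||ej es] := half_middle (occ_antichain h); try (rewrite /valid in v; nlia).
have ei : i = k.+1 by nlia.
rewrite ei ej es in h; left; exists n, s0; apply/occ_row.
have vkn : valid k n by rewrite /valid in v *; nlia.
split.
- by apply: occ_supported_left (occ_antichain h) vkn => //; nlia.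
- by apply: (occ_above_notin h); rewrite ?compat_refl //; nlia.
- by move=> _; apply: occ_antichain_down.
- move=> _ s1; rewrite -{1}kn /=; have := occ_full_down hk.
  by apply: occ_sign; apply/orP; left; nlia.
Qed.

End HalfMiddle.

End Support.

(* Only in type D: the relations at the middle node may fail when one of its two
   copies is adjoined, and this is how. *)
Definition exceptional s (A B : {set T}) := [/\ occ A n n s, occ B n n (~~ s),
  forall i, ~~ occ A i n (~~ s) & forall i, ~~ occ B i n s].

(** The clauses treat the nodes below the middle, a middle with one copy in [K], and a middle with
    all copies. In the last one [all_middles] is what links right ends and left ends under
    rowmotion; the other two conditions determine the contribution of the middle to the count. *)
Definition paired (K A B : {set T}) := [/\
  forall k, k < n -> occ K k k true ->
    (starts_at k A <-> ~ ends_at k B) /\ (starts_at k B <-> ~ ends_at k A),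
  forall s, occ K n n s -> ~~ occ K n n (~~ s) ->
    (some_middle A <-> ~ has_central B) /\ (some_middle B <-> ~ has_central A)
  & (forall s, occ K n n s) ->
    [/\ all_middles A <-> ~ all_middles B, has_central A <-> ~ has_central B
      & sign_symmetric A <-> sign_symmetric B] \/ exists s, exceptional s A B].

Lemma occ_node_sign K k s : k < n -> occ K k k s = occ K k k true.
Proof.
by move=> kn; apply/idP/idP; apply: occ_sign; apply/orP; left; nlia.
Qed.

Lemma middle_cases (K : {set T}) : [\/ forall s, ~~ occ K n n s,
  exists2 s, occ K n n s & ~~ occ K n n (~~ s) | forall s, occ K n n s].
Proof.
have [h1|h1] := boolP (occ K n n true); have [h2|h2] := boolP (occ K n n false).
- by constructor 3; case.
- by constructor 2; exists true.
- by constructor 2; exists false.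
- by constructor 1; case; apply/negP; rewrite ?(negbTE h1) ?(negbTE h2).
Qed.

(** * Transport of the relation by rowmotion *)

Section Step.
Variables (K A B : {set T}).
Hypothesis KS : K \subset S.
Let PK := supported le rk P K.
Hypotheses (hA : A \in antichains le PK) (hB : B \in antichains le PK)
  (fA : full_support le K A) (fB : full_support le K B).
Hypothesis hR : paired K (rowmotion le PK A) B.

Lemma no_predecessor k : (forall k', k = k'.+1 -> ~~ occ K k' k' true) -> k <= n ->
  forall i s, k = i.+1 -> ~~ occ K i i s.
Proof.
by move=> h kn i s e; rewrite occ_node_sign; [apply: h | rewrite e in kn].
Qed.

Lemma predecessor_case k : k <= n -> (exists2 k', k = k'.+1 & occ K k' k' true) \/
  (forall i s, k = i.+1 -> ~~ occ K i i s).
Proof.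
move=> kn; have [h|h] := pselect (exists2 k', k = k'.+1 & occ K k' k' true); first by left.
right; apply: no_predecessor => // k' e; apply/negP=> hk; apply: h.
by exists k'.
Qed.

(** Both sides come from the node before [k]: left ends of [A] from those of its image there, right
    ends of the image of [B] from those of [B]. If that node is not in [K], both sides hold
    outright. *)
Lemma step_starts k : k < n -> occ K k k true ->
  starts_at k A <-> ~ ends_at k (rowmotion le PK B).
Proof.
move=> kn hk; have [rel _ _] := hR; case: (predecessor_case (ltnW kn)).
  move=> [k' ek hk']; rewrite ek in kn hk *.
  rewrite (ends_at_row KS hB fB kn hk) -(starts_at_row KS hA fA kn hk' hk).
  by have [] := rel k' (ltnW kn) hk'.
move=> h; have [_ ?] := ends_at_row_first KS hA fA kn h hk.
by have [? _] := ends_at_row_first KS hB fB kn h hk.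
Qed.

Lemma exceptional_row s : ~ exceptional s (rowmotion le PK A) B.
Proof. by move=> [h _ _ _]; apply: (row_not_simple KS hA fA h). Qed.

Lemma step_ends k : k < n -> occ K k k true ->
  starts_at k (rowmotion le PK B) <-> ~ ends_at k A.
Proof.
move=> kn hk; have [rel half full] := hR.
have last_case : (forall s, ~~ occ K k.+1 k.+1 s) ->
    starts_at k (rowmotion le PK B) <-> ~ ends_at k A.
  move=> h; have [_ ?] := starts_at_row_last KS hA fA kn h hk.
  by have [? _] := starts_at_row_last KS hB fB kn h hk.
have [kn1|nk1] := ltnP k.+1 n.
  have [hk1|hk1] := boolP (occ K k.+1 k.+1 true); last first.
    by apply: last_case => s; rewrite occ_node_sign.
  rewrite (starts_at_row KS hB fB kn1 hk hk1) -(ends_at_row KS hA fA kn1 hk1).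
  by have [] := rel k.+1 kn1 hk1.
have en : k.+1 = n by nlia.
case: (middle_cases K) => [h|[s h1 h2]|h].
- by apply: last_case => s; rewrite en.
- rewrite (starts_at_row_half KS hB fB h1 h2 en hk) -(some_middle_row_half KS hA fA h1 h2 en hk).
  by have [e _] := half s h1 h2; rewrite e; split=> [h|/contrapT].
- rewrite (starts_at_row_mid KS hB fB h en hk) -(all_middles_row KS hA fA h en hk).
  case: (full h) => [[e _ _]|[s /exceptional_row //]].
  by rewrite e; split=> [?|/contrapT].
Qed.

Lemma paired_row : paired K A (rowmotion le PK B).
Proof.
have [rel half full] := hR; split.
- by move=> k kn hk; split; [apply: step_starts | apply: step_ends].
- move=> s h1 h2; split.
    split=> [_|_]; last exact: (some_middle_half hA fA h1 h2).
    move=> [i [j [s' [h e]]]]; have v := occ_valid h.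
    have [||ej _] := half_middle h1 h2 (occ_row_supported hB h); try (rewrite /valid in v; nlia).
    have ei : i = n by nlia.
    by rewrite ei ej in h; case: (row_not_simple KS hB fB h).
  case: (predecessor_case (leqnn n)) => [[k ek hk]|hk].
    rewrite (some_middle_row_half KS hB fB h1 h2 (esym ek) hk).
    rewrite -(starts_at_row_half KS hA fA h1 h2 (esym ek) hk).
    have [|e _] := rel k _ hk; first by rewrite ek.
    by rewrite e; split=> [?|/contrapT].
  have [no _] := middles_row_first KS hB fB hk.
  have [_ yes] := middles_row_first KS hA fA hk.
  split=> [[i [s' h]]|nc]; first by have := no i s'; rewrite h.
  by case: nc; have [s' ha _] := yes s h1; exists n, n, s'.
- move=> h; left; case: (full h) => [[em ec es]|[s /exceptional_row //]].
  split; last 2 first.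
  + rewrite (has_central_row KS hB fB h); move: ec; rewrite (has_central_row KS hA fA h).
    by case: (pselect (has_central A)); case: (pselect (has_central B)); tauto.
  + by rewrite (sign_symmetric_row hB h) -es (sign_symmetric_row hA h).
  case: (predecessor_case (leqnn n)) => [[k ek hk]|hk].
    rewrite (all_middles_row KS hB fB h (esym ek) hk).
    rewrite -(starts_at_row_mid KS hA fA h (esym ek) hk).
    by have [|e _] := rel k _ hk; first by rewrite ek.
  have [no _] := middles_row_first KS hB fB hk.
  have [_ yes] := middles_row_first KS hA fA hk.
  split=> [_ hm|_ s]; first by have [i hi] := hm true; have := no i true; rewrite hi.
  have [s' ha c] := yes s (h s); exists n; have [d|nd] := boolP dbl.
    by rewrite (compatP _ _ _ _ c d erefl erefl).
  by apply: occ_sign ha; rewrite nd orbT.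
Qed.

End Step.

(** * An orbit does not keep full support *)

Section Orbit.
Variables (K A : {set T}).
Hypotheses (KS : K \subset S) (K0 : K != set0).
Let PK := supported le rk P K.
Hypothesis hA : A \in antichains le PK.

Lemma orbit_not_full : exists m, ~ full_support le K (iter m (rowmotion le PK) A).
Proof.
apply: contrapT => allfull; pose F m := iter m (rowmotion le PK) A.
have full m : full_support le K (F m).
  by apply: contrapT => h; apply: allfull; exists m.
have hF m : F m \in antichains le PK by apply: iter_row_antichain.
(* Here [ev] means eventually false. The absence of a right end at the first node [k0] spreads by
   one node per step. *)
pose ev (Q : {set T} -> Prop) := exists N, forall m, N <= m -> ~ Q (F m).
have ev_step Q Q' : (forall m, Q' (F m.+1) <-> Q (F m)) -> ev Q -> ev Q'.
  by move=> h [N hN]; exists N.+1 => -[//|m] /hN hm /h.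
have ev_false Q : ev Q -> (forall m, Q (F m)) -> False.
  by move=> [N hN] /(_ N); apply: hN.
pose node k := occ K k k true || occ K k k false.
have node_sign k : k < n -> node k = occ K k k true.
  by move=> kn; rewrite /node (occ_node_sign K false kn) orbb.
have ex0 : exists k, node k.
  case/set0Pn: K0 => a aK; have /triangle_simpleP[k [s [v ea]]] := subsetP KS _ aK.
  have hk : occ K k k s by rewrite /occ v -ea.
  by exists k; rewrite /node; move: hk; case: {+}s => ->; rewrite ?orbT.
case: (ex_minnP ex0) => k0 nk0 min0.
have kn0 : k0 <= n.
  by move: nk0; rewrite /node /occ => /orP[] /andP[v _]; rewrite /valid in v; nlia.
have first i s : k0 = i.+1 -> ~~ occ K i i s.
  move=> e; apply: contraT; rewrite negbK => h.
  have : k0 <= i by apply: min0; rewrite /node; case: s h => ->; rewrite ?orbT.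
  by rewrite e ltnn.
have [k0n|nk] := ltnP k0 n; last first.
  have e0 : k0 = n by nlia.
  rewrite e0 in nk0 first; have [no _] := middles_row_first KS (hF 0) (full 0) first.
  have [_ yes] := middles_row_first KS (hF 1) (full 1) first.
  have [s hs] : exists s, occ K n n s by case/orP: nk0 => h; [exists true | exists false].
  by have [s' h _] := yes s hs; have := no n s'; rewrite h.
have hk0 : occ K k0 k0 true by rewrite -node_sign.
(* The run of nodes of [K] that begins at [k0] stops before [k1], with a cut at the middle. If it
   stops there for want of a next node, a right end is always present at its last node. *)
have ex1 : exists k, (k0 < k) && ((k == n) || ~~ node k).
  by exists n; rewrite k0n eqxx.
case: (ex_minnP ex1) => k1 /andP[k01 nk1] min1.
have k1n : k1 <= n by apply: min1; rewrite k0n eqxx.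
have run k : k0 <= k -> k < k1 -> occ K k k true.
  rewrite leq_eqVlt => /orP[/eqP <- //|k0k] kk1; rewrite -node_sign; last by nlia.
  apply: contraT => nk; have := min1 k; rewrite k0k nk orbT => /(_ isT).
  by rewrite leqNgt kk1.
have evE d : k0 + d < k1 -> ev (ends_at (k0 + d)).
  elim: d => [|d IH] hd.
    exists 1 => -[//|m] _; rewrite addn0.
    by have [] := ends_at_row_first KS (hF m) (full m) k0n first hk0.
  apply: ev_step (IH _); last by nlia.
  move=> m; rewrite addnS; apply: (ends_at_row KS (hF m) (full m)); first by nlia.
  by apply: run; nlia.
have evE1 : ev (ends_at k1.-1).
  have -> : k1.-1 = k0 + (k1.-1 - k0) by nlia.
  by apply: evE; nlia.
have hk1 : occ K k1.-1 k1.-1 true by apply: run; nlia.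
have lt1 : k1.-1 < n by nlia.
have e1 : k1.-1.+1 = k1 by nlia.
have last_case : (forall s, ~~ occ K k1 k1 s) -> False.
  move=> h; apply: (ev_false _ evE1) => m.
  have h' s : ~~ occ K k1.-1.+1 k1.-1.+1 s by rewrite e1.
  by have [] := starts_at_row_last KS (hF m) (full m) lt1 h' hk1.
have [k1n'|nk1'] := ltnP k1 n.
  apply: last_case => s; rewrite occ_node_sign // -node_sign //.
  by move: nk1; rewrite (ltn_eqF k1n').
have en : k1 = n by nlia.
rewrite en in last_case e1.
case: (middle_cases K) => [//|[s h1 h2]|h].
  apply: (ev_false some_middle) => [|m]; last exact: (some_middle_half (hF m) (full m) h1 h2).
  by apply: ev_step evE1 => m; apply: (some_middle_row_half KS (hF m) (full m) h1 h2 _ hk1); rewrite en.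
have evM : ev all_middles.
  by apply: ev_step evE1 => m; apply: (all_middles_row KS (hF m) (full m) h _ hk1); rewrite en.
(* Reflected at the middle, the absence returns towards [k0], now as the absence of left ends; but
   full support always gives a left end at [k0]. *)
have evS d : d < n - k0 -> ev (starts_at (n - d.+1)).
  elim: d => [|d IH] hd.
    have eq1 : n - 1 = k1.-1 by nlia.
    rewrite eq1; apply: ev_step evM => m.
    by apply: (starts_at_row_mid KS (hF m) (full m) h _ hk1); rewrite en.
  apply: ev_step (IH _); last by nlia.
  move=> m; have e2 : n - d.+1 = (n - d.+2).+1 by nlia.
  by rewrite e2; apply: (starts_at_row KS (hF m) (full m)); [nlia | apply: run; nlia | apply: run; nlia].
apply: (ev_false (starts_at k0)) => [|m].
  have {1}-> : k0 = n - (n - k0).-1.+1 by nlia.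
  by apply: evS; nlia.
by have [] := ends_at_row_first KS (hF m) (full m) k0n first hk0.
Qed.

End Orbit.

(** * Adjoining a simple root *)

Section Add.
Variables (K A B : {set T}) (k : nat) (s0 : bool).
Hypotheses (KS : K \subset S) (hk : occ K k k s0).
Let a := el k k s0.
Let PK' := supported le rk P (K :\ a).
Hypotheses (hA : A \in antichains le PK') (hB : B \in antichains le PK')
  (hAB : paired (K :\ a) A B).
Let D := a |: B.

Lemma node_le_middle : k <= n.
Proof. by have /andP[v _] := hk; rewrite /valid in v; nlia. Qed.

Lemma el_node_eq i j s : valid i j -> el i j s = a -> i = k /\ j = k /\ compat j s k s0.
Proof.
move=> v e; have /andP[vk _] := hk.
have := el_le hP s s0 v vk; rewrite -/a -e le_refl => /esym/and3P[ii jj c].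
have := el_le hP s0 s vk v; rewrite -/a e le_refl => /esym/and3P[ii' jj' _].
by split; [|split] => //; nlia.
Qed.

Lemma occ_addN i j s : (i != k) || (j != k) -> occ D i j s = occ B i j s.
Proof.
move=> ne; rewrite /occ in_setU1; case: (boolP (valid i j)) => //= v.
case: eqP => // e; have [ei [ej _]] := el_node_eq v e.
by move: ne; rewrite ei ej eqxx.
Qed.

Lemma occ_add i j s : occ B i j s -> occ D i j s.
Proof. by rewrite /occ in_setU1 => /andP[-> ->]; rewrite orbT. Qed.

Lemma occ_add_node : occ D k k s0.
Proof. by rewrite /occ setU11 andbT; case/andP: hk. Qed.

Lemma occ_removeN i j s : (i != k) || (j != k) -> occ (K :\ a) i j s = occ K i j s.
Proof.
move=> ne; rewrite /occ in_setD1; case: (boolP (valid i j)) => //= v.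
case: eqP => // e; have [ei [ej _]] := el_node_eq v e.
by move: ne; rewrite ei ej eqxx.
Qed.

Lemma not_above C i j s : C \in antichains le PK' -> occ C i j s -> i <= k -> k <= j ->
  ~ compat k s0 j s.
Proof.
move=> hC h ik kj c.
have := occ_supported_node (occ_antichain hC h) ik kj node_le_middle c.
by rewrite /occ in_setD1 eqxx andbF.
Qed.

Lemma paired_add_nodes k' : k' < n -> occ K k' k' true ->
  (starts_at k' A <-> ~ ends_at k' D) /\ (starts_at k' D <-> ~ ends_at k' A).
Proof.
move=> kn h; have kmid := node_le_middle; have [ek|ne] := eqVneq k' k.
  have kn' : k != n by rewrite -ek; nlia.
  have noS : ~ starts_at k' A.
    move=> [[j [s hx]]|[i [s hx]]]; have v := occ_valid hx.
      by apply: (not_above hA hx); rewrite ?ek //; [rewrite /valid in v; nlia | apply: compatl].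
    by apply: (not_above hA hx); rewrite ?ek //; [rewrite /valid in v; nlia | nlia | apply: compatl].
  have noE : ~ ends_at k' A.
    move=> [i [s hx]]; have v := occ_valid hx.
    by apply: (not_above hA hx); rewrite ?ek //; [rewrite /valid in v; nlia | apply: compatl].
  have yesS : starts_at k' D by left; exists k, s0; rewrite ek; apply: occ_add_node.
  have yesE : ends_at k' D by exists k, s0; rewrite ek; apply: occ_add_node.
  by split; split.
have h' : occ (K :\ a) k' k' true by rewrite occ_removeN // ne.
have [rel _ _] := hAB; have [r1 r2] := rel k' kn h'.
have eE : ends_at k' D <-> ends_at k' B.
  by split=> -[i [s]]; exists i, s; [rewrite -occ_addN ?ne ?orbT | apply: occ_add].
have eS : starts_at k' D <-> starts_at k' B.
  split=> -[[j [s hx]]|[i [s hx]]].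
  - by left; exists j, s; rewrite -occ_addN ?ne.
  - right; exists i, s; rewrite -occ_addN //; apply/orP; right; nlia.
  - by left; exists j, s; apply: occ_add.
  - by right; exists i, s; apply: occ_add.
by rewrite eE eS.
Qed.

Lemma has_central_add : has_central B -> has_central D.
Proof. by move=> [i [j [s [h e]]]]; exists i, j, s; split=> //; apply: occ_add. Qed.

Lemma has_central_addN : k != n -> has_central D -> has_central B.
Proof.
move=> kn [i [j [s [h e]]]]; exists i, j, s; split=> //; rewrite -occ_addN //.
by apply: contraT; rewrite negb_or !negbK => /andP[/eqP ei /eqP ej]; nlia.
Qed.

Lemma sign_neg (s s' : bool) : s != s' -> s' = ~~ s.
Proof. by case: s; case: s'. Qed.

Lemma paired_add_half s : occ K n n s -> ~~ occ K n n (~~ s) ->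
  (some_middle A <-> ~ has_central D) /\ (some_middle D <-> ~ has_central A).
Proof.
move=> h1 h2; have [ek|kn] := eqVneq k n; last first.
  have ne : (n != k) || (n != k) by rewrite orbb eq_sym.
  have [_ half _] := hAB; have [|| r1 r2] := half s.
  - by rewrite occ_removeN.
  - by rewrite occ_removeN.
  have eM : some_middle D <-> some_middle B.
    split=> -[i [s' h]]; exists i, s'; last exact: occ_add.
    by rewrite -occ_addN // [n == k]eq_sym kn orbT.
  have eC : has_central D <-> has_central B.
    by split; [apply: has_central_addN | apply: has_central_add].
  by rewrite eM eC.
have hk' := hk; rewrite ek in hk'.
have es : s0 = s by apply/eqP; apply: contraT => /sign_neg e; move: h2; rewrite e negbK hk'.
(* The only copy of the middle in [K] has just been removed, so nothing in [A] reaches the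
   middle. *)
have no i j s' : occ A i j s' -> i <= n -> n <= j -> False.
  move=> hx iN nj; have [c|nc] := boolP (compat k s0 j s').
    by apply: (not_above hA hx) c; rewrite ek.
  move: nc; rewrite negbK => /and4P[d _ /eqP ej /sign_neg es'].
  have c : compat n s' j s' by apply/compatP.
  have := occ_supported_node (occ_antichain hA hx) iN nj (leqnn n) c.
  rewrite -es -es' in h2; rewrite /occ in_setD1 => /and3P[v _ hK].
  by case/negP: h2; rewrite /occ v.
have nM : ~ some_middle A.
  by move=> [i [s' hx]]; have v := occ_valid hx; apply: (no _ _ _ hx) => //; rewrite /valid in v; nlia.
have nC : ~ has_central A.
  by move=> [i [j [s' [hx e]]]]; have v := occ_valid hx; apply: (no _ _ _ hx) => //; rewrite /valid in v; nlia.
have yM : some_middle D by exists n, s0; rewrite -ek; apply: occ_add_node.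
have yC : has_central D by exists n, n, s0; split=> //; rewrite -ek; apply: occ_add_node.
by split; split.
Qed.

(** The delicate case adjoins one copy of a doubled middle. Before that only the other copy is in
    the support, and the clause for one copy leaves three cases. If [A] has no middle element, [B]
    contains the other copy of the node. If [A] has a middle element but not that node, [B] has a
    middle element too. If [A] contains that node, [B] has no middle element, and the pair is
    exceptional. *)
Lemma paired_add_full : (forall s, occ K n n s) ->
  [/\ all_middles A <-> ~ all_middles D, has_central A <-> ~ has_central D
      & sign_symmetric A <-> sign_symmetric D] \/ exists s, exceptional s A D.
Proof.
move=> h; have [_ half full] := hAB; have [ek|kn] := eqVneq k n; last first.
  have ne i : (i != k) || (n != k) by rewrite [n == k]eq_sym kn orbT.
  have eM : all_middles D <-> all_middles B.
    by split=> hm s; have [i hi] := hm s; exists i; [rewrite -occ_addN | apply: occ_add].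
  have eC : has_central D <-> has_central B.
    by split; [apply: has_central_addN | apply: has_central_add].
  have eS : sign_symmetric D <-> sign_symmetric B.
    by split=> hs i s; move: (hs i s); rewrite !occ_addN.
  have [|[r1 r2 r3]|[s [e1 e2 e3 e4]]] := full.
  - by move=> s; rewrite occ_removeN.
  - by left; split; [rewrite eM | rewrite eC | rewrite eS].
  - by right; exists s; split=> // [|i]; rewrite occ_addN.
have hk' := hk; rewrite ek in hk'.
have an : a = el n n s0 by rewrite /a ek.
have yes0 : occ D n n s0 by rewrite -{1 2}ek occ_add_node.
have yC : has_central D by exists n, n, s0.
have [d|nd] := boolP dbl; last first.
  have no i j s' : occ A i j s' -> i <= n -> n <= j -> False.
    move=> hx iN nj; apply: (not_above hA hx); rewrite ?ek //.
    by apply/compatP; rewrite (negbTE nd).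
  have nM : ~ all_middles A.
    move=> hm; have [i hx] := hm true; have v := occ_valid hx.
    by apply: (no _ _ _ hx) => //; rewrite /valid in v; nlia.
  have nC : ~ has_central A.
    by move=> [i [j [s' [hx e]]]]; have v := occ_valid hx; apply: (no _ _ _ hx) => //; rewrite /valid in v; nlia.
  have yM : all_middles D.
    by move=> s; exists n; apply: occ_sign yes0; rewrite nd orbT.
  have sym C : sign_symmetric C by move=> i s hx; apply: occ_sign hx; rewrite nd orbT.
  by left; split; split.
have hn1 : occ (K :\ a) n n (~~ s0).
  have /andP[v hx] := h (~~ s0); rewrite /occ v in_setD1 hx andbT /=.
  apply/eqP=> e; have [_ [_ /compatP c]] := el_node_eq v e.
  by have := c d erefl ek; case: {+}s0.
have hn2 : ~~ occ (K :\ a) n n (~~ ~~ s0).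
  by rewrite negbK /occ in_setD1 -ek eqxx andbF.
have [r1 r2] := half _ hn1 hn2.
have onlyC C i j s : C \in antichains le PK' -> occ C i j s -> i <= n -> n <= j -> j = n /\ s = ~~ s0.
  by move=> hC hx iN nj; apply: (half_middle hn1 hn2 (occ_antichain hC hx)).
have onlyM C i s : C \in antichains le PK' -> occ C i n s -> s = ~~ s0.
  move=> hC hx; have v := occ_valid hx.
  by have [|//] := onlyC C i n s hC hx _ (leqnn n); rewrite /valid in v; nlia.
have centC C : C \in antichains le PK' -> has_central C -> occ C n n (~~ s0).
  move=> hC [i [j [s [hx e]]]]; have v := occ_valid hx.
  have [||ej es] := onlyC C i j s hC hx; try (rewrite /valid in v; nlia).
  by move: hx; rewrite es ej (_ : i = n) //; nlia.
have centM C : has_central C -> C \in antichains le PK' -> some_middle C.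
  by move=> hc hC; exists n, (~~ s0); apply: centC.
have nMA : ~ all_middles A.
  by move=> hm; have [i hx] := hm s0; have := onlyM A i s0 hA hx; case: {+}s0.
have middleM C : C \in antichains le PK' -> some_middle C -> exists i, occ C i n (~~ s0).
  by move=> hC [i [s hx]]; exists i; rewrite -(onlyM C i s hC hx).
have allD : some_middle B -> all_middles D.
  move=> hm s; have [<-|/sign_neg ->] := eqVneq s0 s; first by exists n.
  by have [i hx] := middleM B hB hm; exists i; apply: occ_add.
have [hZA|nZA] := pselect (some_middle A); last first.
  have cB : has_central B by apply: contrapT => h1; apply: nZA; apply/r1.
  have zB := centM B cB hB.
  have ncA : ~ has_central A by apply/r2.
  have hB0 := centC B hB cB.
  left; split; last split=> _.
  - by split=> [/nMA //|[]]; apply: allD.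
  - by split.
  - move=> i s hx; have iN : i <= n by have v := occ_valid hx; rewrite /valid in v; nlia.
    have [ei|nei] := eqVneq i n.
      have [<-|/sign_neg ->] := eqVneq s0 s; first by rewrite ei; apply: occ_add.
      by rewrite negbK ei.
    move: hx; rewrite occ_addN ?ek ?nei // => hx.
    have es := onlyM B i s hB hx; have c : compat n (~~ s0) n s by rewrite es compat_refl.
    by have [e _] := occ_anti hB hB0 hx iN (leqnn n) c; rewrite e eqxx in nei.
  - by move=> i s hx; case: nZA; exists i, s.
have ncB : ~ has_central B by apply/r1.
have nSA : ~ sign_symmetric A.
  move=> hs; have [i hx] := middleM A hA hZA; have := hs i _ hx; rewrite negbK => hx'.
  by have := onlyM A i s0 hA hx'; case: {+}s0.
have nB0 : ~~ occ B n n (~~ s0).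
  by apply/negP=> hx; apply: ncB; exists n, n, (~~ s0).
have neq0 : el n n (~~ s0) != a.
  by move: hn1; rewrite /occ in_setD1 => /and3P[].
have nSD : ~ sign_symmetric D.
  move=> /(_ n s0 yes0); rewrite /occ in_setU1 (negbTE neq0) /= => hx.
  by move: nB0; rewrite /occ hx.
have [hCA|nCA] := pselect (has_central A); last first.
  left; split; [|by split|by split].
  by split=> [/nMA //|[]]; apply: allD; apply/r2.
have nZB : ~ some_middle B by move=> /r2.
right; exists (~~ s0); split.
- exact: centC.
- by rewrite negbK.
- move=> i; rewrite negbK; apply/negP=> hx.
  by have := onlyM A i s0 hA hx; case: {+}s0.
- move=> i; apply/negP; rewrite /occ in_setU1 => /andP[v /orP[/eqP e|hx]].
    by have [_ [_ /compatP c]] := el_node_eq v e; have := c d erefl ek; case: {+}s0.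
  by apply: nZB; exists i, (~~ s0); rewrite /occ v.
Qed.

End Add.

Lemma paired_add (K : {set T}) a (A B : {set T}) : a \in K -> K \subset S ->
  A \in antichains le (supported le rk P (K :\ a)) ->
  B \in antichains le (supported le rk P (K :\ a)) ->
  paired (K :\ a) A B -> paired K A (a |: B).
Proof.
move=> aK KS; have /triangle_simpleP[k [s [v ea]]] := subsetP KS _ aK.
have hk : occ K k k s by rewrite /occ v -ea.
rewrite ea => hA hB hAB; split.
- by move=> k' kn h; apply: (paired_add_nodes hk hA hAB).
- by move=> s' h1 h2; apply: (paired_add_half hk hA hAB h1 h2).
- exact: (paired_add_full hk hA hB hAB).
Qed.

Lemma paired0 : paired set0 set0 set0.
Proof.
have no i j s : ~~ occ set0 i j s by rewrite /occ inE andbF.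
by split=> [k _ h|s h|h]; [have := no k k true | have := no n n s | have := no n n true]; rewrite ?h.
Qed.

Lemma paired_rowvacuation (K A : {set T}) : K \subset S -> A \in antichains le (supported le rk P K) ->
  paired K A (rowvacuation le rk (supported le rk P K) A).
Proof.
apply: Rel_rowvacuation => //.
- exact: graded_triangle.
- exact: triangle_below.
- exact: paired0.
- exact: paired_add.
- by move=> K' A' B' *; apply: paired_row.
- by move=> K' A' K0 KS hA; apply: orbit_not_full.
Qed.

(** * Double counting of left and right ends *)

Definition column k : {set T} := [set x | `[< exists i s, valid i k /\ x = el i k s >]].

Definition hook k : {set T} :=
  [set x | `[< (exists j s, valid k j /\ x = el k j s) \/
               (exists i s, valid i (n + n - k) /\ x = el i (n + n - k) s) >]].

Definition centre : {set T} :=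
  [set x | `[< exists i j s, [/\ valid i j, i + j = n + n & x = el i j s] >]].

Lemma el_inj i j s i' j' s' : valid i j -> valid i' j' -> el i j s = el i' j' s' ->
  [/\ i = i', j = j' & compat j s j' s'].
Proof.
move=> v v' e; have := el_le hP s s' v v'; rewrite e le_refl => /esym/and3P[ii jj c].
have := el_le hP s' s v' v; rewrite e le_refl => /esym/and3P[ii' jj' _].
by split=> //; nlia.
Qed.

Lemma mem_column i j s k : valid i j -> (el i j s \in column k) = (j == k).
Proof.
move=> v; rewrite inE; apply/asboolP/eqP => [[i' [s' [v' e]]]|<-].
  by have [] := el_inj v v' e.
by exists i, s.
Qed.

Lemma mem_hook i j s k : valid i j -> (el i j s \in hook k) = (i == k) || (j == n + n - k).
Proof.
move=> v; rewrite inE; apply/asboolP/orP.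
  by case=> [[j' [s' [v' e]]]|[i' [s' [v' e]]]]; have [/eqP ? /eqP ? _] := el_inj v v' e; [left|right].
case=> /eqP e; [left; exists j, s | right; exists i, s]; first by rewrite -e.
by rewrite -e.
Qed.

Lemma mem_centre i j s : valid i j -> (el i j s \in centre) = (i + j == n + n).
Proof.
move=> v; rewrite inE; apply/asboolP/eqP => [[i' [j' [s' [v' e' e]]]]|e].
  by have [-> -> _] := el_inj v v' e.
by exists i, j, s.
Qed.

Lemma sum_delta (N a : nat) : \sum_(k < N) (a == k :> nat) = (a < N).
Proof.
elim: N => [|N IH]; first by rewrite big_ord0.
by rewrite big_ord_recr /= IH; nlia.
Qed.

(** An interval below the middle has one left and one right end; one that goes past it has two left
    ends after folding. The terms [column n] and [centre] replace what is missing when an end is the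
    middle or the two folded ends coincide. *)
Lemma weight x : x \in P ->
  \sum_(k < n) (x \in hook k) + \sum_(k < n) (x \in column k)
    + (x \in column n) + (x \in centre) = 2.
Proof.
move=> xP; have [i [j [s [v ->]]]] := el_onto hP xP.
rewrite mem_column // mem_centre //.
have -> : \sum_(k < n) (el i j s \in column k) = (j < n).
  by rewrite -sum_delta; apply: eq_bigr => k _; rewrite mem_column.
have [jn|nj] := leqP j n.
  have -> : \sum_(k < n) (el i j s \in hook k) = (i < n).
    rewrite -sum_delta; apply: eq_bigr => k _; rewrite mem_hook //.
    by have := ltn_ord k; nlia.
  by rewrite /valid in v; nlia.
have [e|ne] := eqVneq i (n + n - j).
  have -> : \sum_(k < n) (el i j s \in hook k) = (i < n).
    rewrite -sum_delta; apply: eq_bigr => k _; rewrite mem_hook //.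
    by have := ltn_ord k; rewrite /valid in v; nlia.
  by rewrite /valid in v; nlia.
have -> : \sum_(k < n) (el i j s \in hook k) = (i < n) + (n + n - j < n).
  rewrite -!sum_delta -big_split /=; apply: eq_bigr => k _; rewrite mem_hook //.
  by have := ltn_ord k; rewrite /valid in v; nlia.
by rewrite /valid in v; nlia.
Qed.

Lemma card_setI_sum (A H : {set T}) : \sum_(x in A) (x \in H) = #|A :&: H|.
Proof.
rewrite -sum1_card [RHS](eq_bigl (fun x => (x \in A) && (x \in H))); last by move=> x; rewrite inE.
by rewrite big_mkcondr; apply: eq_bigr => x _; case: (x \in H).
Qed.

Lemma double_card (A : {set T}) : A \subset P -> #|A| + #|A| =
  \sum_(k < n) #|A :&: hook k| + \sum_(k < n) #|A :&: column k|
    + #|A :&: column n| + #|A :&: centre|.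
Proof.
move=> /subsetP AP; have -> : #|A| + #|A| = \sum_(x in A) 2.
  by rewrite sum_nat_const muln2 addnn.
under eq_bigr => x xA do rewrite -(weight (AP x xA)).
rewrite !big_split /= !card_setI_sum; congr (_ + _ + _ + _).
  by rewrite exchange_big; apply: eq_bigr => k _; rewrite /= card_setI_sum.
by rewrite exchange_big; apply: eq_bigr => k _; rewrite /= card_setI_sum.
Qed.

Lemma card_unique (X : {set T}) (Q : Prop) : {in X &, forall x y, x = y} ->
  (Q <-> exists x, x \in X) -> #|X| = `[< Q >].
Proof.
move=> u h; case: asboolP => [/h[x xX]|nQ].
  rewrite (_ : X = [set x]) ?cards1 //; apply/setP=> y; rewrite inE.
  by apply/idP/eqP => [yX|-> //]; apply: u.
by apply: eq_card0 => x; apply/negbTE/negP => xX; apply: nQ; apply/h; exists x.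
Qed.

Section Counting.
Variable A : {set T}.
Hypothesis hA : A \in antichains le P.

Lemma antichain_el x : x \in A -> exists i j s, occ A i j s /\ x = el i j s.
Proof.
have /antichainP[/subsetP AP _] := hA => xA.
by have [i [j [s [v e]]]] := el_onto hP (AP x xA); exists i, j, s; rewrite /occ v -e.
Qed.

Lemma occ_eq i j s i' j' s' : occ A i j s -> occ A i' j' s' ->
  i' <= i -> j <= j' -> compat j s j' s' -> el i j s = el i' j' s'.
Proof.
have /antichainP[_ anti] := hA.
move=> /andP[v xA] /andP[v' yA] ii jj c; apply: anti => //.
by rewrite (el_le hP) // ii jj.
Qed.

Lemma occ_eq_column i i' j s s' : occ A i j s -> occ A i' j s' -> compat j s j s' ->
  el i j s = el i' j s'.
Proof.
move=> h h' c; have c' : compat j s' j s.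
  by apply/compatP=> d e _; rewrite (compatP _ _ _ _ c d e e).
have [ii|ii] := leqP i' i; first exact: occ_eq.
by apply/esym; apply: occ_eq => //; apply: ltnW.
Qed.

Lemma card_column k : k < n -> #|A :&: column k| = `[< ends_at k A >].
Proof.
move=> kn; apply: card_unique => [x y /setIP[xA xk] /setIP[yA yk]|].
  have [i [j [s [h ex]]]] := antichain_el xA; have [i' [j' [s' [h' ey]]]] := antichain_el yA.
  rewrite ex ey (mem_column s _ (occ_valid h)) (mem_column s' _ (occ_valid h')) in xk yk *.
  move/eqP: xk h => ->; move/eqP: yk h' => -> h' h; apply: occ_eq_column => //.
  by apply: compatl; nlia.
split=> [[i [s h]]|[x /setIP[xA xk]]].
  exists (el i k s); rewrite inE mem_column ?(occ_valid h) // eqxx andbT.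
  by case/andP: h.
have [i [j [s [h ex]]]] := antichain_el xA; exists i, s; move: xk.
by rewrite ex (mem_column s _ (occ_valid h)) => /eqP <-.
Qed.

Lemma hookP x k : x \in A -> k < n -> x \in hook k -> starts_at k A.
Proof.
move=> xA kn; have [i [j [s [h ->]]]] := antichain_el xA.
rewrite (mem_hook s _ (occ_valid h)) => /orP[/eqP e|/eqP e]; rewrite e in h.
  by left; exists j, s.
by right; exists i, s.
Qed.

(** The hook of [k] is a chain except for the two copies of [[k, n]] in type D, so only these can
    occur together in it. *)
Definition twin k := occ A k n true && occ A k n false && dbl.

Lemma card_hook k : k < n -> #|A :&: hook k| = `[< starts_at k A >] + twin k.
Proof.
move=> kn.
have chain i j s i' j' s' : occ A i j s -> occ A i' j' s' -> (i == k) || (j == n + n - k) ->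
    (i' == k) || (j' == n + n - k) -> compat j s j' s' -> el i j s = el i' j' s'.
  move=> h h' hk hk' c; have v := occ_valid h; have v' := occ_valid h'.
  have c' : compat j' s' j s by apply/compatP=> d e e'; rewrite (compatP _ _ _ _ c d e' e).
  have [/andP[ii jj]|/andP[ii jj]] : (i' <= i) && (j <= j') \/ (i <= i') && (j' <= j).
    by rewrite /valid in v v'; clear -hk hk' v v' kn; nlia.
    exact: occ_eq.
  by apply/esym; apply: occ_eq.
have memK i j s : occ A i j s -> (i == k) || (j == n + n - k) -> el i j s \in A :&: hook k.
  by move=> h hk; rewrite inE (mem_hook s _ (occ_valid h)) hk andbT; case/andP: h.
have [tw|ntw] := boolP (twin k); last first.
  rewrite addn0; apply: card_unique => [x y /setIP[xA xk] /setIP[yA yk]|]; last first.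
    split=> [[[j [s h]]|[i [s h]]]|[x /setIP[xA]]]; last exact: hookP.
      by exists (el k j s); apply: memK; rewrite ?eqxx.
    by exists (el i (n + n - k) s); apply: memK; rewrite ?eqxx ?orbT.
  have [i [j [s [h ex]]]] := antichain_el xA; have [i' [j' [s' [h' ey]]]] := antichain_el yA.
  rewrite ex ey (mem_hook s _ (occ_valid h)) (mem_hook s' _ (occ_valid h')) in xk yk *.
  apply: chain => //; apply: contraT; rewrite negbK => /and4P[d /eqP ej /eqP ej' ss].
  case/negP: ntw; rewrite ej in h xk; rewrite ej' in h' yk.
  have ei : i = k by nlia.
  have ei' : i' = k by nlia.
  rewrite ei in h; rewrite ei' in h'; rewrite /twin d andbT.
  by move: h h' ss; case: {+}s; case: {+}s' => // -> ->.
have /andP[/andP[ht hf] d] := tw.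
have -> : `[< starts_at k A >] = true by apply/asboolP; left; exists n, true.
have ne : el k n true != el k n false.
  apply/eqP=> e; have [_ _ /compatP] := el_inj (occ_valid ht) (occ_valid hf) e.
  by move=> /(_ d erefl erefl).
rewrite (_ : A :&: hook k = [set el k n true; el k n false]) ?cards2 ?ne //.
apply/setP=> x; apply/idP/set2P; last by case=> ->; apply: memK; rewrite ?eqxx.
move=> /setIP[xA xk]; have [i [j [s [h ex]]]] := antichain_el xA.
rewrite ex (mem_hook s _ (occ_valid h)) in xk *.
have [c|nc] := boolP (compat j s n true); first by left; apply: chain; rewrite ?eqxx.
right; apply: chain; rewrite ?eqxx //; move: nc; rewrite negbK => /and4P[_ _ _ ss].
by apply/compatP => _ _ _; case: {+}s ss.
Qed.

(** What [2 #|A|] contains beyond one unit for every start and every end at a node below the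
    middle. *)
Definition excess := \sum_(k < n) twin k + #|A :&: column n| + #|A :&: centre|.

Lemma double_card_excess : #|A| + #|A| =
  \sum_(k < n) `[< starts_at k A >] + \sum_(k < n) `[< ends_at k A >] + excess.
Proof.
have /antichainP[AP _] := hA; rewrite (double_card AP) /excess !addnA.
rewrite (eq_bigr _ (fun (k : 'I_n) _ => card_hook (ltn_ord k))) big_split /=.
rewrite (eq_bigr _ (fun (k : 'I_n) _ => card_column (ltn_ord k))); lia.
Qed.

Lemma centre_chain i j s i' j' s' : occ A i j s -> occ A i' j' s' -> i + j = n + n ->
  i' + j' = n + n -> compat j s j' s' -> el i j s = el i' j' s'.
Proof.
move=> h h' e e' c.
have c' : compat j' s' j s by apply/compatP=> d f f'; rewrite (compatP _ _ _ _ c d f' f).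
have [/andP[ii jj]|/andP[ii jj]] : (i' <= i) && (j <= j') \/ (i <= i') && (j' <= j).
  by clear -e e'; nlia.
  exact: occ_eq.
by apply/esym; apply: occ_eq.
Qed.

Lemma mem_centre_antichain i j s : occ A i j s -> i + j = n + n -> el i j s \in A :&: centre.
Proof. by move=> h /eqP e; rewrite inE (mem_centre s (occ_valid h)) e andbT; case/andP: h. Qed.

Lemma centre_antichain x : x \in A :&: centre ->
  exists i j s, [/\ occ A i j s, i + j = n + n & x = el i j s].
Proof.
move=> /setIP[xA]; have [i [j [s [h ->]]]] := antichain_el xA.
by rewrite (mem_centre s (occ_valid h)) => /eqP e; exists i, j, s.
Qed.

Lemma card_centre : #|A :&: centre| = `[< has_central A >] + twin n.
Proof.
have [tw|ntw] := boolP (twin n); last first.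
  rewrite addn0; apply: card_unique => [x y|]; last first.
    split=> [[i [j [s [h e]]]]|[x /centre_antichain[i [j [s [h e _]]]]]].
      by exists (el i j s); apply: mem_centre_antichain.
    by exists i, j, s.
  move=> /centre_antichain[i [j [s [h e ->]]]] /centre_antichain[i' [j' [s' [h' e' ->]]]].
  apply: centre_chain => //; apply: contraT; rewrite negbK => /and4P[d /eqP ej /eqP ej' ss].
  case/negP: ntw; have ei : i = n by lia.
  have ei' : i' = n by lia.
  rewrite ei ej in h; rewrite ei' ej' in h'; rewrite /twin d andbT.
  by move: h h' ss; case: {+}s; case: {+}s' => // -> ->.
have /andP[/andP[ht hf] d] := tw.
have -> : `[< has_central A >] = true by apply/asboolP; exists n, n, true.
have ne : el n n true != el n n false.
  apply/eqP=> e; have [_ _ /compatP] := el_inj (occ_valid ht) (occ_valid hf) e.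
  by move=> /(_ d erefl erefl).
rewrite (_ : A :&: centre = [set el n n true; el n n false]) ?cards2 ?ne //.
apply/setP=> x; apply/idP/set2P; last by case=> ->; apply: mem_centre_antichain.
move=> /centre_antichain[i [j [s [h e ->]]]].
have [c|nc] := boolP (compat j s n true); first by left; apply: centre_chain.
right; apply: centre_chain => //; move: nc; rewrite negbK => /and4P[_ _ _ ss].
by apply/compatP => _ _ _; case: {+}s ss.
Qed.

Lemma card_middle_single : ~~ dbl -> #|A :&: column n| = `[< all_middles A >].
Proof.
move=> nd; have c j s j' s' : compat j s j' s' by rewrite /compat (negbTE nd).
apply: card_unique => [x y /setIP[xA xk] /setIP[yA yk]|].
  have [i [j [s [h ex]]]] := antichain_el xA; have [i' [j' [s' [h' ey]]]] := antichain_el yA.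
  rewrite ex ey (mem_column s _ (occ_valid h)) (mem_column s' _ (occ_valid h')) in xk yk *.
  by move/eqP: xk h => ->; move/eqP: yk h' => -> h' h; apply: occ_eq_column.
split=> [hm|[x /setIP[xA xk]] s'].
  have [i h] := hm true; exists (el i n true).
  by rewrite inE mem_column ?(occ_valid h) // eqxx andbT; case/andP: h.
have [i [j [s [h ex]]]] := antichain_el xA; exists i; move: xk.
rewrite ex (mem_column s _ (occ_valid h)) => /eqP ej; rewrite ej in h.
by apply: occ_sign h; rewrite nd orbT.
Qed.

Definition sided s := exists i, occ A i n s.

Lemma card_middle_double : dbl ->
  #|A :&: column n| = `[< sided true >] + `[< sided false >].
Proof.
move=> d; pose Y := [set x | `[< exists i, valid i n /\ x = el i n true >]].
have el_Y i s : valid i n -> (el i n s \in Y) = s.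
  move=> v; rewrite inE; apply/asboolP/idP => [[i' [v' e]]|->]; last by exists i.
  by have [_ _ /compatP] := el_inj v v' e => /(_ d erefl erefl)->.
have mid_el x : x \in A :&: column n -> exists i s, occ A i n s /\ x = el i n s.
  move=> /setIP[xA]; have [i [j [s [h ->]]]] := antichain_el xA.
  by rewrite (mem_column s _ (occ_valid h)) => /eqP ej; rewrite ej in h *; exists i, s.
have el_mid i s : occ A i n s -> el i n s \in A :&: column n.
  by move=> h; rewrite inE (mem_column s _ (occ_valid h)) eqxx andbT; case/andP: h.
rewrite -(cardsID Y); congr (_ + _); apply: card_unique.
- move=> x y /setIP[/mid_el[i [s [h ->]]] +] /setIP[/mid_el[i' [s' [h' ->]]] +].
  rewrite !el_Y ?(occ_valid h) ?(occ_valid h') // => es es'.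
  by apply: occ_eq_column => //; apply/compatP; rewrite es es'.
- split=> [[i h]|[x /setIP[/mid_el[i [s [h ->]]]]]].
    by exists (el i n true); apply/setIP; rewrite el_mid // el_Y ?(occ_valid h).
  by rewrite el_Y ?(occ_valid h) // => es; exists i; rewrite es in h.
- move=> x y /setDP[/mid_el[i [s [h ->]]] +] /setDP[/mid_el[i' [s' [h' ->]]] +].
  rewrite !el_Y ?(occ_valid h) ?(occ_valid h') // => es es'.
  by apply: occ_eq_column => //; apply/compatP; move: es es'; case: {+}s; case: {+}s'.
- split=> [[i h]|[x /setDP[/mid_el[i [s [h ->]]]]]].
    by exists (el i n false); apply/setDP; rewrite el_mid // el_Y ?(occ_valid h).
  by rewrite el_Y ?(occ_valid h) // => es; exists i; move: es h; case: {+}s.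
Qed.

(** An antichain has at most one middle element of each sign, so at most one [k] contributes. *)
Lemma sum_twin : dbl ->
  \sum_(k < n.+1) twin k = `[< all_middles A /\ sign_symmetric A >].
Proof.
move=> d; have twinE k : twin k = occ A k n true && occ A k n false by rewrite /twin d andbT.
have [[hm hs]|h] := asboolP (all_middles A /\ sign_symmetric A).
  have [i ht] := hm true; have hf := hs _ _ ht.
  have iN : i < n.+1 by have := occ_valid ht; rewrite /valid; nlia.
  have {2}-> : true = (i < n.+1) by rewrite iN.
  rewrite -sum_delta; apply: eq_bigr => k _; rewrite twinE.
  have [<-|ne] := eqVneq i k; first by rewrite ht hf.
  have [hk|//] := boolP (occ A k n true).
  have e := occ_eq_column hk ht (compat_refl _ _).
  by have [ek _ _] := el_inj (occ_valid hk) (occ_valid ht) e; rewrite ek eqxx in ne.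
apply: big1 => k _; apply/eqP; rewrite eqb0 twinE; apply/negP=> /andP[ht hf]; apply: h.
split=> [[]|i s hx]; [by exists k | by exists k |].
have hk s' : occ A k n s' by case: s'.
have e := occ_eq_column hx (hk s) (compat_refl _ _).
by have [ek _ _] := el_inj (occ_valid hx) (occ_valid (hk s)) e; rewrite ek.
Qed.

Lemma excess_single : mid -> ~~ dbl ->
  excess = `[< all_middles A >] + `[< has_central A >].
Proof.
move=> hm nd; have tw k : twin k = false by rewrite /twin (negbTE nd) andbF.
rewrite /excess card_middle_single // card_centre tw addn0.
by rewrite big1 ?add0n // => k _; rewrite tw.
Qed.

Lemma excess_double : dbl -> excess = `[< sided true >] + `[< sided false >] +
  `[< has_central A >] + `[< all_middles A /\ sign_symmetric A >].
Proof.
move=> d; rewrite /excess card_middle_double // card_centre -sum_twin // big_ord_recr /=.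
lia.
Qed.

Lemma excess_symmetric : dbl -> sign_symmetric A ->
  excess = `[< has_central A >] + 3 * `[< all_middles A >].
Proof.
move=> d hs; rewrite excess_double //.
have -> : `[< sided true >] = `[< all_middles A >].
  apply: asbool_equiv_eq; split=> [[i h] [] | h]; last exact: h.
    by exists i.
  by exists i; apply: (hs i true).
have -> : `[< sided false >] = `[< all_middles A >].
  apply: asbool_equiv_eq; split=> [[i h] [] | h]; last exact: h.
    by exists i; apply: (hs i false).
  by exists i.
have -> : `[< all_middles A /\ sign_symmetric A >] = `[< all_middles A >].
  by apply: asbool_equiv_eq; split=> [[]|].
by case: `[< all_middles A >]; case: `[< has_central A >].
Qed.

Lemma excess_asymmetric : dbl -> ~ sign_symmetric A ->
  excess = `[< has_central A >] + `[< all_middles A >] + 1.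
Proof.
move=> d hs; rewrite excess_double //.
have -> : `[< all_middles A /\ sign_symmetric A >] = false.
  by apply/asboolP => -[].
have -> : `[< all_middles A >] = `[< sided true >] && `[< sided false >].
  apply/asboolP/andP => [h|[/asboolP h1 /asboolP h2] []] //.
  by split; apply/asboolP; apply: h.
have : `[< sided true >] || `[< sided false >].
  apply/orP; apply: contrapT => h; apply: hs => i s hx; case: h.
  by case: s hx => hx; [left|right]; apply/asboolP; exists i.
by case: `[< sided true >]; case: `[< sided false >]; case: `[< has_central A >].
Qed.

End Counting.

Lemma paired_full A : A \in antichains le P -> paired S A (rowvacuation le rk P A).
Proof. by have := @paired_rowvacuation S A (subxx _); rewrite /S supported_full. Qed.

Lemma occ_simples k s : valid k k -> occ S k k s.
Proof. by move=> v; rewrite /occ v; apply/triangle_simpleP; exists k, s. Qed.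

Lemma asbool_xor (X Y : Prop) : X <-> ~ Y -> `[< X >] + `[< Y >] = 1.
Proof. by move=> h; case: asboolP; case: asboolP; tauto. Qed.

Lemma card_middle_rowvacuation (A : {set T}) (B := rowvacuation le rk P A) :
  A \in antichains le P -> mid -> ~~ dbl ->
  #|A :&: column n| + #|B :&: column n| = 1 /\ #|A :&: centre| + #|B :&: centre| = 1.
Proof.
move=> hA hm nd.
have hB : B \in antichains le P by apply: rowvacuation_antichain => //; apply: graded_triangle.
have [_ _ full] := paired_full hA.
have tw C : twin C n = false by rewrite /twin (negbTE nd) andbF.
rewrite !card_middle_single // !card_centre // !tw !addn0.
have hfull s : occ S n n s by apply: occ_simples; rewrite /valid hm; nlia.
case: (full hfull) => [[r1 r2 _]|[s [h1 _ h3 _]]].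
  by rewrite (asbool_xor r1) (asbool_xor r2).
by have := h3 n; rewrite (occ_sign _ _ h1) // nd orbT.
Qed.

(** Twice the sum is [n + n] plus the two excesses, which add up to 0 without a middle and to 2 with
    a single one. With a double middle they add up to 4: as 1 + 3 in the symmetric case, as 1 + 1 on
    top of 1 for each antichain in the asymmetric one, and as 2 + 2 in the exceptional one. *)
Lemma card_rowvacuation (A : {set T}) (B := rowvacuation le rk P A) :
  A \in antichains le P -> #|A| + #|B| = n + (if mid then if dbl then 2 else 1 else 0).
Proof.
move=> hA.
have hB : B \in antichains le P by apply: rowvacuation_antichain => //; apply: graded_triangle.
have [rel _ full] := paired_full hA.
have pairs k : k < n -> `[< starts_at k A >] + `[< ends_at k B >] = 1 /\
    `[< starts_at k B >] + `[< ends_at k A >] = 1.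
  move=> kn; have [|r1 r2] := rel k kn; first by apply: occ_simples; rewrite /valid; nlia.
  by split; apply: asbool_xor.
have sums : (#|A| + #|B|) + (#|A| + #|B|) = n + n + excess A + excess B.
  have e1 : \sum_(k < n) `[< starts_at k A >] + \sum_(k < n) `[< ends_at k B >] = n.
    rewrite -big_split /= -[RHS]card_ord -sum1_card; apply: eq_bigr => k _.
    by have [] := pairs k (ltn_ord k).
  have e2 : \sum_(k < n) `[< starts_at k B >] + \sum_(k < n) `[< ends_at k A >] = n.
    rewrite -big_split /= -[RHS]card_ord -sum1_card; apply: eq_bigr => k _.
    by have [] := pairs k (ltn_ord k).
  by have := double_card_excess hA; have := double_card_excess hB; lia.
have {rel pairs} [hm|nm] := boolP mid; last first.
  have noocc C i s : ~~ occ C i n s.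
    by apply/negP => /occ_valid; rewrite /valid (negbTE nm) ltnn !andbF.
  have noex C : C \in antichains le P -> excess C = 0.
    have noel i j s : occ C i j s -> j < n.
      by move=> /occ_valid/and3P[_ _]; rewrite (negbTE nm).
    move=> hC; have e1 : C :&: column n = set0.
      apply/setP=> x; rewrite [RHS]inE; apply/negbTE/negP=> /setIP[xC].
      have [i [j [s [h ->]]]] := antichain_el hC xC.
      by rewrite (mem_column s _ (occ_valid h)) => /eqP ej; have := noel _ _ _ h; rewrite ej ltnn.
    have e2 : C :&: centre = set0.
      apply/setP=> x; rewrite [RHS]inE; apply/negbTE/negP=> /(centre_antichain hC).
      move=> [i [j [s [h e _]]]]; have jn := noel _ _ _ h.
      by have /and3P[ij _ _] := occ_valid h; clear -e jn ij; lia.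
    rewrite /excess e1 e2 !cards0 !addn0; apply: big1 => k _.
    by rewrite /twin (negbTE (noocc _ _ _)).
  by rewrite !noex // in sums; nlia.
have hfull s : occ S n n s by apply: occ_simples; rewrite /valid hm; nlia.
have [d|nd] := boolP dbl; last first.
  rewrite !excess_single // in sums.
  case: (full hfull) => [[r1 r2 _]|[s [h1 _ h3 _]]]; last first.
    by have := h3 n; rewrite (occ_sign _ _ h1) // nd orbT.
  by have := asbool_xor r1; have := asbool_xor r2; rewrite -/B; clear -sums; nlia.
case: (full hfull) => [[r1 r2 r3]|[s [h1 h2 h3 h4]]].
  have := asbool_xor r1; have := asbool_xor r2; rewrite -/B.
  have [sA|nsA] := pselect (sign_symmetric A).
    have sB := iffLR r3 sA.
    by rewrite !excess_symmetric // in sums; clear -sums; nlia.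
  have nsB : ~ sign_symmetric B by move/r3.
  by rewrite !excess_asymmetric // in sums; nlia.
have nsA : ~ sign_symmetric A by move=> /(_ n s h1); apply/negP.
have nsB : ~ sign_symmetric B by move=> /(_ n _ h2); rewrite negbK; apply/negP.
rewrite !excess_asymmetric // in sums.
have cA : `[< has_central A >] = true by apply/asboolP; exists n, n, s.
have cB : `[< has_central B >] = true by apply/asboolP; exists n, n, (~~ s).
have mA : `[< all_middles A >] = false.
  by apply/asboolP => /(_ (~~ s))[i hx]; have := h3 i; rewrite hx.
have mB : `[< all_middles B >] = false.
  by apply/asboolP => /(_ s)[i hx]; have := h4 i; rewrite hx.
by rewrite cA cB mA mB in sums; nlia.
Qed.

Definition triangle_rank : nat := if mid then n + n else n.-1.

Lemma triangle_rank_le x : x \in P -> rk x <= triangle_rank.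
Proof.
move=> xP; have [i [j [s [v ->]]]] := el_onto hP xP; rewrite (el_rk hP) // /triangle_rank.
by case: ifP => hm; rewrite /valid hm in v; nlia.
Qed.

Lemma triangle_above x : x \in P -> rk x < triangle_rank ->
  exists y, [/\ y \in P, le x y & y != x].
Proof.
move=> xP; have [i [j [s [v ->]]]] := el_onto hP xP; rewrite (el_rk hP) // /triangle_rank => r.
have grow i' j' : valid i' j' -> i' <= i -> j <= j' -> (i' != i) || (j' != j) ->
    exists y, [/\ y \in P, le (el i j s) y & y != el i j s].
  move=> v' ii jj ne; exists (el i' j' s); rewrite (el_in hP) // (el_le hP) // ii jj.
  split=> //; first exact/compatP.
  by apply: contraTneq ne => e; have [-> -> _] := el_inj v' v e; rewrite !eqxx.
case: i v r grow => [|i] v r grow; last first.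
  by apply: (grow i j); rewrite /valid in v *; nlia.
apply: (grow 0 j.+1); rewrite ?orbT //; last by nlia.
by move: r v; rewrite /valid; case: ifP => hm; nlia.
Qed.

Lemma poset_rank_triangle : valid 0 triangle_rank -> poset_rank rk P = triangle_rank.
Proof.
move=> v; apply/eqP; rewrite eqn_leq; apply/andP; split.
  by apply/bigmax_leqP => x; apply: triangle_rank_le.
have := poset_rank_max rk (el_in hP true v); rewrite (el_rk hP) // subn0.
exact.
Qed.

End FoldedTriangle.

Local Open Scope ring_scope.

(** * Scalar product and reflections *)

Section DotProduct.
Variables (R : realFieldType) (d : nat).
Implicit Types u v w : 'rV[R]_d.

Lemma dotvC u v : dotv u v = dotv v u.
Proof. by apply: eq_bigr => i _; rewrite mulrC. Qed.

Lemma dotvDl u v w : dotv (u + v) w = dotv u w + dotv v w.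
Proof. by rewrite /dotv -big_split; apply: eq_bigr => i _; rewrite mxE mulrDl. Qed.

Lemma dotvZl x u v : dotv (x *: u) v = x * dotv u v.
Proof. by rewrite /dotv mulr_sumr; apply: eq_bigr => i _; rewrite mxE mulrA. Qed.

Lemma dotvDr u v w : dotv w (u + v) = dotv w u + dotv w v.
Proof. by rewrite dotvC dotvDl !(dotvC _ w). Qed.

Lemma dotvZr x u v : dotv v (x *: u) = x * dotv v u.
Proof. by rewrite dotvC dotvZl dotvC. Qed.

Lemma dotvNl u v : dotv (- u) v = - dotv u v.
Proof. by rewrite -scaleN1r dotvZl mulN1r. Qed.

Lemma dotvNr u v : dotv v (- u) = - dotv v u.
Proof. by rewrite dotvC dotvNl dotvC. Qed.

Lemma dotvBl u v w : dotv (u - v) w = dotv u w - dotv v w.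
Proof. by rewrite dotvDl dotvNl. Qed.

Lemma dotvBr u v w : dotv w (u - v) = dotv w u - dotv w v.
Proof. by rewrite dotvDr dotvNr. Qed.

Lemma dotv0l v : dotv 0 v = 0.
Proof. by rewrite -(scale0r 0) dotvZl mul0r. Qed.

Lemma dotv0r v : dotv v 0 = 0.
Proof. by rewrite dotvC dotv0l. Qed.

Lemma dotvMnr u v m : dotv v (u *+ m) = dotv v u *+ m.
Proof. by rewrite -scaler_nat dotvZr mulr_natl. Qed.

Lemma dotv_sumr (I : finType) (F : I -> 'rV[R]_d) v :
  dotv v (\sum_i F i) = \sum_i dotv v (F i).
Proof.
by apply: (big_morph (dotv v)) => [x y|]; rewrite ?dotvDr ?dotv0r.
Qed.

Lemma dotv_ge0 v : 0 <= dotv v v.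
Proof. by apply: sumr_ge0 => i _; rewrite -expr2 sqr_ge0. Qed.

Lemma dotv_eq0 v : (dotv v v == 0) = (v == 0).
Proof.
apply/eqP/eqP => [h|->]; last exact: dotv0l.
apply/rowP=> i; rewrite mxE; apply/eqP; rewrite -sqrf_eq0 expr2; apply/eqP.
by apply: (psumr_eq0P _ h) => // j _; rewrite -expr2 sqr_ge0.
Qed.

Lemma reflection_linear a x u v :
  reflection a (x *: u + v) = x *: reflection a u + reflection a v.
Proof.
rewrite /reflection /coroot_pairing dotvDl dotvZl mulrDr mulrDl scalerDl opprD.
rewrite scalerBr !scalerA addrACA; congr (_ - _ *: _ + _); ring.
Qed.

Lemma reflectionN a v : reflection a (- v) = - reflection a v.
Proof.
have := reflection_linear a (-1) v 0; rewrite addr0 !scaleN1r => ->.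
by rewrite /reflection /coroot_pairing dotv0l mulr0 mul0r scale0r subr0 addr0.
Qed.

Lemma reflectionD a u v : reflection a (u + v) = reflection a u + reflection a v.
Proof. by have := reflection_linear a 1 u v; rewrite !scale1r. Qed.

Lemma reflectionB a u v : reflection a (u - v) = reflection a u - reflection a v.
Proof. by rewrite reflectionD reflectionN. Qed.

Lemma reflectionZ a x v : reflection a (x *: v) = x *: reflection a v.
Proof.
have := reflection_linear a x v 0; rewrite addr0 => ->.
by rewrite /reflection /coroot_pairing dotv0l mulr0 mul0r scale0r subr0 addr0.
Qed.

Lemma reflectionK a v : a != 0 -> reflection a (reflection a v) = v.
Proof.
move=> a0; have aa : dotv a a != 0 by rewrite dotv_eq0.
rewrite {1}/reflection /reflection /coroot_pairing dotvBl dotvZl.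
rewrite -[RHS]addr0 -addrA; congr (_ + _); rewrite -opprD -scalerDl.
by rewrite (_ : _ + _ = 0) ?scale0r ?oppr0 //; field.
Qed.

Lemma reflection_dotv a u v : a != 0 ->
  dotv (reflection a u) (reflection a v) = dotv u v.
Proof.
move=> a0; have aa : dotv a a != 0 by rewrite dotv_eq0.
rewrite /reflection /coroot_pairing !dotvBl !dotvBr !dotvZl !dotvZr (dotvC a v).
by field.
Qed.

End DotProduct.

(** * Coefficients, order and height in a simple system *)

Section SimpleSystem.
Variables (R : realFieldType) (d : nat) (Phi : {fset 'rV[R]_d}) (r : nat)
  (alpha : 'I_r -> Phi).
Hypotheses (hPhi : is_root_system Phi) (halpha : is_simple_system alpha).

(** Indexing by [nat], with the value 0 past the end, keeps ordinals out of the index arithmetic. *)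
Definition simple (k : nat) : 'rV[R]_d := oapp (fun i : 'I_r => fsval (alpha i)) 0 (insub k).

Lemma simpleE (i : 'I_r) : simple i = fsval (alpha i).
Proof. by rewrite /simple valK. Qed.

Lemma simple_in k : (k < r)%N -> simple k \in Phi.
Proof. by move=> kr; rewrite -[k]/(val (Ordinal kr)) simpleE; apply: valP. Qed.

Lemma root_in_neq0 v : v \in Phi -> v != 0.
Proof. by apply: contraTneq => ->; apply: (root_neq0 hPhi). Qed.

Lemma reflection_in v w : v \in Phi -> w \in Phi -> reflection v w \in Phi.
Proof. by move=> hv hw; apply: (root_reflection hPhi (FSetSub hv) (FSetSub hw)). Qed.

Definition comb (c : nat -> nat) : 'rV[R]_d := \sum_(k < r) simple k *+ c k.

Lemma nat_combE c : nat_comb alpha (fun i => c (val i)) = comb c.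
Proof. by apply: eq_bigr => i _; rewrite simpleE. Qed.

Lemma nat_comb_extend (c : 'I_r -> nat) : exists c' : nat -> nat, nat_comb alpha c = comb c'.
Proof.
exists (fun k => oapp c 0%N (insub k)); rewrite -nat_combE.
by apply: eq_bigr => i _; rewrite valK.
Qed.

Lemma simple_independent (x : nat -> R) : \sum_(k < r) x k *: simple k = 0 ->
  forall k, (k < r)%N -> x k = 0.
Proof.
move=> h k kr; have : free [tuple fsval (alpha i) | i < r].
  exact: (simple_free halpha).
move=> /freeP/(_ (fun i : 'I_r => x i)) => h2.
apply: (h2 _ (Ordinal kr)); rewrite -[RHS]h; apply: eq_bigr => i _.
by rewrite simpleE (nth_map i) ?size_enum_ord // nth_ord_enum.
Qed.

Lemma comb_inj c c' : comb c = comb c' -> forall k, (k < r)%N -> c k = c' k.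
Proof.
move=> e k kr; apply/eqP; rewrite -(eqr_nat R) -subr_eq0; apply/eqP.
apply: (simple_independent (x := fun k => (c k)%:R - (c' k)%:R)) kr.
under eq_bigr do rewrite scalerBl !scaler_nat.
by rewrite sumrB -/(comb c) -/(comb c') e subrr.
Qed.

Lemma combD c c' : comb c + comb c' = comb (fun k => c k + c' k)%N.
Proof. by rewrite -big_split; apply: eq_bigr => k _; rewrite /= mulrnDr. Qed.

Lemma comb0 : comb (fun _ => 0%N) = 0.
Proof. by apply: big1 => k _; rewrite mulr0n. Qed.

Lemma comb_delta k : (k < r)%N -> comb (fun l => (l == k) : nat) = simple k.
Proof.
move=> kr; rewrite /comb (bigD1 (Ordinal kr)) //= eqxx big1 ?addr0 // => i ne.
by rewrite (_ : (val i == k) = false) ?mulr0n //; apply/negbTE; apply: contra ne.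
Qed.

Lemma root_leP (x y : Phi) :
  reflect (exists c, fsval y - fsval x = comb c) (root_le alpha x y).
Proof.
rewrite /root_le; apply: (iffP (asboolP _)) => [[c ->]|[c ->]]; first exact: nat_comb_extend.
by exists (fun i => c (val i)); rewrite nat_combE.
Qed.

Lemma root_le_refl : reflexive (root_le alpha).
Proof. by move=> x; apply/root_leP; exists (fun _ => 0%N); rewrite comb0 subrr. Qed.

Lemma root_le_trans : transitive (root_le alpha).
Proof.
move=> y x z /root_leP[c e] /root_leP[c' e']; apply/root_leP.
by exists (fun k => c k + c' k)%N; rewrite -combD -e -e' [RHS]addrC subrKA.
Qed.

Lemma root_le_anti : antisymmetric (root_le alpha).
Proof.
move=> x y /andP[/root_leP[c e] /root_leP[c' e']]; apply: val_inj.
have e0 : comb (fun k => c k + c' k)%N = comb (fun _ => 0%N).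
  by rewrite -combD -e -e' comb0 subrKA subrr.
have c0 k : (k < r)%N -> c k = 0%N by move=> /(comb_inj e0); lia.
apply/esym/subr0_eq; rewrite e; apply: big1 => k _.
by rewrite c0 ?mulr0n.
Qed.

Lemma pos_rootsP (b : Phi) : reflect (exists c, fsval b = comb c) (b \in pos_roots alpha).
Proof.
rewrite inE; apply: (iffP (asboolP _)) => [[c ->]|[c ->]]; first exact: nat_comb_extend.
by exists (fun i => c (val i)); rewrite nat_combE.
Qed.

Lemma root_sign v : v \in Phi -> exists c, v = comb c \/ v = - comb c.
Proof.
move=> hv; have [c] := simple_comb halpha (FSetSub hv).
have [c' ->] := nat_comb_extend c; by exists c'.
Qed.

Lemma heightE (b : Phi) c : fsval b = comb c -> height alpha b = (\sum_(k < r) c k)%N.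
Proof.
move=> e; rewrite /height; case: classical_sets.xgetP => [m _ [c' e' ->]|no]; last first.
  by case: (no (\sum_(k < r) c k)%N); exists (fun i => c (val i)); rewrite ?nat_combE.
have [c2 e2] := nat_comb_extend c'.
apply: eq_bigr => i _; have h : nat_comb alpha c' = nat_comb alpha (fun i => c (val i)).
  by rewrite -e' e nat_combE.
have := simple_independent (x := fun k => oapp (fun i => (c' i)%:R - (c i)%:R) 0 (insub k : option 'I_r)).
move=> /(_ _ i (ltn_ord i)); rewrite valK /= => h0.
apply/eqP; rewrite -(eqr_nat R) -subr_eq0; apply/eqP; apply: h0.
transitivity (nat_comb alpha c' - nat_comb alpha (fun i => c (val i))).
  rewrite /nat_comb -sumrB; apply: eq_bigr => j _; rewrite valK /= simpleE.
  by rewrite scalerBl !scaler_nat.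
by rewrite h subrr.
Qed.

(* A positive root which is not simple is lowered by the reflection in some simple root in its support, and stays positive. *)
Lemma simple_reflection_ind (Q : 'rV[R]_d -> Prop) :
  (forall k, (k < r)%N -> Q (simple k)) -> (forall v, Q v -> Q (- v)) ->
  (forall k v, (k < r)%N -> Q v -> Q (reflection (simple k) v)) ->
  forall v, v \in Phi -> Q v.
Proof.
move=> Qs QN Qr.
have pos N : forall c : nat -> nat, (\sum_(k < r) c k <= N)%N -> comb c \in Phi -> Q (comb c).
  elim: N => [|N IH] c hN hc.
    have c0 : comb c = 0.
      apply: big1 => k _; rewrite (_ : c k = 0%N) ?mulr0n //.
      by move: hN; rewrite (bigD1 k) //=; lia.
    by move: (root_in_neq0 hc); rewrite c0 eqxx.
  have nn : 0 < dotv (comb c) (comb c).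
    by rewrite lt_def dotv_eq0 root_in_neq0 // dotv_ge0.
  have [k ck] : exists k : 'I_r, 0 < dotv (comb c) (simple k) *+ c k.
    apply: contrapT => h; move: nn; rewrite {2}/comb dotv_sumr; apply/negP; rewrite -leNgt.
    apply: sumr_le0 => k _; rewrite dotvMnr leNgt; apply/negP => hk.
    by apply: h; exists k.
  have ck0 : (0 < c k)%N by case: posnP ck => // ->; rewrite mulr0n ltxx.
  have dk : 0 < dotv (comb c) (simple k) by move: ck; rewrite pmulrn_lgt0.
  have hk := simple_in (ltn_ord k).
  have [only|[j /andP[jk cj]]] : (forall j : 'I_r, j != k -> c j = 0%N) \/
      exists j : 'I_r, (j != k) && (0 < c j)%N.
    have [[j hj]|h] := pselect (exists j : 'I_r, (j != k) && (0 < c j)%N).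
      by right; exists j.
    left=> j jk; apply/eqP; apply: contraT; rewrite -lt0n => cj.
    by case: h; exists j; rewrite jk.
    have e : comb c = (c k)%:R *: simple k.
      rewrite /comb (bigD1 k) //= big1 ?addr0 ?scaler_nat // => j jk.
      by rewrite only // mulr0n.
    have := hc; rewrite e => hc'.
    have := root_reduced hPhi (a := FSetSub hk) (c := (c k)%:R) hc'.
    case=> [->|h]; first by rewrite scale1r; apply: Qs.
    by have := ler0n R (c k); rewrite h oppr_ge0 ler10.
  set s := reflection (simple k) (comb c).
  have hs : s \in Phi by apply: reflection_in.
  have [c' e'] := root_sign hs.
  pose m := coroot_pairing (comb c) (simple k).
  have m0 : 0 < m.
    by rewrite /m /coroot_pairing divr_gt0 ?mulr_gt0 ?ltr0n // lt_def dotv_eq0 root_in_neq0 // dotv_ge0.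
  have key (x : R) : s = x *: comb c' -> forall l : 'I_r,
      x * (c' l)%:R = (c l)%:R - (if l == k then m else 0).
    move=> e l; apply/eqP; rewrite -subr_eq0; apply/eqP.
    pose y l := x * (c' l)%:R - ((c l)%:R - (if l == k :> nat then m else 0)).
    have := simple_independent (x := y) _ (ltn_ord l); rewrite /y (inj_eq val_inj); apply.
    have : x *: comb c' - (comb c - m *: simple k) = 0 by rewrite -e /s /reflection subrr.
    move=> h0; rewrite -[RHS]h0; under eq_bigr do rewrite /y scalerBl scalerBl -scalerA !scaler_nat.
    rewrite sumrB -scaler_sumr sumrB; congr (_ - (_ - _)).
    by rewrite (bigD1 k) //= eqxx big1 ?addr0 // => j' ne; rewrite (inj_eq val_inj) (negbTE ne) scale0r.
  have {e'} es : s = comb c'.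
    case: e' => // e'; have := key (-1) _ j; rewrite scaleN1r (negbTE jk) subr0 => /(_ e') h.
    have : (0 : R) < (c j)%:R by rewrite ltr0n.
    by rewrite -h mulN1r oppr_gt0 ltrn0.
  have kc := key 1; rewrite scale1r in kc; have {}kc := kc es.
  rewrite -(reflectionK (comb c) (root_in_neq0 hk)) -/s es; apply: Qr => //.
  apply: IH; last by rewrite -es.
  rewrite -ltnS (leq_trans _ hN) // (bigD1 k) //= [X in (_ < X)%N](bigD1 k) //=.
  rewrite -addSn leq_add //.
    have := kc k; rewrite eqxx mul1r => h.
    by rewrite -(ltr_nat R) h ltrBlDr ltrDl.
  apply: leq_sum => l lk; have := kc l; rewrite (negbTE lk) mul1r subr0 => /eqP.
  by rewrite eqr_nat => /eqP ->.
move=> v hv; have [c [e|e]] := root_sign hv.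
  by rewrite e; apply: (pos _ c (leqnn _)); rewrite -e.
rewrite e; apply: QN; apply: (pos _ c (leqnn _)).
have := reflection_in hv hv; rewrite /reflection /coroot_pairing mulfK ?dotv_eq0 ?root_in_neq0 //.
by rewrite e scaler_nat mulr2n opprD addrA subrr add0r opprK.
Qed.

Lemma root_rankE (b : Phi) c : fsval b = comb c ->
  root_rank alpha b = (\sum_(k < r) c k).-1.
Proof. by move=> e; rewrite /root_rank (heightE e). Qed.

Lemma alpha_pos (k : 'I_r) : alpha k \in pos_roots alpha.
Proof.
by apply/pos_rootsP; exists (fun l => (l == k :> nat) : nat); rewrite comb_delta // simpleE.
Qed.

Lemma sum_delta_ord (k : 'I_r) : (\sum_(l < r) ((l == k :> nat) : nat) = 1)%N.
Proof.
rewrite (bigD1 k) //= eqxx big1 ?addn0 // => l ne.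
by apply/eqP; rewrite eqb0; apply: contra ne.
Qed.

Lemma alpha_rank (k : 'I_r) : root_rank alpha (alpha k) = 0%N.
Proof.
by rewrite (@root_rankE _ (fun l => (l == k :> nat) : nat)) ?sum_delta_ord // comb_delta // simpleE.
Qed.

Lemma rank0_simple : rank_level (root_rank alpha) (pos_roots alpha) 0 = simple_roots alpha.
Proof.
apply/setP=> x; rewrite inE; apply/andP/imsetP => [[/pos_rootsP[c e]]|[k _ ->]]; last first.
  by rewrite alpha_pos alpha_rank.
(* Because of the predecessor in [root_rank], rank 0 allows a coefficient sum of 0 or 1; the sum 0
   is excluded because a root is nonzero. *)
rewrite (root_rankE e) => s0; have [k ck] : exists k : 'I_r, (0 < c k)%N.
  have nz : fsval x != 0 := root_in_neq0 (valP x).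
  apply: contrapT => h; move: nz; rewrite e /comb big1 ?eqxx // => k _.
  by case: (posnP (c k)) => [->|ck]; [rewrite mulr0n | case: h; exists k].
exists k => //; apply: val_inj; rewrite /= e -simpleE -comb_delta //.
move: s0; rewrite (bigD1 k) //=; set rest := (\sum_(i < r | _) _)%N => s0.
have [c1 /eqP rest0] : c k = 1%N /\ rest = 0%N by clear -s0 ck; lia.
apply: eq_bigr => l _; have [->|lk] := eqVneq l k; first by rewrite eqxx c1.
rewrite (_ : (val l == val k) = false); last exact/negbTE.
by move: rest0; rewrite /rest sum_nat_eq0 => /forallP/(_ l); rewrite lk => /eqP ->.
Qed.

Lemma card_simple : #|simple_roots alpha| = r.
Proof.
rewrite card_imset ?card_ord // => k l /(congr1 (@fsval _ _)).
rewrite -!simpleE -!comb_delta // => /comb_inj/(_ k (ltn_ord k)).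
by rewrite eqxx; case: eqP => // /val_inj.
Qed.

Section Coefficients.
Variables (n : nat) (dbl mid : bool) (coef : nat -> nat -> bool -> nat -> nat).
Hypotheses
  (coef_in : forall i j s, valid n mid i j -> comb (coef i j s) \in Phi)
  (coef_onto : forall v, v \in Phi -> exists i j s, valid n mid i j /\
     (v = comb (coef i j s) \/ v = - comb (coef i j s)))
  (coef_le : forall i j s i' j' s', valid n mid i j -> valid n mid i' j' ->
     (forall k, (k < r)%N -> (coef i j s k <= coef i' j' s' k)%N) <->
     [&& (i' <= i)%N, (j <= j')%N & compat n dbl j s j' s'])
  (coef_sum : forall i j s, valid n mid i j -> (\sum_(k < r) coef i j s k = (j - i).+1)%N).
Variable root0 : Phi.

(** The root [root0] is a default value: the function must be total, while only valid pairs are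
    known to give roots. *)
Definition coef_root (i j : nat) (s : bool) : Phi := insubd root0 (comb (coef i j s)).

Lemma coef_rootE i j s : valid n mid i j -> fsval (coef_root i j s) = comb (coef i j s).
Proof. by move=> v; apply: insubdK; apply: coef_in. Qed.

(** By linear independence the order on roots is the comparison of coefficients, so each type
    reduces to a table of coefficients and its sums. *)
Lemma coef_folded_triangle :
  folded_triangle (root_le alpha) (root_rank alpha) (pos_roots alpha) n dbl mid coef_root.
Proof.
split.
- by move=> i j s v; apply/pos_rootsP; exists (coef i j s); apply: coef_rootE.
- move=> x /pos_rootsP[c e]; have [i [j [s [v [e'|e']]]]] := coef_onto (valP x).
    by exists i, j, s; split=> //; apply: val_inj; rewrite /= coef_rootE.
  have nz : fsval x != 0 := root_in_neq0 (valP x).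
  have e0 : comb (fun k => c k + coef i j s k)%N = comb (fun _ => 0%N).
    by rewrite -combD comb0 -e e' addNr.
  have c0 k : (k < r)%N -> c k = 0%N by move=> /(comb_inj e0); lia.
  by move: nz; rewrite e /comb big1 ?eqxx // => k _; rewrite c0 ?mulr0n.
- move=> i j s i' j' s' v v'; apply/root_leP/idP; rewrite !coef_rootE //.
    move=> [c e]; apply/coef_le => // k kr.
    have : comb (coef i' j' s') = comb (fun k => c k + coef i j s k)%N.
      by rewrite -combD -e subrK.
    by move=> /comb_inj/(_ k kr); lia.
  move=> /coef_le h; exists (fun k => coef i' j' s' k - coef i j s k)%N.
  apply/eqP; rewrite subr_eq combD; apply/eqP; apply: eq_bigr => k _.
  by congr (_ *+ _); rewrite subnK // h.
- by move=> i j s v; rewrite (root_rankE (coef_rootE s v)) coef_sum.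
Qed.

End Coefficients.

End SimpleSystem.

(** * Axes adapted to a chain of simple roots *)

Definition swap (k i : nat) : nat := if i == k then k.+1 else if i == k.+1 then k else i.

Lemma swap_lt k i N : (k.+1 < N)%N -> (i < N)%N -> (swap k i < N)%N.
Proof. by rewrite /swap; case: eqP => // _; case: eqP => // _; nlia. Qed.

Lemma swap_eq k i m : (swap k i == swap k m) = (i == m).
Proof.
rewrite /swap; case: (boolP (i == k)) => ik; case: (boolP (m == k)) => mk;
  case: (boolP (i == k.+1)) => ik1; case: (boolP (m == k.+1)) => mk1; nlia.
Qed.

Section Chain.
Variables (R : realFieldType) (d : nat) (a : nat -> 'rV[R]_d) (N : nat) (f : 'rV[R]_d) (q : R).
Hypotheses (q0 : q != 0)
  (gram : forall k l, (k.+1 < N)%N -> (l.+1 < N)%N ->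
     dotv (a k) (a l) = q * (2 * (k == l)%:R - (k == l.+1)%:R - (l == k.+1)%:R))
  (dot_f : forall k, (k.+1 < N)%N -> dotv (a k) f = - q * (k.+2 == N)%:R).

(* Orthogonal up to a common shift: the last vector [f] is chosen type by type. *)
Definition axis (i : nat) : 'rV[R]_d := f + \sum_(i <= k < N.-1) a k.

Lemma axis_last : axis N.-1 = f.
Proof. by rewrite /axis big_geq ?addr0. Qed.

Lemma axisS k : (k.+1 < N)%N -> axis k = a k + axis k.+1.
Proof.
move=> kN; have kN1 : (k < N.-1)%N by nlia.
by rewrite /axis (big_ltn kN1) addrCA.
Qed.

Lemma chainE k : (k.+1 < N)%N -> a k = axis k - axis k.+1.
Proof. by move=> kN; rewrite (axisS kN) addrK. Qed.

Lemma dotv_axis k i : (k.+1 < N)%N -> (i < N)%N ->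
  dotv (a k) (axis i) = q * ((k == i)%:R - (k.+1 == i)%:R).
Proof.
move=> kN iN; have [m hm] : exists m, (i + m = N.-1)%N by exists (N.-1 - i)%N; nlia.
elim: m i iN hm => [|m IH] i iN hm.
  have -> : i = N.-1 by nlia.
  have e1 : (k == N.-1) = false by nlia.
  have e2 : (k.+2 == N) = (k.+1 == N.-1) by nlia.
  by rewrite axis_last (dot_f kN) e1 e2 sub0r mulrN mulNr.
have iN1 : (i.+1 < N)%N by nlia.
have hm1 : (i.+1 + m = N.-1)%N by nlia.
rewrite (axisS iN1) dotvDr (gram kN iN1) (IH _ iN1 hm1) eqSS (eq_sym i k.+1); ring.
Qed.

Lemma dotv_chain k : (k.+1 < N)%N -> dotv (a k) (a k) = 2 * q.
Proof.
move=> kN; have e : (k == k.+1) = false by nlia.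
by rewrite (gram kN kN) eqxx e !subr0 mulr1 mulrC.
Qed.

Lemma reflection_chain k v : (k.+1 < N)%N ->
  reflection (a k) v = v - (dotv v (a k) / q) *: a k.
Proof.
move=> kN; rewrite /reflection /coroot_pairing (dotv_chain kN).
by congr (_ - _ *: _); field; rewrite q0.
Qed.

Lemma reflection_axis k i : (k.+1 < N)%N -> (i < N)%N ->
  reflection (a k) (axis i) = axis (swap k i).
Proof.
move=> kN iN; rewrite (reflection_chain _ kN) dotvC (dotv_axis kN iN) mulrC (mulKf q0) /swap.
have [->|ik] := eqVneq i k.
  have e : (k.+1 == k) = false by nlia.
  by rewrite e subr0 scale1r (axisS kN) addrC addKr.
have [->|ik1] := eqVneq i k.+1.
  by rewrite sub0r scaleN1r opprK (axisS kN) addrC.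
by rewrite subrr scale0r subr0.
Qed.

Lemma sum_interval_chain M lo hi : (M < N)%N -> (lo <= hi)%N ->
  \sum_(k < M) a k *+ (lo <= k < hi) = axis (minn lo M) - axis (minn hi M).
Proof.
elim: M => [|M IH] MN lh; first by rewrite big_ord0 !minn0 subrr.
rewrite big_ord_recr /= IH ?(ltnW MN) // (chainE MN).
have [h1|h1] := boolP (lo <= M)%N; have [h2|h2] := boolP (M < hi)%N => /=.
- have -> : minn lo M = minn lo M.+1 by nlia.
  have -> : minn hi M = M by nlia.
  have -> : minn hi M.+1 = M.+1 by nlia.
  by rewrite mulr1n addrA subrK.
- have -> : minn lo M = minn lo M.+1 by nlia.
  have -> : minn hi M = minn hi M.+1 by nlia.
  by rewrite mulr0n addr0.
- have -> : minn lo M = minn hi M by nlia.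
  have -> : minn lo M.+1 = minn hi M.+1 by nlia.
  by rewrite !subrr mulr0n addr0.
- by nlia.
Qed.

Definition chain_product (m : nat) v := foldr (fun k w => reflection (a k) w) v (iota 0 m).

Lemma chain_productS m v : chain_product m.+1 v = chain_product m (reflection (a m) v).
Proof. by rewrite /chain_product -[m.+1]addn1 iotaD foldr_cat. Qed.

Lemma chain_productZ m x v : chain_product m (x *: v) = x *: chain_product m v.
Proof. by elim: m v => // m IH v; rewrite !chain_productS reflectionZ IH. Qed.

Lemma chain_productD m u v : chain_product m (u + v) = chain_product m u + chain_product m v.
Proof. by elim: m u v => // m IH u v; rewrite !chain_productS reflectionD IH. Qed.

(** The reflections act as adjacent transpositions of the axes, and the product of the first [m] of
    them is a cycle on [m.+1] axes. *)
Lemma chain_product_axis m i : (m < N)%N -> (i < N)%N ->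
  chain_product m (axis i) = axis (if (i < m)%N then i.+1 else if i == m then 0%N else i).
Proof.
elim: m i => [|m IH] i mN iN; first by rewrite /chain_product /=; case: eqP => // ->.
rewrite chain_productS reflection_axis // /swap.
have [->|im] := eqVneq i m.
  by rewrite IH ?(ltnW mN) // ltnS leqnn ltnNge leqnSn /= (_ : (m.+1 == m) = false) //; nlia.
have [->|im1] := eqVneq i m.+1.
  by rewrite IH ?(ltnW mN) ?ltnn ?eqxx //; nlia.
rewrite IH ?(ltnW mN) //; congr axis.
by case: (ltngtP i m) im => // h _; case: (ltngtP i m.+1) im1 => //; nlia.
Qed.

End Chain.

(** * Coxeter number, and the statement for a folded triangle *)

Section Conclusion.
Variables (R : realFieldType) (d : nat) (Phi : {fset 'rV[R]_d}) (r : nat)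
  (alpha : 'I_r -> Phi) (h : nat).
Hypotheses (hPhi : is_root_system Phi) (halpha : is_simple_system alpha).
Let a := simple alpha.

Lemma coxeter_elementE v : coxeter_element alpha v = chain_product a r v.
Proof.
rewrite /coxeter_element /chain_product -val_enum_ord foldr_map.
by elim: (enum _) => //= i s ->; rewrite /a simpleE.
Qed.

Lemma coxeter_linear m x u v : iter m (coxeter_element alpha) (x *: u + v) =
  x *: iter m (coxeter_element alpha) u + iter m (coxeter_element alpha) v.
Proof. by elim: m => //= m ->; rewrite !coxeter_elementE chain_productD chain_productZ. Qed.

Lemma coxeter_fixed m : (forall k, (k < r)%N -> iter m (coxeter_element alpha) (a k) = a k) ->
  forall v, iter m (coxeter_element alpha) v = v.
Proof.
move=> fix_simple; set C := iter m _ in fix_simple *.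
have lin x u v : C (x *: u + v) = x *: C u + C v := coxeter_linear m x u v.
have C0 : C 0 = 0.
  have := lin 1 0 0; rewrite !scale1r addr0 => /eqP.
  by rewrite -subr_eq subrr => /eqP.
have CD u v : C (u + v) = C u + C v by rewrite -[u]scale1r lin !scale1r.
have CZ x u : C (x *: u) = x *: C u by rewrite -[x *: u]addr0 lin C0 !addr0.
have Ccomb c : C (comb alpha c) = comb alpha c.
  rewrite /comb (big_morph C CD C0); apply: eq_bigr => k _.
  by rewrite -scaler_nat CZ fix_simple.
have Croot v : v \in Phi -> C v = v.
  move=> /(root_sign halpha)[c [->|->]] //.
  by rewrite -scaleN1r CZ Ccomb.
move=> v; have : v \in <<in_tuple (enum_fset Phi)>>%VS.
  by rewrite /= (root_span hPhi) memvf.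
move=> /coord_span ->; rewrite (big_morph C CD C0); apply: eq_bigr => i _.
by rewrite CZ Croot //; apply: mem_nth.
Qed.

Lemma coxeter_number_unique m0 : is_coxeter_number alpha h -> (0 < m0)%N ->
  (forall k, (k < r)%N -> iter m0 (coxeter_element alpha) (a k) = a k) ->
  (forall m, (0 < m)%N -> (m < m0)%N -> exists v, iter m (coxeter_element alpha) v <> v) ->
  h = m0.
Proof.
move=> [h0 hfix hmin] m00 /coxeter_fixed fix0 nofix; apply/eqP; rewrite eqn_leq hmin //=.
rewrite leqNgt; apply/negP=> lt; have [v] := nofix h h0 lt.
by rewrite hfix.
Qed.

Lemma cartan_AE k l : (cartan_A k l)%:~R =
  2 * (k == l)%:R - (k == l.+1)%:R - (l == k.+1)%:R :> R.
Proof.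
rewrite /cartan_A; have [->|kl] := eqVneq k l.
  by rewrite (_ : (l == l.+1) = false) ?mulr1 ?subr0 //; nlia.
have [->|kl1] := eqVneq k l.+1.
  by rewrite (_ : (l == l.+2) = false) ?mulr0 ?subr0 ?sub0r ?mulrN1z //; nlia.
by case: eqP => _ /=; rewrite ?mulrN1z ?mulr0z ?mulr0 ?subr0 ?sub0r.
Qed.

(** Both Cartan entries of two neighbours in the chain are -1, so neighbours have equal length and
    the single scale [q], half the squared length, governs the whole chain. *)
Lemma gram_of_cartan M : (0 < M)%N -> (M <= r)%N ->
  (forall k l, (k < M)%N -> (l < M)%N -> coroot_pairing (a k) (a l) = (cartan_A k l)%:~R) ->
  let q := dotv (a 0%N) (a 0%N) / 2 in
  forall k l, (k < M)%N -> (l < M)%N ->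
    dotv (a k) (a l) = q * (2 * (k == l)%:R - (k == l.+1)%:R - (l == k.+1)%:R).
Proof.
move=> M0 Mr cartan q.
have nz k : (k < M)%N -> dotv (a k) (a k) != 0.
  move=> kM; rewrite dotv_eq0; apply: (root_in_neq0 hPhi); apply: simple_in.
  exact: leq_trans kM Mr.
have dotE k l : (k < M)%N -> (l < M)%N -> dotv (a k) (a l) = (cartan_A k l)%:~R * dotv (a l) (a l) / 2.
  by move=> kM lM; rewrite -cartan // /coroot_pairing; have := nz l lM => ?; field.
have norm k : (k < M)%N -> dotv (a k) (a k) = 2 * q.
  elim: k => [|k IH] kM; first by rewrite /q; field.
  rewrite -(IH (ltnW kM)).
  have := dotE k k.+1 (ltnW kM) kM; have := dotE k.+1 k kM (ltnW kM).
  rewrite dotvC !cartan_AE !eqxx => ->.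
  have e1 : (k == k.+2) = false by nlia.
  have e2 : (k.+1 == k) = false by nlia.
  have e3 : (k == k.+1) = false by nlia.
  by rewrite e1 e2 e3 !mulr0 !subr0 !sub0r mulr1n => e; lra.
by move=> k l kM lM; rewrite dotE // norm // cartan_AE; field.
Qed.

Section Triangle.
Variables (n : nat) (dbl mid : bool) (el : nat -> nat -> bool -> Phi).
Let le := root_le alpha.
Let rk := root_rank alpha.
Let pos := pos_roots alpha.
Let Rvac := rowvacuation le rk pos.
Hypotheses (hT : folded_triangle le rk pos n dbl mid el)
  (hR : valid n mid 0 (triangle_rank n mid)) (hh : h = (triangle_rank n mid).+2).
Variable nshort : nat.
Hypothesis short_const : forall A : {set Phi}, A \in antichains le pos ->
  (#|[set b in A | short_root b]| + #|[set b in Rvac A | short_root b]|)%N = nshort.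

Let le_refl := root_le_refl alpha.
Let le_anti : antisymmetric le := root_le_anti halpha.
Let le_trans : transitive le := @root_le_trans _ _ _ _ alpha.
Let gpos : graded le rk pos := graded_triangle le_anti hT.

Lemma rowvacuation_level i : (i <= h - 1)%N ->
  Rvac (rank_level rk pos i) = rank_level rk pos (h - 1 - i).
Proof.
rewrite hh subn1 /= => iR; have eR := poset_rank_triangle hT hR.
have := rowvacuation_rank_level le_refl le_anti le_trans gpos (triangle_below hT) _ (i := i).
rewrite eR; apply=> // x xP rx; apply: (triangle_above le_refl hT) => //.
Qed.

(** The level [h - 1] is empty, so this is the extreme case of the formula for levels. *)
Lemma rowvacuation_set0 : Rvac set0 = simple_roots alpha.
Proof.
have e : rank_level rk pos (h - 1) = set0.
  apply/setP=> x; rewrite [RHS]inE; apply/negbTE/negP => /setIdP[xP /eqP rx].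
  by have := triangle_rank_le hT xP; rewrite rx hh subn1 ltnn.
by rewrite -e rowvacuation_level // subnn rank0_simple.
Qed.

Lemma set0_antichain : set0 \in antichains le pos.
Proof. by apply/antichainP; split=> [|x]; rewrite ?sub0set // inE. Qed.

(** The sum is the same for all antichains, and at the empty one it is the number of simple roots;
    so [n] and [r] are never compared. *)
Lemma card_const (A : {set Phi}) : A \in antichains le pos -> (#|A| + #|Rvac A|)%N = r.
Proof.
move=> hA; rewrite (card_rowvacuation le_refl le_anti le_trans hT hA).
rewrite -(card_rowvacuation le_refl le_anti le_trans hT set0_antichain).
by rewrite cards0 add0n -/Rvac rowvacuation_set0 card_simple.
Qed.

Lemma card_split (A : {set Phi}) (p : pred Phi) :
  (#|[set b in A | p b]| + #|[set b in A | ~~ p b]|)%N = #|A|.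
Proof.
rewrite -(cardsID [set b | p b] A); congr (_ + _)%N; apply: eq_card => x; rewrite !inE //.
by rewrite andbC.
Qed.

Lemma conclusion (A : {set Phi}) : A \in antichains le pos ->
    (Rvac A \in antichains le pos /\ Rvac (Rvac A) = A) /\
    [/\ (#|A| + #|Rvac A|)%N = r,
        (#|[set b in A | long_root b]| + #|[set b in Rvac A | long_root b]|)%N
          = #|[set b in simple_roots alpha | long_root b]| /\
        (#|[set b in A | short_root b]| + #|[set b in Rvac A | short_root b]|)%N
          = #|[set b in simple_roots alpha | short_root b]|,
        forall i : nat, (i <= h - 1)%N -> A = rank_level rk pos i ->
          Rvac A = rank_level rk pos (h - 1 - i),
        forall k : 'I_r, alpha k \in A ->
          Rvac A = rowvacuation le rk (parabolic_pos_roots alpha k) (A :\ alpha k)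
      & forall k : 'I_r, A \subset parabolic_pos_roots alpha k ->
          Rvac A = alpha k |: rowvacuation le rk (parabolic_pos_roots alpha k) A].
Proof.
move=> hA; have aP k : alpha k \in pos := alpha_pos alpha k.
have ar k : rk (alpha k) = 0%N := alpha_rank halpha k.
have shortE : (#|[set b in A | short_root b]| + #|[set b in Rvac A | short_root b]|)%N
          = #|[set b in simple_roots alpha | short_root b]|.
  (* The constant [nshort] is identified by the same evaluation at the empty antichain. *)
  rewrite short_const // -(short_const set0_antichain) rowvacuation_set0.
  rewrite (_ : [set b in set0 | short_root b] = set0) ?cards0 //.
  by apply/setP=> x; rewrite !inE.
split.
  split; first exact: (rowvacuation_antichain le_refl le_anti le_trans gpos hA).
  exact: (rowvacuationK le_refl le_anti le_trans gpos hA).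
split.
- exact: card_const.
- split=> //; apply/eqP; rewrite -(eqn_add2r #|[set b in simple_roots alpha | short_root b]|).
  rewrite -{1}shortE addnACA !card_split card_const // card_simple //.
- by move=> i hi eA; rewrite {1}eA rowvacuation_level.
- by move=> k kA; apply: (rowvacuation_mem le_refl le_anti le_trans gpos (aP k) (ar k) hA kA).
- move=> k sub; apply: (rowvacuation_remove le_refl le_anti le_trans gpos (aP k) (ar k)).
  by apply/antichainP; split=> //; have /antichainP[] := hA.
Qed.

End Triangle.
End Conclusion.

Lemma sum_interval N lo hi : (\sum_(k < N) ((lo <= k < hi) : nat) = minn hi N - lo)%N.
Proof.
elim: N => [|N IH]; first by rewrite big_ord0; nlia.
by rewrite big_ord_recr /= IH; nlia.
Qed.

Lemma iter_cycle (T : Type) (F : T -> T) (x : nat -> T) N :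
  (forall i, (i.+1 < N)%N -> F (x i) = x i.+1) -> forall m i, (i + m < N)%N ->
  iter m F (x i) = x (i + m)%N.
Proof.
move=> h; elim=> [|m IH] i im; first by rewrite addn0.
by rewrite iterS IH ?h ?addnS //; move: im; rewrite addnS // => /ltnW.
Qed.

(** * Root lengths in the simply laced types *)

Section SimplyLaced.
Variables (R : realFieldType) (d : nat) (Phi : {fset 'rV[R]_d}) (r : nat)
  (alpha : 'I_r -> Phi).
Hypotheses (hPhi : is_root_system Phi) (halpha : is_simple_system alpha).

Lemma all_long (c : R) : (forall k, (k < r)%N -> dotv (simple alpha k) (simple alpha k) = c) ->
  forall b : Phi, long_root b.
Proof.
move=> h; have norm v : v \in Phi -> dotv v v = c.
  apply: (simple_reflection_ind hPhi halpha (Q := fun v => dotv v v = c)) => [|w|k w kr].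
  - exact: h.
  - by rewrite dotvNl dotvNr opprK.
  - by rewrite reflection_dotv // (root_in_neq0 hPhi) // simple_in.
by move=> b; apply/forallP => g; rewrite !norm ?valP.
Qed.

Lemma short_all_long (A : {set Phi}) : (forall b : Phi, long_root b) ->
  #|[set b in A | short_root b]| = 0%N.
Proof. by move=> h; apply: eq_card0 => b; rewrite !inE /short_root h andbF. Qed.

End SimplyLaced.

(** * Orthogonal axes and signed permutations *)

Section OrthogonalAxes.
Variables (R : realFieldType) (d : nat) (a : nat -> 'rV[R]_d) (N : nat) (f : 'rV[R]_d) (q : R).
Hypotheses (q0 : q != 0)
  (gram : forall k l, (k.+1 < N)%N -> (l.+1 < N)%N ->
     dotv (a k) (a l) = q * (2 * (k == l)%:R - (k == l.+1)%:R - (l == k.+1)%:R))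
  (dot_f : forall k, (k.+1 < N)%N -> dotv (a k) f = - q * (k.+2 == N)%:R)
  (dot_ff : dotv f f = q).
Let e := axis a N f.

Lemma dotv_last_axis i : (i < N)%N -> dotv f (e i) = q * (i == N.-1)%:R.
Proof.
move=> iN; have [m hm] : exists m, (i + m = N.-1)%N by exists (N.-1 - i)%N; nlia.
elim: m i iN hm => [|m IH] i iN hm.
  have -> : i = N.-1 by nlia.
  by rewrite eqxx mulr1 /e axis_last.
have iN1 : (i.+1 < N)%N by nlia.
have hm1 : (i.+1 + m = N.-1)%N by nlia.
rewrite /e (axisS a f iN1) dotvDr dotvC (dot_f iN1) -/e (IH _ iN1 hm1).
have -> : (i == N.-1) = false by nlia.
have -> : (i.+2 == N) = (i.+1 == N.-1) by nlia.
by rewrite mulr0 mulNr addNr.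
Qed.

Lemma axis_orthogonal i j : (i < N)%N -> (j < N)%N -> dotv (e j) (e i) = q * (j == i)%:R.
Proof.
move=> iN jN; have [m hm] : exists m, (j + m = N.-1)%N by exists (N.-1 - j)%N; nlia.
elim: m j jN hm => [|m IH] j jN hm.
  have -> : j = N.-1 by nlia.
  by rewrite {1}/e axis_last dotv_last_axis // eq_sym.
have jN1 : (j.+1 < N)%N by nlia.
have hm1 : (j.+1 + m = N.-1)%N by nlia.
rewrite {1}/e (axisS a f jN1) dotvDl (dotv_axis gram dot_f jN1 iN) -/e (IH _ jN1 hm1).
by ring.
Qed.

Definition signed_axis (b : bool) (i : nat) : 'rV[R]_d := (-1) ^+ b *: e i.

Lemma axis_signed i : e i = signed_axis false i.
Proof. by rewrite /signed_axis scale1r. Qed.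

Lemma opp_axis_signed i : - e i = signed_axis true i.
Proof. by rewrite /signed_axis scaleN1r. Qed.

Lemma signed_axis_pair b b' i m : (i < N)%N -> (m < N)%N -> i != m ->
  let v := signed_axis b i + signed_axis b' m in
  exists i' m', [/\ (i' < m')%N, (m' < N)%N &
    (v = e i' - e m' \/ v = - (e i' - e m')) \/ (v = e i' + e m' \/ v = - (e i' + e m'))].
Proof.
have sgn : forall c, signed_axis c =1 (fun i => if c then - e i else e i).
  by case=> l; rewrite -?opp_axis_signed -?axis_signed.
move=> iN mN im; rewrite !sgn; have [lt|lt|eq] := ltngtP i m; last by rewrite eq eqxx in im.
  exists i, m; split=> //; case: b; case: b'.
  - by right; right; rewrite [RHS]opprD.
  - by left; right; rewrite [RHS]opprB addrC.
  - by left; left.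
  - by right; left.
exists m, i; split=> //; case: b; case: b'.
- by right; right; rewrite [RHS]opprD addrC.
- by left; left; rewrite addrC.
- by left; right; rewrite [RHS]opprB.
- by right; left; rewrite addrC.
Qed.

Lemma signed_axisN b i : - signed_axis b i = signed_axis (~~ b) i.
Proof. by rewrite /signed_axis signrN scaleNr. Qed.

Lemma reflection_signed_chain k b i : (k.+1 < N)%N -> (i < N)%N ->
  reflection (a k) (signed_axis b i) = signed_axis b (swap k i).
Proof. by move=> kN iN; rewrite reflectionZ (reflection_axis q0 gram dot_f). Qed.

Lemma chain_product_signed m b i : (m < N)%N -> (i < N)%N ->
  chain_product a m (signed_axis b i) =
  signed_axis b (if (i < m)%N then i.+1 else if i == m then 0%N else i).
Proof. by move=> mN iN; rewrite chain_productZ (chain_product_axis q0 gram dot_f). Qed.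

Lemma reflection_signed_last c b i : c != 0 -> (i < N)%N ->
  reflection (c *: f) (signed_axis b i) = signed_axis (b (+) (i == N.-1)) i.
Proof.
move=> c0 iN; rewrite reflectionZ /reflection /coroot_pairing.
rewrite (dotvC (e i)) !dotvZl !dotvZr dotv_last_axis // dot_ff.
have [-> /=|ne] := eqVneq i N.-1; last first.
  by rewrite mulr0 !mulr0 mul0r scale0r subr0 addbF.
rewrite /signed_axis addbT signrN scaleNr -scalerN; congr (_ *: _).
rewrite /e axis_last scalerA.
have -> : 2 * (c * (q * 1)) / (c * (c * q)) * c = 2 by field; rewrite q0 c0.
by rewrite scaler_nat mulr2n opprD addrA subrr add0r.
Qed.

(** The extra generator of type D exchanges the last two axes and changes the sign of both. *)
Lemma reflection_signed_sum b i : (1 < N)%N -> (i < N)%N ->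
  reflection (e N.-2 + e N.-1) (signed_axis b i) =
  signed_axis (b (+) ((i == N.-2) || (i == N.-1))) (swap N.-2 i).
Proof.
move=> N1 iN; rewrite reflectionZ /reflection /coroot_pairing.
have N2 : (N.-2 < N)%N by nlia.
have N3 : (N.-1 < N)%N by nlia.
rewrite (dotvDl (e N.-2) (e N.-1)) !(dotvDr (e N.-2) (e N.-1)) !axis_orthogonal // !eqxx.
have -> : (N.-2 == N.-1) = false by nlia.
have -> : (N.-1 == N.-2) = false by nlia.
rewrite /swap; have eN : N.-2.+1 = N.-1 by nlia.
rewrite eN; have [->|ne] := eqVneq i N.-2.
  have -> : (N.-2 == N.-1) = false by nlia.
  rewrite /= addbT /signed_axis signrN scaleNr -scalerN; congr (_ *: _).
  have -> : 2 * (q * 1%:R + q * 0%:R) / (q * 1%:R + q * 0%:R + (q * 0%:R + q * 1%:R)) = 1.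
    by field; rewrite -mulr2n mulrn_eq0.
  by rewrite scale1r opprD addrA subrr add0r.
have [->|ne1] := eqVneq i N.-1.
  rewrite /= addbT /signed_axis signrN scaleNr -scalerN; congr (_ *: _).
  have -> : 2 * (q * 0%:R + q * 1%:R) / (q * 1%:R + q * 0%:R + (q * 0%:R + q * 1%:R)) = 1.
    by field; rewrite -mulr2n mulrn_eq0.
  by rewrite scale1r opprD addrCA subrr addr0.
by rewrite /= !mulr0 addr0 mulr0 mul0r scale0r subr0 addbF.
Qed.

Lemma dotv_signed_axis b i : (0 < N)%N -> (i < N)%N ->
  dotv (e 0%N) (signed_axis b i) = (-1) ^+ b * (q * (0%N == i)%:R).
Proof. by move=> N0 iN; rewrite dotvZr axis_orthogonal. Qed.

Lemma signed_axis_neq b i : (0 < N)%N -> (i < N)%N -> b || (0 < i)%N -> signed_axis b i <> e 0%N.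
Proof.
move=> N0 iN h /(congr1 (dotv (e 0%N))); rewrite dotv_signed_axis // axis_orthogonal // eqxx mulr1.
case: posnP h => [->|i0 _]; last first.
  have -> : (0%N == i) = false by nlia.
  by rewrite mulr0 mulr0 => /esym/eqP; rewrite (negbTE q0).
rewrite orbF => ->; rewrite eqxx mulr1 expr1 mulN1r => /eqP.
by rewrite eq_sym -addr_eq0 -mulr2n mulrn_eq0 /= (negbTE q0).
Qed.

Section SignedCycle.
Variables (C : 'rV[R]_d -> 'rV[R]_d) (M : nat).
Hypotheses (M0 : (0 < M)%N) (MN : (M <= N)%N)
  (C_axis : forall b i, (i < M)%N ->
     C (signed_axis b i) = if (i.+1 < M)%N then signed_axis b i.+1 else signed_axis (~~ b) 0).

Lemma iter_signed_axis b i m : (i + m < M)%N -> iter m C (signed_axis b i) = signed_axis b (i + m).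
Proof.
move=> im; apply: (iter_cycle (x := signed_axis b) (N := M)) => // l lM.
by rewrite C_axis ?lM //; nlia.
Qed.

(** The signed axes form one cycle of length [M + M], half of which is the sign change. In types B
    and C the cycle uses all axes; in type D the last axis stays apart. *)
Lemma iter_half_cycle b i : (i < M)%N -> iter M C (signed_axis b i) = signed_axis (~~ b) i.
Proof.
move=> iM; have {1}-> : M = (i + (M.-1 - i).+1)%N by nlia.
rewrite iterD iterS iter_signed_axis; last by nlia.
rewrite subnKC; last by nlia.
have -> : C (signed_axis b M.-1) = signed_axis (~~ b) 0.
  rewrite C_axis; last by nlia.
  by rewrite prednK // ltnn.
by rewrite iter_signed_axis.
Qed.

Lemma iter_full_cycle b i : (i < M)%N -> iter (M + M) C (signed_axis b i) = signed_axis b i.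
Proof. by move=> iM; rewrite iterD !iter_half_cycle // negbK. Qed.

Lemma iter_cycle_neq m : (0 < m)%N -> (m < M + M)%N -> iter m C (e 0%N) <> e 0%N.
Proof.
move=> m0 mM; have -> : iter m C (e 0%N) = iter m C (signed_axis false 0).
  by rewrite /signed_axis scale1r.
have [lt|ge] := ltnP m M.
  by rewrite iter_signed_axis // add0n; apply: signed_axis_neq; nlia.
have -> : m = ((m - M) + M)%N by nlia.
rewrite iterD iter_half_cycle // iter_signed_axis; last by nlia.
by apply: signed_axis_neq => //; nlia.
Qed.

End SignedCycle.

End OrthogonalAxes.

(** * Roots obtained from the axes *)

Section ChainRoots.
Variables (R : realFieldType) (d : nat) (Phi : {fset 'rV[R]_d}) (r : nat)
  (alpha : 'I_r -> Phi).
Hypotheses (hPhi : is_root_system Phi).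
Let a := simple alpha.
Variables (N : nat) (f : 'rV[R]_d) (q : R).
Hypotheses (Nr : (N <= r.+1)%N) (q0 : q != 0)
  (gram : forall k l, (k.+1 < N)%N -> (l.+1 < N)%N ->
     dotv (a k) (a l) = q * (2 * (k == l)%:R - (k == l.+1)%:R - (l == k.+1)%:R))
  (dot_f : forall k, (k.+1 < N)%N -> dotv (a k) f = - q * (k.+2 == N)%:R).
Let e := axis a N f.

Lemma chain_in k : (k.+1 < N)%N -> a k \in Phi.
Proof. by move=> kN; apply: simple_in; nlia. Qed.

Lemma axis_sub_root i m : (i < m)%N -> (m < N)%N -> e i - e m \in Phi.
Proof.
move=> im; have {im}[p ->] : exists p, m = (i + p.+1)%N by exists (m - i.+1)%N; nlia.
elim: p => [|p IH] im.
  have iN : (i.+1 < N)%N by nlia.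
  by rewrite addn1 -(chainE a f iN); apply: chain_in.
have kN : ((i + p.+1).+1 < N)%N by nlia.
have iN : (i < N)%N by nlia.
have := reflection_in hPhi (chain_in kN) (IH (ltnW kN)).
rewrite reflectionB !(reflection_axis q0 gram dot_f) ?(ltnW kN) // /swap.
have -> : (i == i + p.+1)%N = false by nlia.
have -> : (i == (i + p.+1).+1)%N = false by nlia.
by rewrite eqxx !addnS.
Qed.

Lemma axis_add_root i m : (forall l, (l < N.-1)%N -> e l + e N.-1 \in Phi) ->
  (i < m)%N -> (m < N)%N -> e i + e m \in Phi.
Proof.
move=> h im mN; have [p hp] : exists p, (m + p = N.-1)%N by exists (N.-1 - m)%N; nlia.
elim: p m im mN hp => [|p IH] m im mN hp.
  have em : m = N.-1 by nlia.
  by rewrite em; apply: h; nlia.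
have mN1 : (m.+1 < N)%N by nlia.
have iN : (i < N)%N by nlia.
have := reflection_in hPhi (chain_in mN1) (IH m.+1 (leqW im) mN1 ltac:(nlia)).
rewrite reflectionD !(reflection_axis q0 gram dot_f) // /swap.
have -> : (i == m)%N = false by nlia.
have -> : (i == m.+1)%N = false by nlia.
have -> : (m.+1 == m)%N = false by nlia.
by rewrite eqxx.
Qed.

Lemma axis_scale_root c i : c *: f \in Phi -> (i < N)%N -> c *: e i \in Phi.
Proof.
move=> h iN; have [p hp] : exists p, (i + p = N.-1)%N by exists (N.-1 - i)%N; nlia.
elim: p i iN hp => [|p IH] i iN hp.
  have -> : i = N.-1 by nlia.
  by rewrite /e axis_last.
have iN1 : (i.+1 < N)%N by nlia.
have := reflection_in hPhi (chain_in iN1) (IH i.+1 iN1 ltac:(nlia)).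
rewrite reflectionZ (reflection_axis q0 gram dot_f) // /swap.
have -> : (i.+1 == i)%N = false by nlia.
by rewrite eqxx.
Qed.

End ChainRoots.

(** * Type A *)

Section TypeA.
Variables (R : realFieldType) (d : nat) (Phi : {fset 'rV[R]_d}) (r h : nat)
  (alpha : 'I_r -> Phi).
Hypotheses (hPhi : is_root_system Phi) (halpha : is_simple_system alpha)
  (r0 : (0 < r)%N) (hh : is_coxeter_number alpha h)
  (cartan : forall k l, (k < r)%N -> (l < r)%N ->
     coroot_pairing (simple alpha k) (simple alpha l) = (cartan_A k l)%:~R).

Let a := simple alpha.
Let q := dotv (a 0%N) (a 0%N) / 2.

Definition coef_A (i j : nat) (s : bool) (k : nat) : nat := (i <= k < j.+1)%N.

Lemma q_neq0_A : q != 0.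
Proof.
rewrite mulf_neq0 ?invr_neq0 ?pnatr_eq0 // dotv_eq0.
by apply: (root_in_neq0 hPhi); apply: simple_in.
Qed.

Lemma gram_A k l : (k.+1 < r.+1)%N -> (l.+1 < r.+1)%N ->
  dotv (a k) (a l) = q * (2 * (k == l)%:R - (k == l.+1)%:R - (l == k.+1)%:R).
Proof. exact: (gram_of_cartan hPhi r0 (leqnn r) cartan). Qed.

(** In the usual model this is the last basis vector minus the mean of all of them. The axes then
    sum to zero instead of being orthogonal. *)
Definition last_axis_A : 'rV[R]_d := - (r.+1%:R)^-1 *: \sum_(l < r) l.+1%:R *: a l.

Lemma sum_delta_mul (F : nat -> R) m k :
  \sum_(l < m) F l * (l == k :> nat)%:R = (k < m)%:R * F k.
Proof.
elim: m => [|m IH]; first by rewrite big_ord0 ltn0 mul0r.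
rewrite big_ord_recr /= IH ltnS.
have [->|mk] := eqVneq m k; first by rewrite ltnn leqnn mul0r mul1r add0r mulr1.
have -> : (k <= m)%N = (k < m)%N by nlia.
by rewrite mulr0 addr0.
Qed.

Lemma dot_last_axis_A k : (k.+1 < r.+1)%N -> dotv (a k) last_axis_A = - q * (k.+2 == r.+1)%:R.
Proof.
move=> kr; have {}kr : (k < r)%N by [].
have r1 : (r.+1%:R : R) != 0 by rewrite pnatr_eq0.
rewrite /last_axis_A dotvZr dotv_sumr.
have -> : \sum_(l < r) dotv (a k) (l.+1%:R *: a l) = q *
    (2 * (\sum_(l < r) l.+1%:R * (l == k :> nat)%:R)
     - (\sum_(l < r) l.+1%:R * (k == l.+1 :> nat)%:R)
     - (\sum_(l < r) l.+1%:R * (l == k.+1 :> nat)%:R)).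
  rewrite mulr_sumr -!sumrB mulr_sumr; apply: eq_bigr => l _.
  rewrite dotvZr (gram_A (kr : k.+1 < r.+1)%N (ltn_ord l : l.+1 < r.+1)%N) [k == _]eq_sym; ring.
have -> : \sum_(l < r) l.+1%:R * (k == l.+1 :> nat)%:R = k%:R :> R.
  case: k kr => [|k] kr; first by apply: big1 => l _; rewrite mulr0.
  under eq_bigr => l _ do rewrite eqSS eq_sym.
  by rewrite (sum_delta_mul (fun l => l.+1%:R)) ltnW // mul1r.
rewrite !(sum_delta_mul (fun l => l.+1%:R)) kr mul1r eqSS.
have [k1|k1] := eqVneq k.+1 r.
  by rewrite -k1 ltnn /=; field; rewrite -natrD pnatr_eq0.
have -> : (k.+1 < r)%N by nlia.
by rewrite !mul1r mulr0 -!natr1; ring.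
Qed.

Let e := axis a r.+1 last_axis_A.

Lemma comb_coef_A i j s : valid r false i j -> comb alpha (coef_A i j s) = e i - e j.+1.
Proof.
move=> v; rewrite /comb /coef_A.
rewrite (sum_interval_chain _ last_axis_A (ltnSn r)); last first.
  by rewrite /valid in v; nlia.
by congr (_ - _); congr axis; rewrite /valid in v; nlia.
Qed.

Lemma simple_axis_A k : (k < r)%N -> a k = e k - e k.+1.
Proof. by move=> kr; apply: chainE. Qed.

Lemma reflection_axis_A k i : (k < r)%N -> (i < r.+1)%N ->
  reflection (a k) (e i) = e (swap k i).
Proof. by move=> kr ir; apply: (reflection_axis q_neq0_A gram_A dot_last_axis_A). Qed.

Lemma coef_A_in i j s : valid r false i j -> comb alpha (coef_A i j s) \in Phi.
Proof.
move=> v; rewrite comb_coef_A //.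
by apply: (axis_sub_root hPhi (leqnn _) q_neq0_A gram_A dot_last_axis_A); rewrite /valid in v; nlia.
Qed.

Lemma coef_A_onto v : v \in Phi -> exists i j s, valid r false i j /\
  (v = comb alpha (coef_A i j s) \/ v = - comb alpha (coef_A i j s)).
Proof.
pose Q w := exists i m, [/\ (i < r.+1)%N, (m < r.+1)%N, i != m & w = e i - e m].
move=> hv; have [i [m [ir mr im ->]]] : Q v.
  apply: (simple_reflection_ind hPhi halpha (Q := Q)) hv => [k kr|w|k w kr].
  - by exists k, k.+1; rewrite -simple_axis_A //; split=> //; nlia.
  - by move=> [i [m [ir mr im ->]]]; exists m, i; rewrite eq_sym opprB.
  - move=> [i [m [ir mr im ->]]]; exists (swap k i), (swap k m).
    by rewrite reflectionB !reflection_axis_A // !swap_lt // swap_eq.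
have [lt|lt|eq] := ltngtP i m; last by rewrite eq eqxx in im.
  have vv : valid r false i m.-1 by rewrite /valid; nlia.
  exists i, m.-1, true; split=> //; left.
  by rewrite comb_coef_A // (ltn_predK lt).
have vv : valid r false m i.-1 by rewrite /valid; nlia.
exists m, i.-1, true; split=> //; right.
by rewrite comb_coef_A // (ltn_predK lt) opprB.
Qed.

Lemma coef_A_le i j s i' j' s' : valid r false i j -> valid r false i' j' ->
  (forall k, (k < r)%N -> (coef_A i j s k <= coef_A i' j' s' k)%N) <->
  [&& (i' <= i)%N, (j <= j')%N & compat r false j s j' s'].
Proof.
rewrite /valid => v v'; split=> [le|/and3P[ii jj _] k kr]; last by rewrite /coef_A; nlia.
have ir : (i < r)%N by nlia.
have jr : (j < r)%N by nlia.
by have := le i ir; have := le j jr; rewrite /coef_A /compat /= andbT; nlia.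
Qed.

Lemma coef_A_sum i j s : valid r false i j -> (\sum_(k < r) coef_A i j s k = (j - i).+1)%N.
Proof. by move=> v; rewrite sum_interval; rewrite /valid in v; nlia. Qed.

Lemma coxeter_axis_A i : (i < r.+1)%N ->
  coxeter_element alpha (e i) = e (if (i < r)%N then i.+1 else 0%N).
Proof.
move=> ir; rewrite coxeter_elementE.
rewrite (chain_product_axis q_neq0_A gram_A dot_last_axis_A) //; congr axis.
by case: (ltngtP i r) => // h1; nlia.
Qed.

Lemma coxeter_iter_A m i : (i < r.+1)%N -> (m <= r.+1)%N ->
  iter m (coxeter_element alpha) (e i) = e (if (i + m < r.+1)%N then i + m else i + m - r.+1)%N.
Proof.
move=> ir; elim: m => [|m IH] mr; first by rewrite addn0 ir.
rewrite iterS IH ?(ltnW mr) // coxeter_axis_A; last by case: (ltnP (i + m)) => ?; nlia.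
by congr (axis _ _ _ _); case: (ltnP (i + m)) => ?; case: ltnP => ?; case: ltnP => ?; nlia.
Qed.

Lemma coxeter_number_A : h = r.+1.
Proof.
apply: (coxeter_number_unique hPhi halpha hh) => //.
  move=> k kr; rewrite -/a simple_axis_A //.
  have lin := coxeter_linear alpha r.+1 (-1) (e k.+1) (e k).
  rewrite !scaleN1r addrC in lin; rewrite lin !coxeter_iter_A //; try nlia.
  have -> : (k + r.+1 < r.+1)%N = false by nlia.
  have -> : (k.+1 + r.+1 < r.+1)%N = false by nlia.
  by rewrite !addnK addrC.
(* A smaller power fixing the axis 0 would make it equal to the axis [m], whereas their difference
   is a root. *)
move=> m m0 mr; exists (e 0%N); rewrite coxeter_iter_A ?(ltnW mr) // add0n mr => em.
have := axis_sub_root hPhi (leqnn _) q_neq0_A gram_A dot_last_axis_A m0 mr.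
by rewrite -/e em subrr => /(root_in_neq0 hPhi); rewrite eqxx.
Qed.

Let le := root_le alpha.
Let rk := root_rank alpha.
Let pos := pos_roots alpha.

Lemma triangle_A : folded_triangle le rk pos r false false (coef_root alpha coef_A (alpha (Ordinal r0))).
Proof.
exact: (coef_folded_triangle hPhi halpha coef_A_in coef_A_onto coef_A_le coef_A_sum).
Qed.

Lemma long_A (b : Phi) : long_root b.
Proof.
apply: (all_long hPhi halpha (c := 2 * q)) => k kr.
exact: (dotv_chain gram_A).
Qed.

End TypeA.

(** * Types B and C: common geometry *)

Section TypesBC.
Variables (R : realFieldType) (d : nat) (Phi : {fset 'rV[R]_d}) (n h : nat)
  (alpha : 'I_n.+1 -> Phi).
Hypotheses (hPhi : is_root_system Phi) (halpha : is_simple_system alpha)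
  (n0 : (0 < n)%N) (hh : is_coxeter_number alpha h).
Let a := simple alpha.
Variables (f : 'rV[R]_d) (q c : R).
Hypotheses (q0 : q != 0) (c0 : c != 0)
  (gram : forall k l, (k.+1 < n.+1)%N -> (l.+1 < n.+1)%N ->
     dotv (a k) (a l) = q * (2 * (k == l)%:R - (k == l.+1)%:R - (l == k.+1)%:R))
  (dot_f : forall k, (k.+1 < n.+1)%N -> dotv (a k) f = - q * (k.+2 == n.+1)%:R)
  (dot_ff : dotv f f = q) (last_root : a n = c *: f).

Let e := axis a n.+1 f.
Let sx := signed_axis a n.+1 f.

Lemma chain_signed k b i : (k < n)%N -> (i < n.+1)%N ->
  reflection (a k) (sx b i) = sx b (swap k i).
Proof. by move=> kn iN; apply: (reflection_signed_chain q0 gram dot_f). Qed.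

Lemma last_signed b i : (i < n.+1)%N -> reflection (a n) (sx b i) = sx (b (+) (i == n)) i.
Proof. by move=> iN; rewrite last_root; apply: (reflection_signed_last q0 dot_f dot_ff). Qed.

Lemma add_root_BC i m : (i < m)%N -> (m < n.+1)%N -> e i + e m \in Phi.
Proof.
apply: (axis_add_root hPhi (leqnSn _) q0 gram dot_f) => l /= ln.
have hs : e l - e n \in Phi.
  by apply: (axis_sub_root hPhi (leqnSn _) q0 gram dot_f).
have := reflection_in hPhi (simple_in alpha (ltnSn n)) hs; rewrite -/a.
rewrite /e opp_axis_signed {1}axis_signed -/sx reflectionD !last_signed ?(leqW ln) // eqxx.
have -> : (l == n) = false by nlia.
by rewrite /= /sx -!axis_signed.
Qed.

Lemma scale_root_BC i : (i < n.+1)%N -> c *: e i \in Phi.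
Proof.
apply: (axis_scale_root hPhi (leqnSn _) q0 gram dot_f).
by rewrite -last_root; apply: simple_in.
Qed.

(** The simple reflections permute the signed axes, so they preserve this set of vectors. The factor
    [c] is 1 in type B and 2 in type C. *)
Lemma roots_BC v : v \in Phi ->
  (exists i m, [/\ (i < m)%N, (m < n.+1)%N &
     (v = e i - e m \/ v = - (e i - e m)) \/ (v = e i + e m \/ v = - (e i + e m))]) \/
  (exists2 i, (i < n.+1)%N & v = c *: e i \/ v = - (c *: e i)).
Proof.
pose Q w := (exists i m b b', [/\ (i < n.+1)%N, (m < n.+1)%N, i != m & w = sx b i + sx b' m]) \/
  (exists i b, (i < n.+1)%N /\ w = c *: sx b i).
move=> hv; have : Q v.
  apply: (simple_reflection_ind hPhi halpha (Q := Q)) hv => [k kr|w|k w kr].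
  - have [kn|nk] := ltnP k n.
      left; exists k, k.+1, false, true; split=> //; first by nlia.
      by rewrite /sx -axis_signed -opp_axis_signed -/a (chainE a f (N := n.+1)).
    right; exists n, false; split=> //; have -> : k = n by nlia.
    by rewrite /sx -axis_signed (axis_last a n.+1 f) -last_root.
  - case=> [[i [m [b [b' [iN mN im ->]]]]]|[i [b [iN ->]]]].
      left; exists i, m, (~~ b), (~~ b'); split=> //.
      by rewrite opprD /sx !signed_axisN.
    by right; exists i, (~~ b); split=> //; rewrite -scalerN /sx signed_axisN.
  - have [kn|nk] := ltnP k n.
      case=> [[i [m [b [b' [iN mN im ->]]]]]|[i [b [iN ->]]]].
        left; exists (swap k i), (swap k m), b, b'.
        by rewrite reflectionD !chain_signed // !swap_lt // swap_eq.
      by right; exists (swap k i), b; rewrite reflectionZ chain_signed // swap_lt.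
    have -> : k = n by nlia.
    case=> [[i [m [b [b' [iN mN im ->]]]]]|[i [b [iN ->]]]].
      left; exists i, m, (b (+) (i == n)), (b' (+) (m == n)).
      by rewrite reflectionD !last_signed.
    by right; exists i, (b (+) (i == n)); rewrite reflectionZ last_signed.
case=> [[i [m [b [b' [iN mN im ->]]]]]|[i [b [iN ->]]]]; last first.
  right; exists i => //; case: b; [right|left]; last by rewrite /sx -axis_signed.
  by rewrite /sx -opp_axis_signed scalerN.
by left; apply: signed_axis_pair.
Qed.

Lemma coxeter_signed b i : (i < n.+1)%N -> coxeter_element alpha (sx b i) =
  if (i.+1 < n.+1)%N then sx b i.+1 else sx (~~ b) 0.
Proof.
move=> iN; rewrite coxeter_elementE chain_productS -/a last_signed //.
rewrite (chain_product_signed q0 gram dot_f) // ltnS.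
have [lt|ge] := ltnP i n; first by rewrite (ltn_eqF lt) addbF.
have -> : i = n by nlia.
by rewrite eqxx addbT.
Qed.

Lemma coxeter_number_BC : h = (n.+1 + n.+1)%N.
Proof.
apply: (coxeter_number_unique hPhi halpha hh) => // [|m m0 mN]; last first.
  by exists (e 0%N); apply: (iter_cycle_neq q0 gram dot_f dot_ff (ltn0Sn n) (leqnn _) coxeter_signed).
have fix_axis i : (i < n.+1)%N -> iter (n.+1 + n.+1) (coxeter_element alpha) (e i) = e i.
  by move=> iN; rewrite /e axis_signed; apply: (iter_full_cycle (ltn0Sn n) (leqnn _) coxeter_signed).
have lin := coxeter_linear alpha (n.+1 + n.+1).
have C0 : iter (n.+1 + n.+1) (coxeter_element alpha) 0 = 0.
  have := lin 1 0 0; rewrite !scale1r addr0 => /eqP.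
  by rewrite -subr_eq subrr => /eqP.
move=> k kr; rewrite -/a; have [kn|nk] := ltnP k n.
  have -> : a k = (-1) *: e k.+1 + e k by rewrite scaleN1r addrC; apply: chainE.
  by rewrite lin !fix_axis.
have -> : a k = c *: e n + 0.
  by rewrite addr0 /e (axis_last a n.+1 f) -last_root; congr a; nlia.
by rewrite lin C0 fix_axis.
Qed.

End TypesBC.

Lemma dotv_pairing (R : realFieldType) d (u v : 'rV[R]_d) (z : int) :
  v != 0 -> coroot_pairing u v = z%:~R -> dotv u v = z%:~R * dotv v v / 2.
Proof. by rewrite -dotv_eq0 => v0 <-; rewrite /coroot_pairing; field. Qed.

Lemma long_rootE (R : realFieldType) d (Phi : {fset 'rV[R]_d}) (Q : R) (v : 'rV[R]_d) :
  (forall w, w \in Phi -> dotv w w <= Q) -> v \in Phi -> dotv v v = Q ->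
  forall b : Phi, long_root b = (Q <= dotv (fsval b) (fsval b)).
Proof.
move=> max hv ev b; apply/forallP/idP => [/(_ (FSetSub hv))|le g]; first by rewrite /= ev.
by apply: le_trans le; apply: max; apply: valP.
Qed.

(* The coefficients on the first [n] simple roots of [e i - e j.+1] for [j < n],
   of [e i + e (n + n + t - j)] for [n < j]. *)
Definition fold_coef (n t i j k : nat) : nat :=
  ((i <= k < j.+1) + (n + n + t - j <= k < n + n + 2))%N.

Lemma sum_fold_coef n t i j : (i <= n)%N ->
  (\sum_(k < n) fold_coef n t i j k = minn j.+1 n - i + (n - (n + n + t - j)))%N.
Proof.
by move=> ni; rewrite /fold_coef big_split /= !sum_interval; nlia.
Qed.

(** It suffices to compare at the ends of the interval: the nodes [i], [j] and, after folding,
    [n + n + t - j]. The columns from [n] to [n + t] are left to the coefficients at the remaining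
    nodes. *)
Lemma fold_coef_le n t i j i' j' : (t <= 1)%N -> (i <= j)%N -> (i + j <= n + n)%N ->
  (i' <= j')%N -> (i' + j' <= n + n)%N ->
  (forall k, (k < n)%N -> (fold_coef n t i j k <= fold_coef n t i' j' k)%N) ->
  [/\ (i < n -> i' <= i)%N, (j < n -> j <= j')%N & (n + t < j -> j <= j')%N].
Proof.
rewrite /fold_coef => t1 ij ijn ij' ijn' le; split=> h.
- by have := le i h; clear le; nlia.
- by have := le j h; clear le; nlia.
- have h1 : (n + n + t - j < n)%N by nlia.
  by have := le _ h1; clear le; nlia.
Qed.

Lemma sum_fold_chain (R : realFieldType) d (a : nat -> 'rV[R]_d) N f n t i j :
  (n < N)%N -> (i <= j)%N -> (i + j <= n + n)%N -> (t <= 1)%N ->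
  \sum_(k < n) a k *+ fold_coef n t i j k =
  axis a N f i - axis a N f (minn j.+1 n) +
  (axis a N f (minn (n + n + t - j) n) - axis a N f n).
Proof.
move=> nN ij ijn t1; under eq_bigr => k _ do rewrite /fold_coef mulrnDr.
rewrite big_split /= !(sum_interval_chain a f nN); try by nlia.
by congr (axis _ _ _ _ - _ + (_ - axis _ _ _ _)); nlia.
Qed.

(** * Type B *)

Section TypeB.
Variables (R : realFieldType) (d : nat) (Phi : {fset 'rV[R]_d}) (n h : nat)
  (alpha : 'I_n.+1 -> Phi).
Hypotheses (hPhi : is_root_system Phi) (halpha : is_simple_system alpha)
  (n0 : (0 < n)%N) (hh : is_coxeter_number alpha h)
  (cartan : forall k l, (k < n.+1)%N -> (l < n.+1)%N ->
     coroot_pairing (simple alpha k) (simple alpha l) = (cartan_entry TypeB n.+1 k l)%:~R).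

Let a := simple alpha.
Let q := dotv (a 0%N) (a 0%N) / 2.

Lemma q_gt0_B : 0 < q.
Proof.
rewrite divr_gt0 ?ltr0n // lt_def dotv_ge0 dotv_eq0 andbT.
by apply: (root_in_neq0 hPhi); apply: simple_in.
Qed.

Lemma gram_B k l : (k.+1 < n.+1)%N -> (l.+1 < n.+1)%N ->
  dotv (a k) (a l) = q * (2 * (k == l)%:R - (k == l.+1)%:R - (l == k.+1)%:R).
Proof.
apply: (gram_of_cartan hPhi n0 (leqnSn n)) => {}k {}l kn ln.
rewrite cartan ?(leqW kn) ?(leqW ln) //=.
have -> : (l.+1 == n.+1) = false by nlia.
by rewrite andbF.
Qed.

Lemma dot_last_B k : (k.+1 < n.+1)%N -> dotv (a k) (a n) = - q * (k.+2 == n.+1)%:R.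
Proof.
move=> kn; have := cartan (ltnSn n) (leqW (kn : k < n)%N); rewrite -/a /=.
have -> : (k.+1 == n.+1) = false by nlia.
rewrite andbF => /(dotv_pairing (root_in_neq0 hPhi (simple_in alpha (leqW (kn : k < n)%N)))).
rewrite dotvC (dotv_chain gram_B kn) cartan_AE => ->.
have -> : (n == k) = false by nlia.
have -> : (k == n.+1) = false by nlia.
by rewrite !eqSS [n == _]eq_sym mulr0 subr0 sub0r; field.
Qed.

Lemma dot_last_last_B : dotv (a n) (a n) = q.
Proof.
have n1 : (n.-1.+1 < n.+1)%N by nlia.
have := cartan (ltnW n1) (ltnSn n); rewrite -/a /= prednK // !eqxx /= => /dotv_pairing.
move=> /(_ (root_in_neq0 hPhi (simple_in alpha (ltnSn n)))).
rewrite dot_last_B // prednK // eqxx mulr1 => e.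
rewrite -/a in e; move: e; set x := dotv (a n) (a n) => e; lra.
Qed.

Let q0 : q != 0. Proof. by rewrite lt0r_neq0 // q_gt0_B. Qed.
Let last_B : a n = 1 *: a n. Proof. by rewrite scale1r. Qed.
Let e := axis a n.+1 (a n).

(** Column [n] is [e i], and column [n.+1], which is [e i + e n], takes the short simple root a
    second time. This delays the repetition of the other nodes by one column, whence the shift 1. *)
Definition coef_B (i j : nat) (s : bool) (k : nat) : nat :=
  if (k < n)%N then fold_coef n 1 i j k else ((n <= j) + (n < j))%N.

Lemma comb_coef_B i j s : valid n true i j -> comb alpha (coef_B i j s) =
  if (j < n)%N then e i - e j.+1 else if j == n then e i else e i + e (n + n + 1 - j)%N.
Proof.
move=> v; rewrite /comb big_ord_recr /= /coef_B ltnn.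
under eq_bigr => k _ do rewrite ltn_ord.
rewrite (sum_fold_chain a (a n) (ltnSn n)) //; try by rewrite /valid in v; nlia.
have en : a n = e n by rewrite /e (axis_last a n.+1 (a n)).
rewrite -/a -/e {1}en; have [jn|jn|->] := ltngtP j n => /=.
- have -> : minn j.+1 n = j.+1 by nlia.
  have -> : minn (n + n + 1 - j) n = n by nlia.
  by rewrite addr0 subrr addr0.
- have -> : minn j.+1 n = n by nlia.
  have -> : minn (n + n + 1 - j) n = (n + n + 1 - j)%N by nlia.
  by rewrite mulr2n addrACA !subrK.
- have -> : minn n.+1 n = n by nlia.
  have -> : minn (n + n + 1 - n) n = n by nlia.
  by rewrite subrr addr0 subrK.
Qed.

Lemma coef_B_in i j s : valid n true i j -> comb alpha (coef_B i j s) \in Phi.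
Proof.
move=> v; rewrite comb_coef_B //; rewrite /valid in v.
have [jn|jn|_] := ltngtP j n.
- by apply: (axis_sub_root hPhi (leqnSn _) q0 gram_B dot_last_B); nlia.
- by apply: (add_root_BC hPhi n0 q0 (oner_neq0 R) gram_B dot_last_B dot_last_last_B last_B); nlia.
- rewrite -[e i]scale1r.
  by apply: (scale_root_BC hPhi q0 gram_B dot_last_B last_B); nlia.
Qed.

Lemma coef_B_onto v : v \in Phi -> exists i j s, valid n true i j /\
  (v = comb alpha (coef_B i j s) \/ v = - comb alpha (coef_B i j s)).
Proof.
move=> hv; have main i j w : valid n true i j -> v = w \/ v = - w ->
    (if (j < n)%N then e i - e j.+1 else if j == n then e i else e i + e (n + n + 1 - j)%N) = w ->
    exists i j s, valid n true i j /\
      (v = comb alpha (coef_B i j s) \/ v = - comb alpha (coef_B i j s)).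
  by move=> vv hw ew; exists i, j, true; rewrite comb_coef_B // ew.
case: (roots_BC hPhi halpha n0 q0 (oner_neq0 R) gram_B dot_last_B dot_last_last_B last_B hv).
  move=> [i [m [im mN]]]; rewrite -/e => hw.
  have vsub : valid n true i m.-1 by rewrite /valid; nlia.
  have vadd : valid n true i (n + n + 1 - m)%N by rewrite /valid; nlia.
  case: hw => [esub|eadd].
    apply: (main i m.-1 _ vsub esub); have -> : (m.-1 < n)%N by nlia.
    by rewrite prednK //; nlia.
  apply: (main i (n + n + 1 - m)%N _ vadd eadd).
  have -> : (n + n + 1 - m < n)%N = false by nlia.
  have -> : (n + n + 1 - m == n)%N = false by nlia.
  by congr (_ + axis _ _ _ _); nlia.
move=> [i iN]; rewrite -/e scale1r => hw; have vm : valid n true i n by rewrite /valid; nlia.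
by apply: (main i n _ vm hw); rewrite ltnn eqxx.
Qed.

Lemma coef_B_le i j s i' j' s' : valid n true i j -> valid n true i' j' ->
  (forall k, (k < n.+1)%N -> (coef_B i j s k <= coef_B i' j' s' k)%N) <->
  [&& (i' <= i)%N, (j <= j')%N & compat n false j s j' s'].
Proof.
rewrite /valid /coef_B /compat /= !andbT => /andP[ij ijn] /andP[ij' ijn'].
split=> [le|/andP[ii jj] k kr]; last by rewrite /fold_coef; case: ltnP => kn; nlia.
have := le n (ltnSn n); rewrite ltnn => hn.
have lek k : (k < n)%N -> (fold_coef n 1 i j k <= fold_coef n 1 i' j' k)%N.
  by move=> kn; have := le k (leqW kn); rewrite kn.
have [h1 h2 h3] := fold_coef_le (leqnn 1) ij ijn ij' ijn' lek.
apply/andP; split; first by case: (ltnP i n) => [/h1//|]; clear h1 h2 h3 le lek; nlia.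
by case: (ltnP j n) => [/h2//|]; case: (ltnP (n + 1) j) => [/h3//|]; clear h1 h2 h3 le lek; nlia.
Qed.

Lemma coef_B_sum i j s : valid n true i j -> (\sum_(k < n.+1) coef_B i j s k = (j - i).+1)%N.
Proof.
move=> v; rewrite big_ord_recr /= /coef_B ltnn; under eq_bigr => k _ do rewrite ltn_ord.
by rewrite sum_fold_coef; rewrite /valid in v; nlia.
Qed.

Let le := root_le alpha.
Let rk := root_rank alpha.
Let pos := pos_roots alpha.
Let el := coef_root alpha coef_B (alpha ord0).

Lemma triangle_B : folded_triangle le rk pos n false true el.
Proof. exact: (coef_folded_triangle hPhi halpha coef_B_in coef_B_onto coef_B_le coef_B_sum). Qed.

Lemma norm_B i j s : valid n true i j ->
  dotv (fsval (el i j s)) (fsval (el i j s)) = if j == n then q else 2 * q.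
Proof.
move=> v; rewrite /el (coef_rootE coef_B_in) // comb_coef_B //; rewrite /valid in v.
have dot := axis_orthogonal gram_B dot_last_B dot_last_last_B; rewrite -/e in dot.
have iN : (i < n.+1)%N by nlia.
have [jn|jn|_] := ltngtP j n; last by rewrite dot // eqxx mulr1.
- have jN : (j.+1 < n.+1)%N by nlia.
  rewrite (dotvBl (e i)) !(dotvBr (e i)) !dot // !eqxx.
  have -> : (i == j.+1) = false by nlia.
  have -> : (j.+1 == i) = false by nlia.
  by rewrite /=; ring.
- have jN : (n + n + 1 - j < n.+1)%N by nlia.
  rewrite (dotvDl (e i)) !(dotvDr (e i)) !dot // !eqxx.
  have -> : (i == n + n + 1 - j)%N = false by nlia.
  have -> : (n + n + 1 - j == i)%N = false by nlia.
  by rewrite /=; ring.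
Qed.

Lemma short_B i j s : valid n true i j -> short_root (el i j s) = (j == n).
Proof.
move=> v; have n2 : (1 < n.+1)%N by nlia.
rewrite /short_root (long_rootE (Q := 2 * q) (v := a 0%N)).
- rewrite norm_B //; have := q_gt0_B; case: eqP => _ qp; last by rewrite lexx.
  by rewrite -ltNge mulr2n mulrDl !mul1r ltrDl.
- move=> w hw; have [i' [j' [s' [v' e']]]] := coef_B_onto hw.
  have -> : dotv w w = dotv (fsval (el i' j' s')) (fsval (el i' j' s')).
    by rewrite /el (coef_rootE coef_B_in) //; case: e' => ->; rewrite ?dotvNl ?dotvNr ?opprK.
  by rewrite norm_B //; have := q_gt0_B; case: ifP => _ qp; lra.
- exact: simple_in.
- exact: (dotv_chain gram_B).
Qed.

Lemma count_short_B (A : {set Phi}) : A \in antichains le pos ->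
  (#|[set b in A | short_root b]| + #|[set b in rowvacuation le rk pos A | short_root b]|)%N = 1%N.
Proof.
move=> hA; have shortE (B : {set Phi}) : B \in antichains le pos ->
    [set b in B | short_root b] = B :&: column n true el n.
  move=> /antichainP[BP _]; apply/setP=> x; rewrite in_set in_setI.
  case: (boolP (x \in B)) => //= xB.
  have [i [j [s [v ->]]]] := el_onto triangle_B (subsetP BP x xB).
  by rewrite short_B // (mem_column (root_le_refl alpha) triangle_B).
rewrite !shortE //; last first.
  exact: (rowvacuation_antichain (root_le_refl alpha) (root_le_anti halpha)
    (@root_le_trans _ _ _ _ alpha) (graded_triangle (root_le_anti halpha) triangle_B) hA).
by case: (card_middle_rowvacuation (root_le_refl alpha) (root_le_anti halpha)
    (@root_le_trans _ _ _ _ alpha) triangle_B hA).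
Qed.

Lemma coxeter_number_B : h = (n.+1 + n.+1)%N.
Proof.
exact: (coxeter_number_BC hPhi halpha n0 hh q0 (oner_neq0 R) gram_B dot_last_B dot_last_last_B last_B).
Qed.

End TypeB.

(** * Type C *)

Section TypeC.
Variables (R : realFieldType) (d : nat) (Phi : {fset 'rV[R]_d}) (n h : nat)
  (alpha : 'I_n.+1 -> Phi).
Hypotheses (hPhi : is_root_system Phi) (halpha : is_simple_system alpha)
  (n0 : (0 < n)%N) (hh : is_coxeter_number alpha h)
  (cartan : forall k l, (k < n.+1)%N -> (l < n.+1)%N ->
     coroot_pairing (simple alpha k) (simple alpha l) = (cartan_entry TypeC n.+1 k l)%:~R).

Let a := simple alpha.
Let q := dotv (a 0%N) (a 0%N) / 2.

Lemma q_gt0_C : 0 < q.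
Proof.
rewrite divr_gt0 ?ltr0n // lt_def dotv_ge0 dotv_eq0 andbT.
by apply: (root_in_neq0 hPhi); apply: simple_in.
Qed.

Lemma gram_C k l : (k.+1 < n.+1)%N -> (l.+1 < n.+1)%N ->
  dotv (a k) (a l) = q * (2 * (k == l)%:R - (k == l.+1)%:R - (l == k.+1)%:R).
Proof.
apply: (gram_of_cartan hPhi n0 (leqnSn n)) => {}k {}l kn ln.
rewrite cartan ?(leqW kn) ?(leqW ln) //=.
have -> : (k.+1 == n.+1) = false by nlia.
by [].
Qed.

Let f := 2^-1 *: a n.

Lemma dot_last_C k : (k.+1 < n.+1)%N -> dotv (a k) f = - q * (k.+2 == n.+1)%:R.
Proof.
move=> kn; have := cartan (ltnSn n) (leqW (kn : k < n)%N); rewrite -/a /= eqxx /=.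
move=> /(dotv_pairing (root_in_neq0 hPhi (simple_in alpha (leqW (kn : k < n)%N)))).
rewrite /f dotvZr dotvC (dotv_chain gram_C kn) => ->.
case: (eqVneq k.+2 n.+1) => [_|ne2]; first by rewrite mulr1; field.
rewrite cartan_AE; have -> : (n == k) = false by nlia.
have -> : (n == k.+1) = false by nlia.
have -> : (k == n.+1) = false by nlia.
by rewrite !mulr0 !subr0 !mul0r mulr0.
Qed.

Lemma dot_last_last_C : dotv f f = q.
Proof.
have n1 : (n.-1.+1 < n.+1)%N by nlia.
have := cartan (ltnW n1) (ltnSn n); rewrite -/a /= prednK //.
have -> : (n == n.+1) = false by nlia.
move=> /= /(dotv_pairing (root_in_neq0 hPhi (simple_in alpha (ltnSn n)))).
have := dot_last_C n1; rewrite prednK // eqxx mulr1 cartan_AE prednK // eqxx.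
have -> : (n.-1 == n) = false by nlia.
have -> : (n.-1 == n.+1) = false by nlia.
rewrite /f !dotvZr dotvZl -/a; set x := dotv (a n) (a n); set y := dotv (a n.-1) (a n).
rewrite mulr0 !subr0 sub0r mulr1n => e1 e2; lra.
Qed.

Let q0 : q != 0. Proof. by rewrite lt0r_neq0 // q_gt0_C. Qed.
Let two0 : (2 : R) != 0. Proof. by rewrite pnatr_eq0. Qed.
Let last_C : a n = 2 *: f. Proof. by rewrite /f scalerA mulfV ?scale1r. Qed.
Let e := axis a n.+1 f.

(** The long simple root is taken once and the other nodes repeat immediately after it: the
    coefficients count the visits of the folded path, with shift 0. *)
Definition coef_C (i j : nat) (s : bool) (k : nat) : nat :=
  if (k < n)%N then fold_coef n 0 i j k else (n <= j)%N.

Lemma comb_coef_C i j s : valid n true i j -> comb alpha (coef_C i j s) =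
  if (j < n)%N then e i - e j.+1 else e i + e (n + n - j)%N.
Proof.
move=> v; rewrite /comb big_ord_recr /= /coef_C ltnn.
under eq_bigr => k _ do rewrite ltn_ord.
rewrite (sum_fold_chain a f (ltnSn n)) //; try by rewrite /valid in v; nlia.
have en : a n = e n *+ 2 by rewrite /e (axis_last a n.+1 f) -scaler_nat.
rewrite -/a -/e en addn0; have [jn|nj] := ltnP j n => /=.
- have -> : minn j.+1 n = j.+1 by nlia.
  have -> : minn (n + n - j) n = n by nlia.
  by rewrite addr0 subrr addr0.
- have -> : minn j.+1 n = n by nlia.
  have -> : minn (n + n - j) n = (n + n - j)%N by nlia.
  by rewrite mulr2n addrACA !subrK.
Qed.

Lemma coef_C_in i j s : valid n true i j -> comb alpha (coef_C i j s) \in Phi.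
Proof.
move=> v; rewrite comb_coef_C //; rewrite /valid in v.
have [jn|nj] := ltnP j n.
  by apply: (axis_sub_root hPhi (leqnSn _) q0 gram_C dot_last_C); nlia.
have [ei|ne] := eqVneq i (n + n - j)%N; last first.
  by apply: (add_root_BC hPhi n0 q0 two0 gram_C dot_last_C dot_last_last_C last_C); nlia.
rewrite -ei -mulr2n -scaler_nat.
by apply: (scale_root_BC hPhi q0 gram_C dot_last_C last_C); nlia.
Qed.

Lemma coef_C_onto v : v \in Phi -> exists i j s, valid n true i j /\
  (v = comb alpha (coef_C i j s) \/ v = - comb alpha (coef_C i j s)).
Proof.
move=> hv; have main i j w : valid n true i j -> v = w \/ v = - w ->
    (if (j < n)%N then e i - e j.+1 else e i + e (n + n - j)%N) = w ->
    exists i j s, valid n true i j /\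
      (v = comb alpha (coef_C i j s) \/ v = - comb alpha (coef_C i j s)).
  by move=> vv hw ew; exists i, j, true; rewrite comb_coef_C // ew.
have add i m : (i <= m)%N -> (m < n.+1)%N -> v = e i + e m \/ v = - (e i + e m) ->
    exists i j s, valid n true i j /\
      (v = comb alpha (coef_C i j s) \/ v = - comb alpha (coef_C i j s)).
  move=> im mN eadd; have vadd : valid n true i (n + n - m)%N by rewrite /valid; nlia.
  apply: (main i (n + n - m)%N _ vadd eadd).
  have -> : (n + n - m < n)%N = false by nlia.
  by congr (_ + axis _ _ _ _); nlia.
case: (roots_BC hPhi halpha n0 q0 two0 gram_C dot_last_C dot_last_last_C last_C hv).
  move=> [i [m [im mN]]]; rewrite -/e => hw.
  have vsub : valid n true i m.-1 by rewrite /valid; nlia.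
  case: hw => [esub|eadd].
    apply: (main i m.-1 _ vsub esub); have -> : (m.-1 < n)%N by nlia.
    by rewrite prednK //; nlia.
  exact: (add i m (ltnW im) mN eadd).
by move=> [i iN]; rewrite -/e scaler_nat mulr2n; apply: add.
Qed.

Lemma coef_C_le i j s i' j' s' : valid n true i j -> valid n true i' j' ->
  (forall k, (k < n.+1)%N -> (coef_C i j s k <= coef_C i' j' s' k)%N) <->
  [&& (i' <= i)%N, (j <= j')%N & compat n false j s j' s'].
Proof.
rewrite /valid /coef_C /compat /= !andbT => /andP[ij ijn] /andP[ij' ijn'].
split=> [le|/andP[ii jj] k kr]; last by rewrite /fold_coef; case: ltnP => kn; nlia.
have := le n (ltnSn n); rewrite ltnn => hn.
have lek k : (k < n)%N -> (fold_coef n 0 i j k <= fold_coef n 0 i' j' k)%N.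
  by move=> kn; have := le k (leqW kn); rewrite kn.
have [h1 h2 h3] := fold_coef_le (leq0n 1) ij ijn ij' ijn' lek.
apply/andP; split; first by case: (ltnP i n) => [/h1//|]; clear h1 h2 h3 le lek; nlia.
by case: (ltnP j n) => [/h2//|]; case: (ltnP (n + 0) j) => [/h3//|]; clear h1 h2 h3 le lek; nlia.
Qed.

Lemma coef_C_sum i j s : valid n true i j -> (\sum_(k < n.+1) coef_C i j s k = (j - i).+1)%N.
Proof.
move=> v; rewrite big_ord_recr /= /coef_C ltnn; under eq_bigr => k _ do rewrite ltn_ord.
by rewrite sum_fold_coef; rewrite /valid in v; nlia.
Qed.

Let le := root_le alpha.
Let rk := root_rank alpha.
Let pos := pos_roots alpha.
Let el := coef_root alpha coef_C (alpha ord0).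

Lemma triangle_C : folded_triangle le rk pos n false true el.
Proof. exact: (coef_folded_triangle hPhi halpha coef_C_in coef_C_onto coef_C_le coef_C_sum). Qed.

Lemma norm_C i j s : valid n true i j ->
  dotv (fsval (el i j s)) (fsval (el i j s)) = if (i + j == n + n)%N then 4 * q else 2 * q.
Proof.
move=> v; rewrite /el (coef_rootE coef_C_in) // comb_coef_C //; rewrite /valid in v.
have dot := axis_orthogonal gram_C dot_last_C dot_last_last_C; rewrite -/e in dot.
have iN : (i < n.+1)%N by nlia.
have [jn|nj] := ltnP j n.
  have jN : (j.+1 < n.+1)%N by nlia.
  rewrite (dotvBl (e i)) !(dotvBr (e i)) !dot // !eqxx.
  have -> : (i == j.+1) = false by nlia.
  have -> : (j.+1 == i) = false by nlia.
  have -> : (i + j == n + n)%N = false by nlia.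
  by rewrite /=; ring.
have jN : (n + n - j < n.+1)%N by nlia.
rewrite (dotvDl (e i)) !(dotvDr (e i)) !dot // !eqxx [(_ - _)%N == i]eq_sym.
have -> : (i == n + n - j)%N = (i + j == n + n)%N by nlia.
by case: eqP => _ /=; ring.
Qed.

Lemma short_C i j s : valid n true i j -> short_root (el i j s) = (i + j != n + n)%N.
Proof.
move=> v; rewrite /short_root (long_rootE (Q := 4 * q) (v := a n)).
- rewrite norm_C //; congr (~~ _); have := q_gt0_C; case: eqP => _ qp; first by rewrite lexx.
  by apply/negbTE; rewrite -ltNge ltr_pM2r // ltr_nat.
- move=> w hw; have [i' [j' [s' [v' e']]]] := coef_C_onto hw.
  have -> : dotv w w = dotv (fsval (el i' j' s')) (fsval (el i' j' s')).
    by rewrite /el (coef_rootE coef_C_in) //; case: e' => ->; rewrite ?dotvNl ?dotvNr ?opprK.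
  by rewrite norm_C //; have := q_gt0_C; case: ifP => _ qp; lra.
- exact: simple_in.
- by rewrite last_C dotvZl dotvZr dot_last_last_C; ring.
Qed.

(** The long roots are the central intervals, of which [A] and its image have exactly one together;
    the short ones are the rest of the total [n.+1]. *)
Lemma count_short_C (A : {set Phi}) : A \in antichains le pos ->
  (#|[set b in A | short_root b]| + #|[set b in rowvacuation le rk pos A | short_root b]|)%N = n.
Proof.
move=> hA; have shortE (B : {set Phi}) : B \in antichains le pos ->
    [set b in B | short_root b] = B :\: centre n true el.
  move=> /antichainP[BP _]; apply/setP=> x; rewrite in_set in_setD andbC.
  case: (boolP (x \in B)) => xB; rewrite ?andbF //=.
  have [i [j [s [v ->]]]] := el_onto triangle_C (subsetP BP x xB).
  by rewrite short_C // (mem_centre (root_le_refl alpha) triangle_C) ?andbT.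
rewrite !shortE //; last first.
  exact: (rowvacuation_antichain (root_le_refl alpha) (root_le_anti halpha)
    (@root_le_trans _ _ _ _ alpha) (graded_triangle (root_le_anti halpha) triangle_C) hA).
have [//|//|_ one] := card_middle_rowvacuation (root_le_refl alpha) (root_le_anti halpha)
    (@root_le_trans _ _ _ _ alpha) triangle_C hA.
have := card_rowvacuation (root_le_refl alpha) (root_le_anti halpha)
    (@root_le_trans _ _ _ _ alpha) triangle_C hA.
rewrite -(cardsID (centre n true el) A) -(cardsID (centre n true el) (rowvacuation _ _ _ _)) /=.
by rewrite addnACA one addn1 add1n => -[].
Qed.

Lemma coxeter_number_C : h = (n.+1 + n.+1)%N.
Proof.
exact: (coxeter_number_BC hPhi halpha n0 hh q0 two0 gram_C dot_last_C dot_last_last_C last_C).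
Qed.

End TypeC.

(** * Type D *)

Section TypeD.
Variables (R : realFieldType) (d : nat) (Phi : {fset 'rV[R]_d}) (n h : nat)
  (alpha : 'I_n.+2 -> Phi).
Hypotheses (hPhi : is_root_system Phi) (halpha : is_simple_system alpha)
  (n0 : (0 < n)%N) (hh : is_coxeter_number alpha h)
  (cartan : forall k l, (k < n.+2)%N -> (l < n.+2)%N ->
     coroot_pairing (simple alpha k) (simple alpha l) = (cartan_entry TypeD n.+2 k l)%:~R).

Let a := simple alpha.
Let q := dotv (a 0%N) (a 0%N) / 2.

Let q0 : q != 0.
Proof.
rewrite mulf_neq0 ?invr_neq0 ?pnatr_eq0 // dotv_eq0.
by apply: (root_in_neq0 hPhi); apply: simple_in.
Qed.

Lemma gram_D k l : (k.+1 < n.+2)%N -> (l.+1 < n.+2)%N ->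
  dotv (a k) (a l) = q * (2 * (k == l)%:R - (k == l.+1)%:R - (l == k.+1)%:R).
Proof.
apply: (gram_of_cartan hPhi (ltn0Sn n) (leqnSn n.+1)) => {}k {}l kn ln.
rewrite cartan ?(leqW kn) ?(leqW ln) //= /cartan_A /edge_D; congr (_%:~R).
have -> : (l.+1 < n.+2)%N by nlia.
have -> : (k.+1 < n.+2)%N by nlia.
have -> : (l.+1 == n.+2) = false by nlia.
have -> : (k.+1 == n.+2) = false by nlia.
by rewrite !andbT !andbF !orbF orbC.
Qed.

Lemma dot_fork k : (k < n.+1)%N ->
  dotv (a k) (a n.+1) = - q * (k.+1 == n)%:R /\ dotv (a n.+1) (a n.+1) = 2 * q.
Proof.
have nz k' : (k' < n.+2)%N -> a k' != 0.
  by move=> kN; apply: (root_in_neq0 hPhi); apply: simple_in.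
have pair1 k' : (k' < n.+1)%N -> dotv (a k') (a n.+1) = - q * (k'.+1 == n)%:R.
  move=> kn; rewrite dotvC (dotv_pairing (nz _ (leqW kn)) (cartan (ltnSn _) (leqW kn))).
  rewrite (dotv_chain gram_D kn) /= /edge_D.
  have -> : (n.+1 == k') = false by nlia.
  have -> : (k' == n.+2) = false by nlia.
  have -> : (n.+4 == n.+2) = false by nlia.
  rewrite ltnn andbF eqxx andbT !orbF /= !eqSS.
  by case: eqP => _; rewrite ?mulrN1z ?mulr0z /= ?mulr1 ?mulr0 ?mul0r //; field.
move=> kn; split; first exact: pair1.
have n1 : (n.-1 < n.+1)%N by nlia.
have := dotv_pairing (nz _ (ltnSn _)) (cartan (leqW n1) (ltnSn _)); rewrite -/a pair1 // /= /edge_D.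
have -> : (n.-1 == n.+1) = false by nlia.
rewrite prednK // eqxx ltnn andbF eqxx /= mulrN1z mulr1.
by set x := dotv _ _ => e; lra.
Qed.

(** The two roots of the fork are the sum and the difference of the last two axes, so half of this
    difference is the last axis. *)
Let f := 2^-1 *: (a n.+1 - a n).

Lemma dot_last_D k : (k.+1 < n.+2)%N -> dotv (a k) f = - q * (k.+2 == n.+2)%:R.
Proof.
move=> kn; rewrite /f dotvZr dotvBr [dotv (a k) (a n)](gram_D kn) // (dot_fork kn).1 !eqSS [n == k.+1]eq_sym.
have -> : (k == n.+1) = false by nlia.
by rewrite /=; field.
Qed.

Lemma dot_last_last_D : dotv f f = q.
Proof.
rewrite /f dotvZl dotvZr dotvBl !dotvBr [dotv (a n.+1) (a n)]dotvC.
have [-> ->] := dot_fork (ltnSn n); rewrite (dotv_chain gram_D) //.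
have -> : (n.+1 == n) = false by nlia.
by rewrite /=; field.
Qed.

Let e := axis a n.+2 f.
Let sx := signed_axis a n.+2 f.

Lemma axis_fork : e n + e n.+1 = a n.+1.
Proof.
have el : e n.+1 = f by rewrite /e (axis_last a n.+2 f).
rewrite {1}/e (axisS a f (ltnSn n.+1)) -/e el /f -addrA -mulr2n -scaler_nat scalerA mulfV ?pnatr_eq0 //.
by rewrite scale1r addrCA subrr addr0.
Qed.

Lemma chain_signed_D k b i : (k < n.+1)%N -> (i < n.+2)%N ->
  reflection (a k) (sx b i) = sx b (swap k i).
Proof. by move=> kn iN; apply: (reflection_signed_chain q0 gram_D dot_last_D). Qed.

Lemma fork_signed b i : (i < n.+2)%N ->
  reflection (a n.+1) (sx b i) = sx (b (+) ((i == n) || (i == n.+1))) (swap n i).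
Proof.
by rewrite -axis_fork; apply: (reflection_signed_sum q0 gram_D dot_last_D dot_last_last_D).
Qed.

Lemma sub_root_D i m : (i < m)%N -> (m < n.+2)%N -> e i - e m \in Phi.
Proof. exact: (axis_sub_root hPhi (leqnSn _) q0 gram_D dot_last_D). Qed.

Lemma add_root_D i m : (i < m)%N -> (m < n.+2)%N -> e i + e m \in Phi.
Proof.
apply: (axis_add_root hPhi (leqnSn _) q0 gram_D dot_last_D) => l /= ln.
have [lt|->] : (l < n)%N \/ l = n by nlia.
  have := reflection_in hPhi (simple_in alpha (ltnSn n.+1)) (sub_root_D lt (leqW (leqnn _))).
  rewrite -/a /e opp_axis_signed axis_signed -/sx reflectionD !fork_signed ?eqxx //; last by nlia.
  have -> : (l == n) = false by nlia.
  have -> : (l == n.+1) = false by nlia.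
  rewrite /swap eqxx; have -> : (l == n) = false by nlia.
  have -> : (l == n.+1) = false by nlia.
  by rewrite /= /sx -!axis_signed.
by rewrite -/e axis_fork; apply: simple_in.
Qed.

Lemma roots_D v : v \in Phi -> exists i m, [/\ (i < m)%N, (m < n.+2)%N &
  (v = e i - e m \/ v = - (e i - e m)) \/ (v = e i + e m \/ v = - (e i + e m))].
Proof.
pose Q w := exists i m b b', [/\ (i < n.+2)%N, (m < n.+2)%N, i != m & w = sx b i + sx b' m].
move=> hv; have [i [m [b [b' [iN mN im ->]]]]] : Q v.
  apply: (simple_reflection_ind hPhi halpha (Q := Q)) hv => [k kr|w|k w kr].
  - have [kn|nk] := ltnP k n.+1.
      exists k, k.+1, false, true; split=> //; first by nlia.
      by rewrite /sx -axis_signed -opp_axis_signed -/a (chainE a f (N := n.+2)).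
    exists n, n.+1, false, false; split=> //; first by nlia.
    have -> : k = n.+1 by nlia.
    by rewrite /sx -!axis_signed -/e axis_fork.
  - move=> [i [m [b [b' [iN mN im ->]]]]].
    by exists i, m, (~~ b), (~~ b'); split=> //; rewrite opprD /sx !signed_axisN.
  - move=> [i [m [b [b' [iN mN im ->]]]]]; have [kn|nk] := ltnP k n.+1.
      exists (swap k i), (swap k m), b, b'.
      by rewrite reflectionD !chain_signed_D // !swap_lt // swap_eq.
    have -> : k = n.+1 by nlia.
    exists (swap n i), (swap n m), (b (+) ((i == n) || (i == n.+1))), (b' (+) ((m == n) || (m == n.+1))).
    by rewrite reflectionD !fork_signed // !swap_lt // swap_eq.
exact: signed_axis_pair.
Qed.

Lemma coxeter_signed_D b i : (i < n.+1)%N -> coxeter_element alpha (sx b i) =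
  if (i.+1 < n.+1)%N then sx b i.+1 else sx (~~ b) 0.
Proof.
move=> iN; rewrite coxeter_elementE chain_productS -/a fork_signed ?(leqW iN) //.
rewrite (chain_product_signed q0 gram_D dot_last_D) //; last by rewrite swap_lt // leqW.
have -> : (i == n.+1) = false by nlia.
rewrite orbF /swap [(i.+1 < _)%N]ltnS; have [lt|ge] := ltnP i n.
  have -> : (i == n) = false by nlia.
  have -> : (i == n.+1) = false by nlia.
  by rewrite iN addbF.
have -> : i = n by nlia.
by rewrite eqxx ltnn eqxx addbT.
Qed.

Lemma coxeter_last_D b : coxeter_element alpha (sx b n.+1) = sx (~~ b) n.+1.
Proof.
rewrite coxeter_elementE chain_productS -/a fork_signed //.
rewrite (chain_product_signed q0 gram_D dot_last_D) //; last by rewrite swap_lt.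
rewrite eqxx orbT addbT /swap eqxx.
have -> : (n.+1 == n) = false by nlia.
by rewrite ltnSn.
Qed.

(** The Coxeter element is a signed cycle on the first [n.+1] axes and changes the sign of the last
    one, which an even power undoes. *)
Lemma coxeter_number_D : h = (n.+1 + n.+1)%N.
Proof.
apply: (coxeter_number_unique hPhi halpha hh) => // [|m m0 mN]; last first.
  exists (e 0%N).
  by apply: (iter_cycle_neq q0 gram_D dot_last_D dot_last_last_D (ltn0Sn n) (leqnSn _) coxeter_signed_D).
have last_axis m b : iter m (coxeter_element alpha) (sx b n.+1) = sx (odd m (+) b) n.+1.
  by elim: m => //= m ->; rewrite coxeter_last_D addNb.
have fix_axis i : (i < n.+2)%N -> iter (n.+1 + n.+1) (coxeter_element alpha) (e i) = e i.
  move=> iN; rewrite /e axis_signed; have [lt|ge] := ltnP i n.+1.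
    by apply: (iter_full_cycle (ltn0Sn n) (leqnSn _) coxeter_signed_D).
  have -> : i = n.+1 by nlia.
  by rewrite last_axis addnn odd_double.
have lin := coxeter_linear alpha (n.+1 + n.+1).
move=> k kr; rewrite -/a; have [kn|nk] := ltnP k n.+1.
  have -> : a k = (-1) *: e k.+1 + e k by rewrite scaleN1r addrC; apply: chainE.
  by rewrite lin !fix_axis ?(leqW kn).
have -> : a k = 1 *: e n + e n.+1 by rewrite scale1r axis_fork; congr a; nlia.
by rewrite lin !fix_axis.
Qed.

(** In the middle column the sign [true] selects node [n] and [false] node [n.+1]. Column [n.+1]
    contains both, which gives the same shift as in type B. *)
Definition coef_D (i j : nat) (s : bool) (k : nat) : nat :=
  if (k < n)%N then fold_coef n 1 i j k
  else ((n < j) || (j == n) && (s == (k == n)))%N.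

Lemma comb_coef_D i j s : valid n true i j -> comb alpha (coef_D i j s) =
  if (j < n)%N then e i - e j.+1
  else if j == n then (if s then e i - e n.+1 else e i + e n.+1)
  else e i + e (n + n + 1 - j)%N.
Proof.
move=> v; rewrite /comb !big_ord_recr /= /coef_D ltnn.
under eq_bigr => k _ do rewrite ltn_ord.
rewrite (sum_fold_chain a f (leqW (ltnSn n))) //; try by rewrite /valid in v; nlia.
have -> : (n.+1 < n)%N = false by nlia.
have -> : (n.+1 == n)%N = false by nlia.
rewrite -/a -/e -axis_fork eqxx (chainE a f (ltnSn n.+1)) -/e.
have [jn|jn|->] := ltngtP j n => /=.
- have -> : minn j.+1 n = j.+1 by nlia.
  have -> : minn (n + n + 1 - j) n = n by nlia.
  by rewrite !addr0 subrr addr0.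
- have -> : minn j.+1 n = n by nlia.
  have -> : minn (n + n + 1 - j) n = (n + n + 1 - j)%N by nlia.
  by rewrite !mulr1n -addrA [X in _ + X = _]addrACA addNr addr0 addrACA !subrK.
- have -> : minn n.+1 n = n by nlia.
  have -> : minn (n + n + 1 - n) n = n by nlia.
  by rewrite subrr addr0; case: s; rewrite /= ?addr0 addrA subrK.
Qed.

Lemma coef_D_in i j s : valid n true i j -> comb alpha (coef_D i j s) \in Phi.
Proof.
move=> v; rewrite comb_coef_D //; rewrite /valid in v.
have [jn|jn|_] := ltngtP j n.
- by apply: sub_root_D; nlia.
- by apply: add_root_D; nlia.
- by case: s; [apply: sub_root_D | apply: add_root_D]; nlia.
Qed.

Lemma coef_D_onto v : v \in Phi -> exists i j s, valid n true i j /\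
  (v = comb alpha (coef_D i j s) \/ v = - comb alpha (coef_D i j s)).
Proof.
move=> hv; have main i j s w : valid n true i j -> v = w \/ v = - w ->
    (if (j < n)%N then e i - e j.+1
     else if j == n then (if s then e i - e n.+1 else e i + e n.+1)
     else e i + e (n + n + 1 - j)%N) = w ->
    exists i j s, valid n true i j /\
      (v = comb alpha (coef_D i j s) \/ v = - comb alpha (coef_D i j s)).
  by move=> vv hw ew; exists i, j, s; rewrite comb_coef_D // ew.
have [i [m [im mN hw]]] := roots_D hv.
have [mn|mn] := ltnP m n.+1; last first.
  have em : m = n.+1 by nlia.
  have vm : valid n true i n by rewrite /valid; nlia.
  rewrite em in hw; case: hw => hw; [apply: (main i n true _ vm hw) | apply: (main i n false _ vm hw)].
    by rewrite ltnn eqxx.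
  by rewrite ltnn eqxx.
have vsub : valid n true i m.-1 by rewrite /valid; nlia.
have vadd : valid n true i (n + n + 1 - m)%N by rewrite /valid; nlia.
case: hw => hw.
  apply: (main i m.-1 true _ vsub hw); have -> : (m.-1 < n)%N by nlia.
  by rewrite prednK //; nlia.
apply: (main i (n + n + 1 - m)%N true _ vadd hw).
have -> : (n + n + 1 - m < n)%N = false by nlia.
have -> : (n + n + 1 - m == n)%N = false by nlia.
by congr (_ + axis _ _ _ _); nlia.
Qed.

Lemma coef_D_le i j s i' j' s' : valid n true i j -> valid n true i' j' ->
  (forall k, (k < n.+2)%N -> (coef_D i j s k <= coef_D i' j' s' k)%N) <->
  [&& (i' <= i)%N, (j <= j')%N & compat n true j s j' s'].
Proof.
rewrite /valid /coef_D /compat /= !andbT => /andP[ij ijn] /andP[ij' ijn'].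
split=> [le|/and3P[ii jj c] k kr]; last first.
  rewrite /fold_coef; case: ltnP => kn; first by clear c; nlia.
  by clear kr; case: (k == n); case: s s' c => -[] /=; nlia.
have lek k : (k < n)%N -> (fold_coef n 1 i j k <= fold_coef n 1 i' j' k)%N.
  by move=> kn; have := le k (leqW (leqW kn)); rewrite kn.
have [h1 h2 h3] := fold_coef_le (leqnn 1) ij ijn ij' ijn' lek.
have := le n (leqW (ltnSn n)); have := le n.+1 (ltnSn _); rewrite ltnn eqxx.
have -> : (n.+1 < n)%N = false by nlia.
have -> : (n.+1 == n)%N = false by nlia.
move=> hn1 hn; clear le.
have ii : (i' <= i)%N by case: (ltnP i n) => [/h1//|]; clear h1 h2 h3 lek; nlia.
rewrite ii /=; case: (ltnP j n) => [jn|jn].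
  by have -> : (j == n) = false by [nlia]; rewrite h2.
case: (ltnP (n + 1) j) => [jn1|jn1].
  by have -> : (j == n) = false by [nlia]; rewrite h3.
by clear h1 h2 h3 lek; case: s s' hn hn1 => -[] /=; nlia.
Qed.

Lemma coef_D_sum i j s : valid n true i j -> (\sum_(k < n.+2) coef_D i j s k = (j - i).+1)%N.
Proof.
move=> v; rewrite !big_ord_recr /= /coef_D ltnn; under eq_bigr => k _ do rewrite ltn_ord.
have -> : (n.+1 < n)%N = false by nlia.
have -> : (n.+1 == n)%N = false by nlia.
by rewrite eqxx sum_fold_coef; rewrite /valid in v; case: s => /=; nlia.
Qed.

Let le := root_le alpha.
Let rk := root_rank alpha.
Let pos := pos_roots alpha.

Lemma triangle_D : folded_triangle le rk pos n true true (coef_root alpha coef_D (alpha ord0)).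
Proof. exact: (coef_folded_triangle hPhi halpha coef_D_in coef_D_onto coef_D_le coef_D_sum). Qed.

Lemma long_D (b : Phi) : long_root b.
Proof.
apply: (all_long hPhi halpha (c := 2 * q)) => k kr; have [kn|nk] := ltnP k n.+1.
  exact: (dotv_chain gram_D).
have -> : k = n.+1 by nlia.
by have [] := dot_fork (ltnSn n).
Qed.

End TypeD.

Theorem theorem1p4 (R : realFieldType) (n : nat) (Phi : {fset 'rV[R]_n})
    (r : nat) (alpha : 'I_r -> Phi) (X : classical_type) (h : nat)
    (hPhi : is_root_system Phi) (halpha : is_simple_system alpha)
    (hX : has_classical_type alpha X) (hh : is_coxeter_number alpha h) :
  let le := root_le alpha in
  let rk := root_rank alpha in
  let pos := pos_roots alpha in
  let par := parabolic_pos_roots alpha in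
  let Rvac := rowvacuation le rk pos in
  forall A : {set Phi}, A \in antichains le pos ->
    (Rvac A \in antichains le pos /\ Rvac (Rvac A) = A) /\
    [/\ (#|A| + #|Rvac A|)%N = r,
        (#|[set b in A | long_root b]| + #|[set b in Rvac A | long_root b]|)%N
          = #|[set b in simple_roots alpha | long_root b]| /\
        (#|[set b in A | short_root b]| + #|[set b in Rvac A | short_root b]|)%N
          = #|[set b in simple_roots alpha | short_root b]|,
        forall i : nat, (i <= h - 1)%N -> A = rank_level rk pos i ->
          Rvac A = rank_level rk pos (h - 1 - i),
        forall k : 'I_r, alpha k \in A ->
          Rvac A = rowvacuation le rk (par k) (A :\ alpha k)
      & forall k : 'I_r, A \subset par k ->
          Rvac A = alpha k |: rowvacuation le rk (par k) A].
Proof.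
have [hr cartan0] := hX.
have cartan k l : (k < r)%N -> (l < r)%N ->
    coroot_pairing (simple alpha k) (simple alpha l) = (cartan_entry X r k l)%:~R.
  by move=> kr lr; rewrite -(cartan0 (Ordinal kr) (Ordinal lr)) -!simpleE.
case: X hr cartan {hX cartan0} => /= hr cartan A hA.
- have hT := triangle_A hPhi halpha hr cartan.
  apply: (conclusion hPhi halpha hT _ _ (nshort := 0)) => // [||B hB].
  + by rewrite /valid /triangle_rank; nlia.
  + by rewrite (coxeter_number_A hPhi halpha hr hh cartan) /triangle_rank; nlia.
  + by rewrite !(short_all_long _ (long_A hPhi halpha hr cartan)).
- case: r alpha halpha hh hr cartan A hA => [|m] // alpha halpha hh hr cartan A hA.
  have m0 : (0 < m)%N by nlia.
  apply: (conclusion hPhi halpha (triangle_B hPhi halpha m0 cartan) _ _ (nshort := 1)) => //.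
  + by rewrite /valid /triangle_rank; nlia.
  + by rewrite (coxeter_number_B hPhi halpha m0 hh cartan) /triangle_rank; nlia.
  + exact: (count_short_B hPhi halpha m0 cartan).
- case: r alpha halpha hh hr cartan A hA => [|m] // alpha halpha hh hr cartan A hA.
  have m0 : (0 < m)%N by nlia.
  apply: (conclusion hPhi halpha (triangle_C hPhi halpha m0 cartan) _ _ (nshort := m)) => //.
  + by rewrite /valid /triangle_rank; nlia.
  + by rewrite (coxeter_number_C hPhi halpha m0 hh cartan) /triangle_rank; nlia.
  + exact: (count_short_C hPhi halpha m0 cartan).
- case: r alpha halpha hh hr cartan A hA => [|[|m]] // alpha halpha hh hr cartan A hA.
  have m0 : (0 < m)%N by nlia.
  have hT := triangle_D hPhi halpha m0 cartan.
  apply: (conclusion hPhi halpha hT _ _ (nshort := 0)) => // [||B hB].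
  + by rewrite /valid /triangle_rank; nlia.
  + by rewrite (coxeter_number_D hPhi halpha m0 hh cartan) /triangle_rank; nlia.
  + by rewrite !(short_all_long _ (long_D hPhi halpha m0 cartan)).
Qed.
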